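(* Fix $r\geq1$, $\mathbf n\in\mathbb Z_{\geq0}^r\setminus\{\mathbf 0\}$, and a 2-permutation $\sigma$ of type $\mathbf n$. Then the associated map $$f_\sigma^W\colon W_{\mathbf n}^W\to \mathrm{FM}_2^W(|\mathbf n|)$$ is cellular.
   Context: **Trees.** A rooted ribbon tree (RRT) is a planar rooted tree $T$, oriented toward its root $\alpha_{\mathrm{root}}$; for each vertex $\alpha$ the set $\mathrm{in}(\alpha)$ of incoming neighbors (children) is linearly ordered. A vertex is interior if $\mathrm{in}(\alpha)\neq\emptyset$, and a leaf otherwise; $T_{\mathrm{int}}$ is the set of interior vertices. $T$ is stable if every interior vertex has at least 2 incoming edges. $K_r^{\mathrm{tree}}$ is the set of isomorphism classes of stable RRTs with $r$ leaves (for $r=1$: the single-vertex tree). The $i$-th leaf is $\lambda_i^T$. For vertices $\alpha,\beta$, $[\alpha,\beta]$ is the path from $\alpha$ to $\beta$, and $[\alpha,\beta)$ is the path with $\beta$ removed. **Stable tree-pairs.** Let $r\geq1$, $\mathbf n=(n_1,\dots,n_r)\in\mathbb Z_{\geq0}^r\setminus\{\mathbf 0\}$, $|\mathbf n|=\sum n_i$. A stable tree-pair of type $\mathbf n$ is $2T=(T_b\xrightarrow{f}T_s)$, where: - The bubble tree $T_b$ is an RRT whose edges are solid or dashed, with vertex set partitioned as $V_{\mathrm{comp}}\sqcup V_{\mathrm{seam}}\sqcup V_{\mathrm{mark}}$. Each $\alpha\in V_{\mathrm{comp}}$ has $\geq1$ solid incoming edge, no dashed incoming edge, and a dashed or no outgoing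 edge. Each $\alpha\in V_{\mathrm{seam}}$ has $\geq0$ dashed incoming edges, no solid incoming edge, and a solid outgoing edge. Each $\alpha\in V_{\mathrm{mark}}$ has no incoming edge and a dashed or no outgoing edge. Write $V_{\mathrm{comp}}=V^1_{\mathrm{comp}}\sqcup V^{\geq2}_{\mathrm{comp}}$ according to the number of incoming edges. Stability: if $\alpha\in V^1_{\mathrm{comp}}$ has incoming neighbor $\beta$, then $\#\mathrm{in}(\beta)\geq2$; if $\alpha\in V^{\geq2}_{\mathrm{comp}}$ has incoming neighbors $\beta_1,\dots,\beta_\ell$, then some $\#\mathrm{in}(\beta_j)\geq1$. - The seam tree $T_s$ is an element of $K_r^{\mathrm{tree}}$. - The coherence map $f\colon T_b\to T_s$ is a map of vertex sets sending root to root, such that: if $\beta\in\mathrm{in}(\alpha)$ then $f(\beta)\in\mathrm{in}(f(\alpha))$ or $f(\beta)=f(\alpha)$; $f$ contracts all dashed edges and every solid edge whose terminal vertex (the one closer to the root) is in $V^1_{\mathrm{comp}}$; for $\alpha\in V_{\mathrm{comp}}^{\geq2}$, $f$ maps the incoming edges of $\alpha$ bijectively and order-preservingly onto those of $f(\alpha)$; $f$ maps $V_{\mathrm{mark}}$ to leaves of $T_s$, and $f^{-1}\{\lambda_i^{T_s}\}$ contains exactly $n_i$ elements of $V_{\mathrm{mark}}$. $W_{\mathbf n}^{\mathrm{tree}}$ is the set of isomorphism classes of stable tree-pairs of type $\mathbf n$. **Metric stable tree-pairs.** A metric stable tree-pair is a stable tree-pair $2T$ with a length $L_e\in[0,1]$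 for every interior dashed edge of $T_b$ (i.e. the outgoing edge of a vertex $\alpha\in V_{\mathrm{comp}}\setminus\{\alpha_{\mathrm{root}}\}$; write $L_\alpha$) and a length $\ell_e\in[0,1]$ for every interior edge of $T_s$ (i.e. the outgoing edge of a non-root interior vertex $\rho$; write $\ell_\rho$), such that (with $\gamma$ in the maxima ranging over $V_{\mathrm{comp}}$): 1. for all $\alpha_1,\alpha_2\in V_{\mathrm{comp}}^{\geq2}$ and $\beta\in V_{\mathrm{comp}}^1$ with $f(\alpha_1)=f(\alpha_2)=f(\beta)$ and $\beta$ lying on the paths from $\alpha_1$ and from $\alpha_2$ to the root: $\max_{\gamma\in[\alpha_1,\beta)}L_\gamma=\max_{\gamma\in[\alpha_2,\beta)}L_\gamma$; 2. for all non-root interior $\rho\in T_s$ and $\alpha\in V_{\mathrm{comp}}^{\geq2}$ with $f(\alpha)=\rho$: $\ell_\rho=\max_{\gamma\in[\alpha,\beta_\alpha)}L_\gamma$, where $\beta_\alpha$ is the first element of $V_{\mathrm{comp}}^{\geq2}$ after $\alpha$ on the path from $\alpha$ to the root. For fixed $2T$, $C_{2T}$ is the set of all metric stable tree-pairs of type $2T$, a closed subset of the cube $[0,1]^m$, $m$ the total number of lengths. **The space $W_{\mathbf n}^W$.** $W_{\mathbf n}^W:=\bigl(\bigsqcup_{2T\in W_{\mathbf n}^{\mathrm{tree}}}C_{2T}\bigr)/\sim$, where two metric stable tree-pairs are identified if they become equal after all zero lengths are eliminated by the following contractions (keeping all other lengths): - (a) if $\alpha\in V^1_{\mathrm{comp}}$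 is non-root with $L_\alpha=0$, $\mathrm{in}(\alpha)=(\gamma)$, and $\beta$ is the outgoing neighbor of $\alpha$, delete $\alpha,\gamma$ and insert the ordered list $\mathrm{in}(\gamma)$ into $\mathrm{in}(\beta)$ in place of $\alpha$; - (b) if a seam vertex $\beta$ has outgoing neighbor $\delta\in V^1_{\mathrm{comp}}$ and $\mathrm{in}(\beta)=(\alpha_1,\dots,\alpha_p)$ with all $\alpha_j\in V_{\mathrm{comp}}^{\geq2}$ (necessarily over the same $\rho\in T_s$) and all $L_{\alpha_j}=0$, write $\mathrm{in}(\alpha_j)=(\gamma_{j1},\dots,\gamma_{jq})$, $q=\#\mathrm{in}(\rho)$; delete $\beta$ and all $\alpha_j$, $\gamma_{jt}$, and give $\delta$ new incoming seam vertices $\gamma_1,\dots,\gamma_q$, where $\mathrm{in}(\gamma_t)$ is the concatenation of $\mathrm{in}(\gamma_{1t}),\dots,\mathrm{in}(\gamma_{pt})$ and $f(\gamma_t)$ is the $t$-th element of $\mathrm{in}(\rho)$ ($\delta$ now lies in $V_{\mathrm{comp}}^{\geq2}$; $T_s$ is unchanged); - (c) if $\ell_\rho=0$, contract the outgoing edge of $\rho$ in $T_s$, and simultaneously, for every seam vertex $\beta$ over $\rho$ whose outgoing neighbor $\delta$ is in $V^{\geq2}_{\mathrm{comp}}$, replace $\beta$, in its position in $\mathrm{in}(\delta)$, by $\gamma_1,\dots,\gamma_q$ formed from $\mathrm{in}(\beta)=(\alpha_1,\dots,\alpha_p)$ as in (b) (after the contractions (a), (b) the $\alpha_j$ are all in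 $V^{\geq2}_{\mathrm{comp}}$ with length 0; $p=0$ is allowed and gives $q$ seam vertices without incoming edges). *Simplicial decomposition.* The open simplices of the standard simplicial decomposition of $[0,1]^m$ are the nonempty sets cut out by $0*x_{\tau(1)}*\cdots*x_{\tau(m)}*1$, where $\tau$ is a permutation and each $*$ is $<$ or $=$. Each open simplex is contained in or disjoint from $C_{2T}$; those contained in it give a simplicial decomposition of $C_{2T}$, and these induce the cell structure on $W_{\mathbf n}^W$. The boundary $\partial W_{\mathbf n}^W$ is the union of the open cells on which at least one length is identically 1; $\mathring W_{\mathbf n}^W$ is its complement. **Forgetting unmarked lines.** Let $\widetilde{\mathbf n}$ be $\mathbf n$ with all zero entries deleted. Define $\pi^W\colon W_{\mathbf n}^W\to W^W_{\widetilde{\mathbf n}}$ by doing the following once for each $i$ with $n_i=0$: delete the $i$-th leaf of $T_s$ and its edge, and delete every solid edge of $T_b$ mapped by $f$ isomorphically onto that edge (with the seam vertex at its far end, which has no incoming edges); then restabilize: in $T_s$, suppress any interior vertex with exactly one incoming edge, merging its incoming and outgoing edges; in $T_b$, whenever $\alpha\in V_{\mathrm{comp}}$ has a single incoming neighbor $\beta$ and $\beta$ has a single incoming neighbor $\gamma$, delete $\alpha,\beta$ and attach $\gamma$ directly by a dashed edge to the outgoing neighbor of $\alpha$; modify $f$ accordingly. When two edges with lengths $\ell_1,\ell_2$ are merged the new edge gets length $\max(\ell_1,\ell_2)$. If the merged edge is not interior it has no length, and if the suppressed vertex is the root, the remaining neighbor ($\gamma$, resp. the remaining child) becomes the root. **The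 maps $q_F$.** For a cell $F$ of $W_{\mathbf n}^W$ lying in $\partial W_{\mathbf n}^W$, cut every tree-pair in $F$ along all edges of $T_b$ and $T_s$ whose length is identically 1 on $F$. Each component of the cut $T_b$, with its component of the cut $T_s$, is a metric stable tree-pair (a vertex at the upper end of a cut edge becomes the root of the upper component, and also serves as a marked vertex, resp. leaf of the seam tree, of the lower component; a component of $T_b$ rooted at $\delta$ is paired with the component of $T_s$ rooted at $f(\delta)$, or with the one-vertex tree when $f$ is constant on it). This gives an element of $W^W_{\mathbf m^1}\times\cdots\times W^W_{\mathbf m^a}$, with one factor per component of the cut $T_b$. Apply $\pi^W$ to each factor; the result is $q_F\colon F\to W^W_{\widetilde{\mathbf m^1}}\times\cdots\times W^W_{\widetilde{\mathbf m^a}}$. (For a cell $F\not\subset\partial W_{\mathbf n}^W$ with $\mathbf n$ having no zero entries, there is nothing to cut or forget and $q_F$ is the identity.) **Getzler–Jones data.** A 2-permutation on a finite set $A$ is an ordered decomposition $A=A_1\sqcup\cdots\sqcup A_r$ ($A_i$ may be empty) with a linear order on each $A_i$; its type is $(|A_1|,\dots,|A_r|)$; it has no empty part if its type has no zero entries. For $k\geq2$, a type-$k$ Getzler–Jones datum is a stable rooted tree $T$ (every interior vertex has at least 2 incoming edges) with $k$ leaves numbered $1,\dots,k$ and, for each $v\in T_{\mathrm{int}}$, a 2-permutation with no empty part, of type denoted $\mathbf n(v)$, on the set of incoming vertices of $v$. Set $$\mathrm{GJ}_T=\prod_{v\in T_{\mathrm{int}}}\mathring W^W_{\mathbf n(v)},\qquad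 \widetilde{\mathrm{GJ}}_T=\prod_{v\in T_{\mathrm{int}}}W^W_{\mathbf n(v)},$$ with simplicial decompositions obtained by decomposing each product $\prod_vC_{2T_v}\subset[0,1]^{\sum_v m_v}$ into the open simplices of the standard simplicial decomposition of $[0,1]^{\sum_v m_v}$ contained in it. **The space $\mathrm{FM}_2^W(k)$.** $\mathrm{FM}_2^W(1)$ is a point. For $k\geq2$, $$\mathrm{FM}_2^W(k)=\Bigl(\coprod_T\widetilde{\mathrm{GJ}}_T\Bigr)/\sim,$$ over type-$k$ Getzler–Jones data $T$, where $\sim$ is generated as follows. Let $F$ be a cell in the boundary of $\widetilde{\mathrm{GJ}}_T$, contained in a product $\prod_vF_v$ of cells $F_v$ of $W^W_{\mathbf n(v)}$. The product of the maps $q_{F_v}$ sends $F$ to a product of spaces $W^W_{\widetilde{\mathbf m}}$, which is regarded as $\widetilde{\mathrm{GJ}}_{T'}$: $T'$ is obtained from $T$ by replacing each $v$ by the tree whose interior vertices are the components of the cut bubble tree at $v$, with the 2-permutation at each component given by grouping its marked vertices according to the leaf of the seam tree they lie over (in order, empty groups discarded); components with only one incoming vertex, whose factor $W^W_{(1)}$ is a point, are suppressed. Each $x\in F$ is identified with its image in $\widetilde{\mathrm{GJ}}_{T'}$. As a set, $\mathrm{FM}_2^W(k)$ is the disjoint union of the $\mathrm{GJ}_T$, and the open cells of its CW structure are the open simplices of the $\mathrm{GJ}_T$. **The map $f_\sigma^W$.** Let $\sigma$ be a 2-permutation of type $\mathbf n$ (on the set $\{1,\dots,|\mathbf n|\}$).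 The associated (forgetful) map $f_\sigma^W$ is defined as follows: first identify $W_{\mathbf n}^W$ with the corresponding $\widetilde{\mathrm{GJ}}_T$, where $T$ is a Getzler–Jones datum whose associated tree is a corolla with $|\mathbf n|$ leaves (with the 2-permutation $\sigma$ at its interior vertex); then include $\widetilde{\mathrm{GJ}}_T$ into the disjoint union $\coprod_T\widetilde{\mathrm{GJ}}_T$; and finally take the quotient to land in $\mathrm{FM}_2^W(|\mathbf n|)$. *)

(* Defs.v *)
From HB Require Import structures.
From Stdlib Require Import Relation_Operators.
From mathcomp Require Import all_boot all_order perm all_algebra.
From mathcomp Require Import all_classical all_reals all_analysis.
Set Implicit Arguments.
Unset Strict Implicit.
Unset Printing Implicit Defensive.
Import Order.TTheory GRing.Theory Num.Theory.
Import numFieldNormedType.Exports.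
Local Open Scope quotient_scope.
Local Open Scope classical_set_scope.
Local Open Scope ring_scope.

Section Mapi.
Variables (A B : Type) (f : nat -> A -> B).
Fixpoint mapi_from (i : nat) (s : seq A) : seq B :=
  if s is x :: s' then f i x :: mapi_from i.+1 s' else [::].
Definition mapi : seq A -> seq B := mapi_from 0.
End Mapi.

Definition gen_equiv (T : Type) (r : T -> T -> Prop) : rel T :=
  fun x y => `[< clos_refl_sym_trans T r x y >].

Lemma gen_equivP (T : Type) (r : T -> T -> Prop) :
  equiv_class_of (gen_equiv r).
Proof.
split=> [x|x y|y x z].
- by apply/asboolP; exact: rst_refl.
- by apply/asboolP/asboolP => h; exact: rst_sym.
- by move=> /asboolP h1 /asboolP h2; apply/asboolP; exact: rst_trans h1 h2.
Qed.

Canonical gen_equiv_rel (T : Type) (r : T -> T -> Prop) :=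
  EquivRelPack (gen_equivP r).

(** Planar rooted trees, so that equality is isomorphism.  The decoration [L]
    of an interior vertex is the length of its outgoing edge ([L := unit] for a
    tree without lengths); at the root it is a dummy, normalized to [0] in
    [metric] below.  The outgoing edge of a leaf carries no length. *)
Inductive stree (L : Type) :=
| SLeaf
| SNode of L & seq (stree L).
Arguments SLeaf {L}.

(** Bubble trees.  [Comp l ss] is a vertex of V_comp whose list of incoming
    (seam) vertices is [ss]; a seam vertex is identified with the list of its
    incoming vertices, each in V_comp or V_mark.  So solid edges join [Comp] to
    the members of [ss], and dashed edges join a seam to its members.  The
    decoration [l] is the length of the (dashed) outgoing edge, with the same
    convention at the root as above.  Marked vertices carry a label in [M],
    with [M := unit] for plain bubble trees. *)
Inductive btree (L M : Type) :=
| Mark of M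
| Comp of L & seq (seq (btree L M)).
Arguments Mark {L M}.
Arguments Comp {L M}.

Section Maps.
Variables (L L' M M' : Type) (g : L -> L') (h : M -> M').
Fixpoint smap (s : stree L) : stree L' :=
  match s with
  | SLeaf => SLeaf
  | SNode l ch => SNode (g l) [seq smap c | c <- ch]
  end.
Fixpoint bmap (b : btree L M) : btree L' M' :=
  match b with
  | Mark m => Mark (h m)
  | Comp l ss => Comp (g l) [seq [seq bmap c | c <- s] | s <- ss]
  end.
End Maps.

HB.instance Definition _ L := gen_eqMixin (stree L).
HB.instance Definition _ L := gen_choiceMixin (stree L).
HB.instance Definition _ L M := gen_eqMixin (btree L M).
HB.instance Definition _ L M := gen_choiceMixin (btree L M).

Definition tpair (L M : Type) : Type := (btree L M * stree L)%type.

Definition strip L M (b : btree L M) : btree L unit := bmap id (fun=> tt) b.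

Definition tree_type L (x : tpair L unit) : tpair unit unit :=
  (bmap (fun=> tt) id x.1, smap (fun=> tt) x.2).

(** A vertex of a seam tree is the list of child indices on the way to it from
    the root.  A vertex of V_comp or V_mark is a list of pairs (index of the
    seam, index inside the seam).  The path from a vertex to the root consists
    of its prefixes. *)
Fixpoint ssub L (s : stree L) (a : seq nat) : option (stree L) :=
  match a, s with
  | [::], _ => Some s
  | t :: a', SNode _ ch => if onth ch t is Some c then ssub c a' else None
  | _ :: _, SLeaf => None
  end.

Fixpoint bsub L M (b : btree L M) (al : seq (nat * nat)) :
    option (btree L M) :=
  match al, b with
  | [::], _ => Some b
  | (t, j) :: al', Comp _ ss =>
      if onth (nth [::] ss t) j is Some c then bsub c al' else None
  | _ :: _, Mark _ => None
  end.

Definition V1 L M (b : btree L M) (al : seq (nat * nat)) : Prop :=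
  exists l s, bsub b al = Some (Comp l [:: s]).

Definition V2 L M (b : btree L M) (al : seq (nat * nat)) : Prop :=
  exists l ss, bsub b al = Some (Comp l ss) /\ (1 < size ss)%N.

(** The coherence map: it sends root to root and contracts all dashed edges and
    the solid edges into V_comp^1, and it maps the [t]-th solid edge into a
    vertex of V_comp^{>=2} to the [t]-th edge of the seam tree.  This leaves no
    choice, so the map is computed from the bubble tree alone; what remains of
    its definition is that its values are suitable vertices of the seam tree
    ([coherent]). *)
Fixpoint coh L M (b : btree L M) (al : seq (nat * nat)) : seq nat :=
  match al, b with
  | (t, j) :: al', Comp _ ss =>
      (if (1 < size ss)%N then [:: t] else [::]) ++
      (if onth (nth [::] ss t) j is Some c then coh c al' else [::])
  | _, _ => [::]
  end.

(** The marked vertices in planar order, each with its image under [coh] and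
    its label. *)
Fixpoint marks L M (b : btree L M) : seq (seq nat * M) :=
  match b with
  | Mark m => [:: ([::], m)]
  | Comp _ ss => flatten (mapi (fun t s =>
      [seq ((if (1 < size ss)%N then [:: t] else [::]) ++ p.1, p.2)
         | p <- flatten [seq marks c | c <- s]]) ss)
  end.

Fixpoint leaves L (s : stree L) : seq (seq nat) :=
  match s with
  | SLeaf => [:: [::]]
  | SNode _ ch => flatten (mapi (fun t c => [seq t :: a | a <- leaves c]) ch)
  end.

(** The labels of the marked vertices, grouped by the leaf they lie over. *)
Definition groups L M (b : btree L M) (s : stree L) : seq (seq M) :=
  [seq [seq p.2 | p <- marks b & p.1 == lam] | lam <- leaves s].

Definition sstable L (s : stree L) : Prop :=
  forall a l ch, ssub s a = Some (SNode l ch) -> (1 < size ch)%N.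

Definition bstable L M (b : btree L M) : Prop :=
  forall al l ss, bsub b al = Some (Comp l ss) ->
    match ss with
    | [::] => False
    | [:: s] => (1 < size s)%N
    | _ => has (fun s => 0 < size s)%N ss
    end.

Definition coherent L M (b : btree L M) (s : stree L) : Prop :=
  (forall al l ss, bsub b al = Some (Comp l ss) -> (1 < size ss)%N ->
     exists l' ch, ssub s (coh b al) = Some (SNode l' ch) /\
                   size ch = size ss) /\
  (forall al m, bsub b al = Some (Mark m) -> ssub s (coh b al) = Some SLeaf).

(** Stable tree-pairs of type [n].  The last equation also says that the seam
    tree has [size n] leaves. *)
Definition is_type L M (n : seq nat) (x : tpair L M) : Prop :=
  [/\ sstable x.2, bstable x.1, coherent x.1 x.2 &
      [seq size g | g <- groups x.1 x.2] = n].

Fixpoint blens L M (b : btree L M) : seq L :=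
  match b with
  | Mark _ => [::]
  | Comp l ss => l :: flatten [seq flatten [seq blens c | c <- s] | s <- ss]
  end.

Fixpoint slens L (s : stree L) : seq L :=
  match s with
  | SLeaf => [::]
  | SNode l ch => l :: flatten [seq slens c | c <- ch]
  end.

(** The coordinates in [0,1]^m; [behead] drops the dummies at the roots. *)
Definition coords L M (x : tpair L M) : seq L :=
  behead (blens x.1) ++ behead (slens x.2).

Section Metric.
Variable R : realType.

Definition blen M (b : btree R M) (al : seq (nat * nat)) : R :=
  if bsub b al is Some (Comp l _) then l else 0.

(** The maximum of the lengths over [alpha, beta), for [alpha] in V_comp and
    [beta] on the path from [alpha] to the root. *)
Definition pathmax M (b : btree R M) (alpha beta : seq (nat * nat)) : R :=
  \big[Num.max/0]_((size beta).+1 <= i < (size alpha).+1)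
     blen b (take i alpha).

Definition first_V2 M (b : btree R M) (alpha beta : seq (nat * nat)) : Prop :=
  [/\ V2 b beta, prefix beta alpha, beta != alpha &
      forall gamma, V2 b gamma -> prefix gamma alpha -> gamma != alpha ->
        prefix gamma beta].

Definition metric M (x : tpair R M) : Prop :=
  let b := x.1 in let s := x.2 in
  [/\ head 0 (blens b) = 0 /\ head 0 (slens s) = 0,
      all (fun l => 0 <= l <= 1) (coords x),
      forall alpha1 alpha2 beta, V2 b alpha1 -> V2 b alpha2 -> V1 b beta ->
        coh b alpha1 = coh b beta -> coh b alpha2 = coh b beta ->
        prefix beta alpha1 -> prefix beta alpha2 ->
        pathmax b alpha1 beta = pathmax b alpha2 beta &
      forall rho l ch alpha beta, rho != [::] ->
        ssub s rho = Some (SNode l ch) ->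
        V2 b alpha -> coh b alpha = rho -> first_V2 b alpha beta ->
        l = pathmax b alpha beta].

(** Metric stable tree-pairs of type [n], with the topology of the disjoint
    union of the C_2T: the type 2T is discrete and C_2T has the subspace
    topology of [0,1]^m (for a given 2T, all coordinates past the [m]-th are
    [0]). *)
Definition mtp_set (n : seq nat) : pred (tpair R unit) :=
  fun x => `[< is_type n x /\ metric x >].

Definition shape_coords (n : seq nat) (x : {x : tpair R unit | mtp_set n x}) :
    discrete_topology (tpair unit unit) * {ptws nat -> R} :=
  (tree_type (val x), fun i => nth 0 (coords (val x)) i).

Definition mtp (n : seq nat) : topologicalType :=
  initial_topology (@shape_coords n).

Definition raw (n : seq nat) (x : mtp n) : tpair R unit := sval x.

(** [in_ctx P]: apply [P] at one vertex of V_comp or V_mark. *)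
Inductive in_ctx (P : btree R unit -> btree R unit -> Prop) :
    btree R unit -> btree R unit -> Prop :=
| ctx_here b b' : P b b' -> in_ctx P b b'
| ctx_in l ss1 s1 b b' s2 ss2 : in_ctx P b b' ->
    in_ctx P (Comp l (ss1 ++ (s1 ++ b :: s2) :: ss2))
             (Comp l (ss1 ++ (s1 ++ b' :: s2) :: ss2)).

Variant contractA : btree R unit -> btree R unit -> Prop :=
| ContractA l ss1 s1 gamma s2 ss2 :
    contractA (Comp l (ss1 ++ (s1 ++ Comp 0 [:: gamma] :: s2) :: ss2))
              (Comp l (ss1 ++ (s1 ++ gamma ++ s2) :: ss2)).

(** For the [p] lists of [q] seam vertices [gss], the [q] concatenations
    gamma_1, ..., gamma_q that replace them in [contractB] and [bcontract]. *)
Definition merge_seams M (q : nat) (gss : seq (seq (seq (btree R M)))) :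
    seq (seq (btree R M)) :=
  [seq flatten [seq nth [::] gs t | gs <- gss] | t <- iota 0 q].

Variant contractB : btree R unit -> btree R unit -> Prop :=
| ContractB l q gss : (0 < size gss)%N -> (1 < q)%N ->
    all (fun gs => size gs == q) gss ->
    contractB (Comp l [:: [seq Comp 0 gs | gs <- gss]])
              (Comp l (merge_seams q gss)).

Definition skids L (s : stree L) : seq (stree L) :=
  if s is SNode _ ch then ch else [::].

Definition bkids L M (b : btree L M) : seq (seq (btree L M)) :=
  if b is Comp _ ss then ss else [::].

Fixpoint scontract (rho : seq nat) (s : stree R) : stree R :=
  match rho, s with
  | [:: t], SNode l ch =>
      SNode l (flatten (mapi (fun i c =>
        if i == t then skids c else [:: c]) ch))
  | t :: rho', SNode l ch =>
      SNode l (mapi (fun i c => if i == t then scontract rho' c else c) ch)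
  | _, _ => s
  end.

(** Simultaneously replace every seam vertex over [rho] that goes into
    V_comp^{>=2}; here [q] is the number of children of [rho]. *)
Fixpoint bcontract (q : nat) (rho : seq nat) (b : btree R unit) :
    btree R unit :=
  match b with
  | Mark m => Mark m
  | Comp l ss =>
      if (1 < size ss)%N then
        match rho with
        | [::] => b
        | [:: t] => Comp l (flatten (mapi (fun i s =>
            if i == t then merge_seams q [seq bkids c | c <- s]
            else [:: s]) ss))
        | t :: rho' => Comp l (mapi (fun i s =>
            if i == t then [seq bcontract q rho' c | c <- s] else s) ss)
        end
      else Comp l [seq [seq bcontract q rho c | c <- s] | s <- ss]
  end.

(** The premise is that [contractA] and [contractB] have been carried out over
    [rho], so that only vertices of V_comp^{>=2} of length [0] are left there. *)
Variant contractC : tpair R unit -> tpair R unit -> Prop :=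
| ContractC b s rho ch : rho != [::] -> ssub s rho = Some (SNode 0 ch) ->
    (forall al l ss, bsub b al = Some (Comp l ss) -> coh b al = rho ->
       l = 0 /\ (1 < size ss)%N) ->
    contractC (b, s) (bcontract (size ch) rho b, scontract rho s).

Definition W_step (x y : tpair R unit) : Prop :=
  [\/ in_ctx contractA x.1 y.1 /\ x.2 = y.2,
      in_ctx contractB x.1 y.1 /\ x.2 = y.2 |
      contractC x y].

(** Each [W_step] is one contraction.  Contractions can be continued until no
    zero length is left, and the outcome does not depend on their order; so the
    equivalence relation they generate identifies two pairs if and only if they
    become equal after all zero lengths are eliminated. *)
Definition W_equiv (n : seq nat) : equiv_rel (mtp n) :=
  gen_equiv_rel (fun x y : mtp n => W_step (raw x) (raw y)).

Definition W (n : seq nat) : topologicalType :=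
  quotient_topology {eq_quot (W_equiv n)}.

Definition Wpi (n : seq nat) (x : mtp n) : W n := \pi_({eq_quot (W_equiv n)})%qT x.

(** The set 0 * x_(tau 1) * ... * x_(tau m) * 1 of [0,1]^m, where the [i]-th
    [*] is [<] if [tnth c i] and [=] otherwise. *)
Definition open_simplex (m : nat) (tau : 'S_m) (c : m.+1.-tuple bool) :
    set (seq R) :=
  [set v | size v = m /\
    let z : seq R := 0 :: rcons [seq nth 0 v (tau j) | j <- enum 'I_m] 1 in
    forall i : 'I_m.+1,
      if tnth c i then z`_i < z`_i.+1 else z`_i == z`_i.+1].

Definition simplex_dim (m : nat) (c : m.+1.-tuple bool) : nat :=
  (count id c).-1.

Definition C2T (n : seq nat) (S : tpair unit unit) : set (mtp n) :=
  [set x | tree_type (raw x) = S].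

Definition W_simplex (n : seq nat) (S : tpair unit unit)
    (tau : 'S_(size (coords S))) (c : (size (coords S)).+1.-tuple bool) :
    Prop :=
  open_simplex tau c !=set0 /\
  open_simplex tau c `<=` [set coords (raw x) | x in @C2T n S].

Definition W_open_cell (n : seq nat) (S : tpair unit unit)
    (tau : 'S_(size (coords S))) (c : (size (coords S)).+1.-tuple bool) :
    set (W n) :=
  @Wpi n @` [set x | C2T S x /\ open_simplex tau c (coords (raw x))].

Definition W_cell (n : seq nat) (d : nat) (e : set (W n)) : Prop :=
  exists S tau c, [/\ @W_simplex n S tau c, simplex_dim c = d &
                      e = @W_open_cell n S tau c].

Definition W_boundary (n : seq nat) : set (W n) :=
  [set w | exists S tau c (i : 'I_(size (coords S))),
     [/\ @W_simplex n S tau c, @W_open_cell n S tau c w &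
         forall v, open_simplex tau c v -> nth 0 v i = 1]].

Section Forget.
Variable M : Type.

Definition remove_at A (t : nat) (s : seq A) : seq A :=
  take t s ++ drop t.+1 s.

Fixpoint sdelete (lam : seq nat) (s : stree R) : stree R :=
  match lam, s with
  | [:: t], SNode l ch => SNode l (remove_at t ch)
  | t :: lam', SNode l ch =>
      SNode l (mapi (fun i c => if i == t then sdelete lam' c else c) ch)
  | _, _ => s
  end.

(** Delete the seam vertices over [lam] that go into V_comp^{>=2}. *)
Fixpoint bdelete (lam : seq nat) (b : btree R M) : btree R M :=
  match b with
  | Mark m => Mark m
  | Comp l ss =>
      if (1 < size ss)%N then
        match lam with
        | [::] => b
        | [:: t] => Comp l (remove_at t ss)
        | t :: lam' => Comp l (mapi (fun i s =>
            if i == t then [seq bdelete lam' c | c <- s] else s) ss)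
        end
      else Comp l [seq [seq bdelete lam c | c <- s] | s <- ss]
  end.

(** Merge an edge of length [l] with the outgoing edge of the root. *)
Definition sraise (l : R) (s : stree R) : stree R :=
  if s is SNode l' ch then SNode (Num.max l l') ch else SLeaf.

Definition braise (l : R) (b : btree R M) : btree R M :=
  match b with
  | Mark m => Mark m
  | Comp l' ss => Comp (Num.max l l') ss
  end.

Fixpoint srestab (s : stree R) : stree R :=
  match s with
  | SLeaf => SLeaf
  | SNode l ch =>
      let ch' := [seq srestab c | c <- ch] in
      if ch' is [:: c] then sraise l c else SNode l ch'
  end.

Fixpoint brestab (b : btree R M) : btree R M :=
  match b with
  | Mark m => Mark m
  | Comp l ss =>
      let ss' := [seq [seq brestab c | c <- s] | s <- ss] in
      if ss' is [:: [:: gamma]] then braise l gamma else Comp l ss'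
  end.

Definition sroot (s : stree R) : stree R :=
  if s is SNode _ ch then SNode 0 ch else SLeaf.

Definition broot (b : btree R M) : btree R M :=
  match b with
  | Mark m => Mark m
  | Comp _ ss => Comp 0 ss
  end.

Definition forget1 (x : tpair R M) : tpair R M :=
  let lam := nth [::] (leaves x.2) (find (@nilp M) (groups x.1 x.2)) in
  (broot (brestab (bdelete lam x.1)), sroot (srestab (sdelete lam x.2))).

Definition forget (x : tpair R M) : tpair R M :=
  iter (count (@nilp M) (groups x.1 x.2)) forget1 x.

End Forget.

(** The 2-permutation at an interior vertex orders the incoming vertices, so a
    datum is, up to isomorphism, a planar tree in which the incoming vertices
    are grouped: the [i]-th list in [Node cs] is the part A_i. *)
Inductive gj :=
| Leaf of nat
| Node of seq (seq gj).

HB.instance Definition _ := gen_eqMixin gj.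
HB.instance Definition _ := gen_choiceMixin gj.

Fixpoint gj_leaves (T : gj) : seq nat :=
  match T with
  | Leaf i => [:: i]
  | Node cs => flatten [seq flatten [seq gj_leaves c | c <- s] | s <- cs]
  end.

Fixpoint gj_stable (T : gj) : bool :=
  match T with
  | Leaf _ => true
  | Node cs => [&& all (fun s => 0 < size s)%N cs, (1 < size (flatten cs))%N &
                   all (fun s => all gj_stable s) cs]
  end.

(** For [k = 1] the only datum is [Leaf 1], which has no interior vertex; this
    makes [FM 1] below a point. *)
Definition gj_data (k : nat) : choiceType :=
  {T : gj | gj_stable T && perm_eq (gj_leaves T) (iota 1 k)}.

Fixpoint gj_types (T : gj) : seq (seq nat) :=
  match T with
  | Leaf _ => [::]
  | Node cs => [seq size s | s <- cs] ::
               flatten [seq flatten [seq gj_types c | c <- s] | s <- cs]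
  end.

Section GJSpaces.
Variable k : nat.

(** The interior vertices of [T], numbered in preorder, and the type of each. *)
Definition gj_vert (T : gj_data k) : Type := 'I_(size (gj_types (val T))).

Definition gj_type (T : gj_data k) (v : gj_vert T) : seq nat :=
  nth [::] (gj_types (val T)) v.

Definition GJt (T : gj_data k) : topologicalType :=
  prod_topology (fun v : gj_vert T => W (gj_type v)).

Definition GJo (T : gj_data k) : set (GJt T) :=
  [set X | forall v, (~` @W_boundary (gj_type v)) (X v)].

Definition GJcoprod : topologicalType := {T : gj_data k & GJt T}.

End GJSpaces.

(** A datum together with a tree-pair at each of its interior vertices: the
    incoming vertices of the datum are the labels of the marked vertices of the
    tree-pair, the parts of the 2-permutation being given by [groups]. *)
Inductive gjm :=
| MLeaf of nat
| MNode of btree R gjm & stree R.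

Fixpoint gjm_datum (P : gjm) : gj :=
  match P with
  | MLeaf i => Leaf i
  | MNode b s => Node (groups (bmap id gjm_datum b) s)
  end.

(** The tree-pairs at the interior vertices, in preorder. *)
Fixpoint gjm_pairs (P : gjm) : seq (tpair R unit) :=
  match P with
  | MLeaf _ => [::]
  | MNode b s => (strip b, s) ::
      flatten [seq flatten g | g <- groups (bmap id gjm_pairs b) s]
  end.

Definition represents (k : nat) (P : gjm) (X : GJcoprod k) : Prop :=
  gjm_datum P = val (projT1 X) /\
  forall v : gj_vert (projT1 X), exists y : mtp (gj_type v),
    onth (gjm_pairs P) v = Some (raw y) /\ projT2 X v = Wpi y.

(** [F] is an open simplex, so a length is identically [1] on [F] if and only
    if it is [1] at one point of [F]; hence q_F(x) is obtained by cutting the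
    edges that have length [1] at [x]. *)

Fixpoint scut (s : stree R) : stree R :=
  match s with
  | SLeaf => SLeaf
  | SNode l ch => SNode l [seq
      match c with
      | SNode l' _ => if l' == 1 then SLeaf else scut c
      | SLeaf => SLeaf
      end | c <- ch]
  end.

Fixpoint has_V2 L M (b : btree L M) : bool :=
  match b with
  | Mark _ => false
  | Comp _ ss => (1 < size ss)%N || has (fun s => has (@has_V2 L M) s) ss
  end.

(** Components with only one incoming vertex are suppressed. *)
Definition mnode (x : tpair R gjm) : gjm :=
  if x.1 is Mark m then m else MNode x.1 x.2.

(** The vertex of the new datum given by the component [b] of a cut bubble
    tree, where [s] is the subtree of the seam tree above the image of the root
    of [b].  The coherence map is constant on [b] if and only if [b] has no
    vertex in V_comp^{>=2}. *)
Definition piece (s : stree R) (b : btree R gjm) : gjm :=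
  mnode (forget (broot b, if has_V2 b then sroot (scut s) else SLeaf)).

(** The component of the root in the cut bubble tree.  A cut edge leaves a
    marked vertex, labelled by the piece above it. *)
Fixpoint bcut (s : stree R) (b : btree R gjm) : btree R gjm :=
  match b with
  | Mark m => Mark m
  | Comp l ss => Comp l (mapi (fun t sm =>
      let s' := if (1 < size ss)%N then nth SLeaf (skids s) t else s in
      [seq match c with
           | Comp l' _ =>
               if l' == 1 then Mark (piece s' (bcut s' c)) else bcut s' c
           | Mark m => Mark m
           end | c <- sm]) ss)
  end.

Fixpoint q_map (P : gjm) : gjm :=
  match P with
  | MLeaf i => MLeaf i
  | MNode b s => piece s (bcut s (bmap id q_map b))
  end.

Section FM.
Variable k : nat.

Definition FM_glue (X Y : GJcoprod k) : Prop :=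
  exists P, [/\ represents P X, has (fun x => 1 \in coords x) (gjm_pairs P) &
                represents (q_map P) Y].

Definition FM_equiv : equiv_rel (GJcoprod k) := gen_equiv_rel FM_glue.

Definition FM : topologicalType := quotient_topology {eq_quot FM_equiv}.

Definition FMpi (X : GJcoprod k) : FM := \pi_({eq_quot FM_equiv})%qT X.

(** A point of the product of the C_2T_v, where 2T_v is [S v], and its
    coordinates in the cube of dimension the sum of the m_v. *)
Definition GJ_C2T (T : gj_data k) (S : gj_vert T -> tpair unit unit) :
    set (forall v : gj_vert T, mtp (gj_type v)) :=
  [set y | forall v, C2T (S v) (y v)].

Definition GJ_coords (T : gj_data k)
    (y : forall v : gj_vert T, mtp (gj_type v)) : seq R :=
  flatten [seq coords (raw (y v)) | v : gj_vert T <- enum 'I_(size (gj_types (val T)))].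

Definition GJ_dim (T : gj_data k) (S : gj_vert T -> tpair unit unit) : nat :=
  (\sum_(v < size (gj_types (val T))) size (coords (S v)))%N.

Definition GJ_simplex (T : gj_data k) (S : gj_vert T -> tpair unit unit)
    (tau : 'S_(GJ_dim S)) (c : (GJ_dim S).+1.-tuple bool) : Prop :=
  open_simplex tau c !=set0 /\
  open_simplex tau c `<=` @GJ_coords T @` GJ_C2T S.

Definition GJ_open_cell (T : gj_data k) (S : gj_vert T -> tpair unit unit)
    (tau : 'S_(GJ_dim S)) (c : (GJ_dim S).+1.-tuple bool) : set (GJt T) :=
  [set (fun v => Wpi (y v)) | y in
     [set y | GJ_C2T S y /\ open_simplex tau c (GJ_coords y)]].

Definition FM_cell (d : nat) (e : set FM) : Prop :=
  exists (T : gj_data k) (S : gj_vert T -> tpair unit unit) tau c,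
    [/\ @GJ_simplex T S tau c, @GJ_open_cell T S tau c `<=` @GJo k T,
        simplex_dim c = d &
        e = [set FMpi (existT _ T X) | X in @GJ_open_cell T S tau c]].

End FM.

Section Cellular.
Variables (X Y : topologicalType).

(** [cell d e]: [e] is an open [d]-cell. *)
Definition skeleton (Z : Type) (cell : nat -> set Z -> Prop) (d : nat) :
    set Z :=
  [set z | exists d' e, [/\ (d' <= d)%N, cell d' e & e z]].

Definition cellular (cellX : nat -> set X -> Prop) (cellY : nat -> set Y -> Prop)
    (f : X -> Y) : Prop :=
  continuous f /\
  forall d, f @` skeleton cellX d `<=` skeleton cellY d.

End Cellular.

Definition two_perm (n : seq nat) (sigma : seq (seq nat)) : Prop :=
  [seq size a | a <- sigma] = n /\
  perm_eq (flatten sigma) (iota 1 (sumn n)).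

(** [f] is the map associated to [sigma].  The marked vertices of the pair [x]
    are labelled by [sigma] (this is [b]), which makes [x] a point over the
    corolla with 2-permutation [sigma].  Data have no empty parts, so the leaves
    of the seam tree over which there are no marked vertices are forgotten; if
    |n| = 1 this leaves only a marked vertex, and the corolla is replaced by
    the trivial tree.  Since every point of [W n] is some [Wpi x], at most one
    [f] satisfies this. *)
Definition is_fsigma (n : seq nat) (sigma : seq (seq nat))
    (f : W n -> FM (sumn n)) : Prop :=
  forall x : mtp n, exists b X,
    [/\ strip b = (raw x).1,
        groups b (raw x).2 = [seq [seq MLeaf i | i <- a] | a <- sigma],
        represents (mnode (forget (b, (raw x).2))) X &
        f (Wpi x) = FMpi X].

End Metric.

(* Main.v *)
(** The map sends the class of a tree-pair [x] to the class of the tree-pair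
    obtained from [x] by forgetting the unmarked seam leaves, decorating a
    corolla.  It is well defined because forgetting turns each contraction (a),
    (b), (c) into a chain of contractions, and continuous because the new
    tree type is determined by the old one, and the new lengths are maxima of
    lengths of [x], so that they move by no more than these do.

    The dimension of the open simplex containing a point is the number of
    distinct coordinates of that point in the open interval ]0, 1[.  Forgetting
    and cutting never create a new value among the lengths, and after one
    application of q_F no length [1] is left, so that the result lies in an open
    cell of FM; hence the dimension of the cell cannot go up. *)

From HB Require Import structures.
From Stdlib Require Import Relation_Operators.
From mathcomp Require Import all_boot all_order perm all_algebra.
From mathcomp Require Import zify lra.
From mathcomp Require Import all_classical all_reals all_analysis.
Require Import Defs.
Set Implicit Arguments.
Unset Strict Implicit.
Unset Printing Implicit Defensive.
Import Order.TTheory GRing.Theory Num.Theory.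
Local Open Scope ring_scope.

(** The conditions in [metric] quantify over paths, while all operations act on subtrees. The
    predicate [over] restates the conditions by recursion, and the invariance statements are
    inductions on it. They go through because each condition asserts that a maximum is independent
    of the path, which merging edges by [Num.max] respects.

    The main obstacle is the contraction (c). The contracted seam edge may be adjacent to the
    forgotten leaf and disappear in the restabilization, so that one (c) has to become several (a)
    or a (b); besides, deleting a leaf shifts addresses. So the leaf is flagged before it is
    removed, and deletion with restabilization becomes a single structural recursion, [prune] and
    [bprune], to be compared with each contraction.

    For cutting, condition 2 is decisive: a seam edge has length 1 exactly when every path that it
    measures contains a length 1, so seam and bubble trees are cut together. For cells, the
    conditions only involve maxima, 0 and 1, so monotone maps fixing 0 and 1 preserve them; this
    puts the whole open simplex of a point into C_2T. *)

Section Combinators.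
Variables (A B C : Type).

Fixpoint map2 (f : A -> B -> C) (s : seq A) (t : seq B) : seq C :=
  match s, t with
  | x :: s', y :: t' => f x y :: map2 f s' t'
  | _, _ => [::]
  end.

Lemma map2E f s t : map2 f s t = [seq f p.1 p.2 | p <- zip s t].
Proof. by elim: s t => [|x s IH] [|y t] //=; rewrite IH. Qed.

Lemma map2_cat f s1 s2 t1 t2 : size s1 = size t1 ->
  map2 f (s1 ++ s2) (t1 ++ t2) = map2 f s1 t1 ++ map2 f s2 t2.
Proof. by move=> e; rewrite !map2E zip_cat // map_cat. Qed.

Lemma mapi_fromE (f : nat -> A -> B) i s :
  mapi_from f i s = [seq f p.1 p.2 | p <- zip (iota i (size s)) s].
Proof. by elim: s i => //= x s IH i; rewrite IH. Qed.

Lemma size_mapi (f : nat -> A -> B) s : size (mapi f s) = size s.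
Proof. by rewrite /mapi mapi_fromE size_map size_zip size_iota minnn. Qed.

Lemma mapi_from_cat (f : nat -> A -> B) i s t :
  mapi_from f i (s ++ t) = mapi_from f i s ++ mapi_from f (i + size s)%N t.
Proof.
by elim: s i => [|x s IH] i /=; rewrite ?addn0 // IH addSnnS.
Qed.

Lemma mapi_from_neq (F G : A -> B) t i s : (t < i)%N || (i + size s <= t)%N ->
  mapi_from (fun j x => if j == t then F x else G x) i s = map G s.
Proof.
elim: s i => //= x s IH i h; rewrite IH; last first.
  by case/orP: h => h; [rewrite (leq_trans h) | rewrite addSnnS h orbT].
by case: eqP => // e; move: h; rewrite e ltnn /= addnS ltnNge leq_addr.
Qed.

(** All operations that follow an address are a [mapi] of such a conditional; on a list split at the
    address they touch one entry. *)
Lemma mapi_at (F G : A -> B) t s x s' : size s = t ->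
  mapi (fun j y => if j == t then F y else G y) (s ++ x :: s') =
  map G s ++ F x :: map G s'.
Proof.
move=> e; rewrite /mapi mapi_from_cat /= add0n e eqxx.
by rewrite !mapi_from_neq ?ltnSn // add0n e leqnn orbT.
Qed.

Lemma split_nth (x0 : A) t s : (t < size s)%N ->
  s = take t s ++ nth x0 s t :: drop t.+1 s.
Proof. by move=> h; rewrite -drop_nth // cat_take_drop. Qed.

Lemma onth_some (s : seq A) t x : onth s t = Some x ->
  exists s1 s2, s = s1 ++ x :: s2 /\ size s1 = t.
Proof.
elim: s t => [|y s IH] [|t] //=; first by case=> ->; exists [::], s.
by case/IH => s1 [s2 [-> <-]]; exists (y :: s1), s2.
Qed.

Lemma onth_cat_size (s1 s2 : seq A) x : onth (s1 ++ x :: s2) (size s1) = Some x.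
Proof. by elim: s1. Qed.

End Combinators.

Lemma all2_zipP (A B : eqType) (r : A -> B -> bool) s t :
  reflect (size s = size t /\ forall p, p \in zip s t -> r p.1 p.2) (all2 r s t).
Proof.
rewrite all2E; apply: (iffP andP) => -[/eqP e h]; split=> //.
  by move=> p; move/allP: h => /[apply].
by apply/allP.
Qed.

Lemma mem_zip1 (A B : eqType) (s : seq A) (t : seq B) p :
  p \in zip s t -> p.1 \in s.
Proof.
elim: s t => [|x s IH] [|y t] //=; rewrite !inE.
by case/orP=> [/eqP->|/IH->]; rewrite ?eqxx ?orbT.
Qed.

Lemma mem_zip2 (A B : eqType) (s : seq A) (t : seq B) p :
  p \in zip s t -> p.2 \in t.
Proof.
elim: s t => [|x s IH] [|y t] //=; rewrite !inE.
by case/orP=> [/eqP->|/IH->]; rewrite ?eqxx ?orbT.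
Qed.

Lemma mem_zip_nth (A B : eqType) (s : seq A) (t : seq B) x0 y0 i :
  size s = size t -> (i < size s)%N -> (nth x0 s i, nth y0 t i) \in zip s t.
Proof.
move=> e h; rewrite -nth_zip // mem_nth // size_zip -e minnn //.
Qed.

Lemma zip_at (A B : eqType) (s1 s2 : seq A) x (t : seq B) :
  size (s1 ++ x :: s2) = size t ->
  exists t1 y t2, [/\ t = t1 ++ y :: t2, size s1 = size t1 & size s2 = size t2].
Proof.
elim: s1 t => [|z s1 IH] [|y t] //=; first by case=> e; exists [::], y, t.
by case=> /IH[t1 [w [t2 [-> -> ->]]]]; exists (y :: t1), w, t2.
Qed.

(** * Induction on nested trees *)

Section TreeInduction.
Variables (L M : Type).

(** The generated principle has no hypothesis for the trees inside a list of children, so the nested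
    recursion is written by hand. *)
Lemma stree_nested_ind (P : stree L -> Prop) : P SLeaf ->
  (forall l (ch : seq (stree L)), (forall c, c \in ch -> P c) -> P (SNode l ch)) -> forall s, P s.
Proof.
move=> P0 P1; fix IH 1; case=> [|l ch]; first exact: P0.
(* For the empty list [by] might close the goal with [IH] itself, which the guard condition
   rejects. *)
apply: P1; elim: ch => [|c ch IHch] c'; first by clear IH.
by rewrite in_cons => /orP[/eqP->|]; [exact: IH | exact: IHch].
Qed.

Lemma btree_nested_ind (P : btree L M -> Prop) : (forall m, P (Mark m)) ->
  (forall l (ss : seq (seq (btree L M))), (forall s c, s \in ss -> c \in s -> P c) -> P (Comp l ss)) ->
  forall b, P b.
Proof.
move=> P0 P1; fix IH 1; case=> [m|l ss]; first exact: P0.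
apply: P1; elim: ss => [|s ss IHss] s' c; first by clear IH.
rewrite in_cons => /orP[/eqP->|]; last exact: IHss.
elim: s => [|x s IHs]; first by clear IH.
by rewrite in_cons => /orP[/eqP->|]; [exact: IH | exact: IHs].
Qed.

End TreeInduction.

(** * Recursive description of metric tree-pairs *)

Section Over.
Variables (R : realType) (M : Type).

Definition slen (s : stree R) : R := if s is SNode l _ then l else 0.
Definition isleaf (s : stree R) := if s is SLeaf then true else false.
Definition unitI (l : R) := 0 <= l <= 1.

(** The maximum of the lengths on a path from the root [b], included, down to
    the first vertices of V_comp^{>=2}.  Conditions 1 and 2 on a metric say that
    this does not depend on the path and equals the length of the seam edge;
    this lets [over] state coherence, stability and the metric conditions by
    recursion on the tree. *)
Fixpoint hgt (b : btree R M) : R :=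
  match b with
  | Mark _ => 0
  | Comp l ss => if ss is [:: s1] then Num.max l (head 0 (map hgt s1)) else l
  end.

Definition fits (s : stree R) (b : btree R M) := isleaf s || (hgt b == slen s).

(** Condition 1 is the constancy of heights in the clause for one seam vertex; it is void over a
    leaf, where no path meets V_comp^{>=2}. Condition 2 is [fits], tested at the members of the
    seams of a vertex of V_comp^{>=2}. *)
Fixpoint over (s : stree R) (b : btree R M) : bool :=
  match b with
  | Mark _ => isleaf s
  | Comp l ss => unitI l &&
      match ss with
      | [:: s1] => [&& (1 < size s1)%N, all (over s) s1 &
                       isleaf s || constant (map hgt s1)]
      | _ => if s is SNode _ ch then
               [&& (1 < size ss)%N, has (fun s1 => 0 < size s1)%N ss &
                   all2 (fun s1 c => all (fun x => over c x && fits c x) s1) ss ch]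
             else false
      end
  end.

(** Induction along the pair: the seam tree stays the same at a vertex of V_comp^1 and is replaced
    by its children at a vertex of V_comp^{>=2}. *)
Lemma over_ind (P : stree R -> btree R M -> Prop) :
  (forall m, P SLeaf (Mark m)) ->
  (forall s l s1, unitI l -> (1 < size s1)%N ->
     (forall x, x \in s1 -> over s x) -> isleaf s || constant (map hgt s1) ->
     (forall x, x \in s1 -> P s x) -> P s (Comp l [:: s1])) ->
  (forall l0 ch l ss, unitI l -> (1 < size ss)%N ->
     has (fun s1 => 0 < size s1)%N ss -> size ss = size ch ->
     (forall p, p \in zip ss ch -> forall x, x \in p.1 ->
        [/\ over p.2 x, fits p.2 x & P p.2 x]) ->
     P (SNode l0 ch) (Comp l ss)) ->
  forall s b, over s b -> P s b.
Proof.
move=> P0 P1 P2 s b; elim/btree_nested_ind: b s => [m|l ss IH] s /=.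
  by case: s.
case/andP=> hl.
have V2 l' : unitI l' -> (if s is SNode _ ch then
    [&& (1 < size ss)%N, has (fun s1 => 0 < size s1)%N ss &
      all2 (fun s1 c => all (fun x => over c x && fits c x) s1) ss ch]
    else false) -> P s (Comp l' ss).
  case: s => // l0 ch hl' /and3P[h1 h2 /all2_zipP[h3 h4]].
  apply: P2 => // p hp x hx.
  have /andP[ho hf] := allP (h4 p hp) x hx.
  by split=> //; apply: (IH p.1) => //; exact: mem_zip1 hp.
case: ss IH V2 => [|s1 [|s2 ss]] IH V2; [exact: V2 | | exact: V2].
case/and3P=> h1 /allP h2 h3; apply: P1 => // x hx.
by apply: (IH s1); rewrite ?mem_head //; exact: h2.
Qed.

Lemma over_V1 s l s1 : over s (Comp l [:: s1]) =
  [&& unitI l, (1 < size s1)%N, all (over s) s1 &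
    isleaf s || constant (map hgt s1)].
Proof. by []. Qed.

Lemma over_V2P s l ss : (1 < size ss)%N ->
  reflect (exists l0 ch, [/\ s = SNode l0 ch, unitI l,
      has (fun s1 => 0 < size s1)%N ss, size ss = size ch &
      forall p, p \in zip ss ch -> forall x, x \in p.1 ->
        over p.2 x /\ fits p.2 x])
    (over s (Comp l ss)).
Proof.
case: ss => [|s1 [|s2 ss]] // _; apply: (iffP idP) => /=.
  case/andP=> hl; case: s => // l0 ch /andP[h2 h34]; exists l0, ch.
  move/(all2_zipP (fun s1 c => all (fun x => over c x && fits c x) s1)
    [:: s1, s2 & ss] ch): h34 => [h3 h4].
  split=> // p hp x hx.
  by have /andP[] := allP (h4 p hp) x hx.
case=> l0 [ch [-> hl h2 h3 h4]]; rewrite hl /=; apply/andP; split=> //.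
change (all2 (fun s1 c => all (fun x => over c x && fits c x) s1)
  [:: s1, s2 & ss] ch).
apply/all2_zipP; split=> // p hp; apply/allP => x hx.
by apply/andP; exact: h4 hp x hx.
Qed.

Lemma over_size s l ss : over s (Comp l ss) -> (0 < size ss)%N.
Proof. by case: ss => [|s1 ss] //=; rewrite andbC; case: s. Qed.

Lemma over_unitI s l ss : over s (Comp l ss) -> unitI l.
Proof. by move=> /andP[]. Qed.

(** A seam length is only read at the parent, through [fits]; this makes the dummy at the root
    harmless. *)
Lemma over_snode_len l l' ch b : over (SNode l ch) b -> over (SNode l' ch) b.
Proof.
elim/btree_nested_ind: b => //= l0 ss IH.
case: ss IH => [|s1 [|s2 ss]] // IH /and4P[h0 h1 /allP h2 h3].
apply/and4P; split=> //; apply/allP => x hx.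
by apply: (IH s1) (h2 x hx) => //; rewrite mem_head.
Qed.

Lemma hgt_ge0 s b : over s b -> 0 <= hgt b.
Proof.
move: s b; apply: over_ind => //= [_ l s1 /andP[l0 _] _ _ _ _|_ ch l ss /andP[l0 _]].
  by rewrite le_max l0.
case: ss => [|s1 [|s2 ss]] // *.
Qed.

Lemma hgt_V2 l ss : (1 < size ss)%N -> hgt (Comp l ss) = l.
Proof. by case: ss => [|s1 [|s2 ss]]. Qed.

Lemma constant_head (T : eqType) (x0 : T) (t : seq T) x :
  constant t -> x \in t -> x = head x0 t.
Proof.
case: t => //= y t /allP h; rewrite inE => /orP[/eqP //|/h/=/eqP //].
Qed.

Lemma constant_map (T U : eqType) (f : T -> U) (t : seq T) v :
  (forall y, y \in t -> f y = v) -> constant (map f t).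
Proof.
case: t => //= y t h; apply/allP => _ /mapP[z hz ->] /=.
by rewrite !h ?mem_head // inE hz orbT.
Qed.

Lemma hgt_const s s1 x : ~~ isleaf s -> isleaf s || constant (map hgt s1) ->
  x \in s1 -> hgt x = head 0 (map hgt s1).
Proof.
by move=> /negbTE-> /= h hx; apply: (constant_head _ h); exact: map_f.
Qed.

End Over.

(** * Forgetting leaves of the seam tree *)

Section Prune.
Variables (R : realType) (M : Type).

Fixpoint lenok (s : stree R) : bool :=
  if s is SNode l ch then unitI l && all lenok ch else true.

Fixpoint sok (s : stree R) : bool :=
  if s is SNode l ch then [&& unitI l, (1 < size ch)%N & all sok ch] else true.

(** A seam leaf that is to be forgotten is marked by making it an interior
    vertex without children.  [prune] and [bprune] delete all such leaves and
    restabilize in a single pass, a suppressed edge being merged into the edge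
    below it; [prune s] is empty if nothing is left of [s]. *)
Definition snorm (l : R) (d : seq (stree R)) : seq (stree R) :=
  match d with
  | [::] => [::]
  | [:: c] => [:: sraise l c]
  | _ => [:: SNode l d]
  end.

Fixpoint prune (s : stree R) : seq (stree R) :=
  match s with
  | SLeaf => [:: SLeaf]
  | SNode l ch => snorm l (flatten (map prune ch))
  end.

Definition renorm (l : R) (ss : seq (seq (btree R M))) : btree R M :=
  if ss is [:: [:: g]] then braise l g else Comp l ss.

Fixpoint bprune (s : stree R) (b : btree R M) : btree R M :=
  match b with
  | Mark m => Mark m
  | Comp l ss => renorm l
      match ss with
      | [:: s1] => [:: map (bprune s) s1]
      | _ => flatten (map2 (fun s1 c =>
               if nilp (prune c) then [::] else [:: map (bprune c) s1])
               ss (skids s))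
      end
  end.

(** The length of the child that takes the place of the root of [s] when the
    root is suppressed by the pruning, and [0] otherwise. *)
Definition kap (s : stree R) : R :=
  if flatten (map prune (skids s)) is [:: c] then slen c else 0.

Lemma unitI_max (l l' : R) : unitI l -> unitI l' -> unitI (Num.max l l').
Proof.
by move=> /andP[h1 h2] /andP[h3 h4]; rewrite /unitI le_max h1 ge_max h2 h4.
Qed.

Lemma maxr0 (l : R) : unitI l -> Num.max l 0 = l.
Proof. by case/andP => h _; apply/max_idPl. Qed.

Lemma max0r (l : R) : unitI l -> Num.max 0 l = l.
Proof. by case/andP => h _; apply/max_idPr. Qed.

Lemma sok_lenok s : sok s -> lenok s.
Proof.
elim/stree_nested_ind: s => //= l ch IH /and3P[-> _ /allP h] /=.
by apply/allP => c hc; apply: IH (h c hc).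
Qed.

Lemma renorm_V2 l ss : (1 < size ss)%N -> renorm l ss = Comp l ss.
Proof. by case: ss => [|[|x [|y s1]] [|s2 ss]]. Qed.

Lemma snorm_le1 l d : (size (snorm l d) <= 1)%N.
Proof. by case: d => [|c [|c' d]]. Qed.

Lemma prune_le1 s : (size (prune s) <= 1)%N.
Proof. by case: s => //= l ch; exact: snorm_le1. Qed.

Lemma prune_cases s : prune s = [::] \/ exists s', prune s = [:: s'].
Proof.
case: (prune s) (prune_le1 s) => [|s' [|s'' t]] // _; first by left.
by right; exists s'.
Qed.

(** Pruning creates stability: [snorm] leaves no interior vertex with fewer than two children. *)
Lemma prune_sok s : lenok s -> all sok (prune s).
Proof.
elim/stree_nested_ind: s => //= l ch IH /andP[hl /allP hch].
have: all sok (flatten (map prune ch)).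
  apply/allP => x /flatten_mapP[c hc]; move: x; apply/allP; exact: IH (hch c hc).
case: (flatten _) => [|c [|c' d]] //=; last by move=> ->; rewrite hl.
by case: c => //= l' ch' /andP[/andP[h1 ->] _]; rewrite unitI_max.
Qed.

Lemma prune_id s : sok s -> prune s = [:: s].
Proof.
elim/stree_nested_ind: s => //= l ch IH /and3P[hl hs /allP hch].
have -> : flatten (map prune ch) = ch; last by case: ch hs {IH hch} => [|c [|]].
rewrite -[RHS]flatten_seq1; congr flatten; apply/eq_in_map => c hc.
exact: IH (hch c hc).
Qed.

Lemma slen_prune s s' : lenok s -> prune s = [:: s'] -> ~~ isleaf s' ->
  slen s' = Num.max (slen s) (kap s).
Proof.
case: s => [|l ch] /=; first by move=> _ [<-].
rewrite /kap /= => /andP[hl _]; case: (flatten _) => [|c [|c' d]] //.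
  by case=> <-; case: c.
by case=> <- _; rewrite maxr0.
Qed.

Lemma over_sraise l c (b : btree R M) : over c b -> over (sraise l c) b.
Proof. by case: c => // l' ch; exact: over_snode_len. Qed.

Lemma over_braise s l (b : btree R M) : unitI l -> over s b -> over s (braise l b).
Proof.
by case: b => //= l' ss hl /andP[hl' ->]; rewrite unitI_max.
Qed.

Lemma hgt_braise s l (b : btree R M) : ~~ isleaf s -> over s b ->
  hgt (braise l b) = Num.max l (hgt b).
Proof.
case: b => [m|l' ss] /=; first by move=> /negbTE->.
by case: ss => [|s1 [|s2 ss]] //; rewrite maxA.
Qed.

Lemma over_renorm1 s l s1 : unitI l -> s1 != [::] ->
  (forall x, x \in s1 -> over s x) -> isleaf s || constant (map (@hgt R M) s1) ->
  over s (renorm l [:: s1]) /\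
  (~~ isleaf s -> hgt (renorm l [:: s1]) = Num.max l (head 0 (map (@hgt R M) s1))).
Proof.
case: s1 => [|x [|y s1]] // hl _ h hc; last first.
  split; last by case: s {h hc}.
  by rewrite /renorm over_V1 hl hc andbT /=; apply/and3P; split; [..|apply/allP => z hz]; apply: h; rewrite ?inE ?hz ?eqxx ?orbT.
rewrite /=; split; first by apply: over_braise => //; apply: h; rewrite mem_head.
by move=> hs; rewrite (hgt_braise l hs) // h ?mem_head.
Qed.

Definition good_seam (s1 : seq (btree R M)) (c : stree R) :=
  all (fun x => over c x && fits c x) s1.

Definition pseams ss ch := flatten (map2 (fun s1 c =>
  if nilp (prune c) then [::] else [:: map (bprune c) s1]) ss ch).

Lemma pseams_cat ss1 ss2 ch1 ch2 : size ss1 = size ch1 ->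
  pseams (ss1 ++ ss2) (ch1 ++ ch2) = pseams ss1 ch1 ++ pseams ss2 ch2.
Proof. by move=> e; rewrite /pseams map2_cat // flatten_cat. Qed.

Lemma size_pseams ss ch : size ss = size ch ->
  size (pseams ss ch) = size (flatten (map prune ch)).
Proof.
rewrite /pseams; elim: ss ch => [|s1 ss IH] [|c ch] //= [/IH e].
by rewrite !size_cat e; case: (prune_cases c) => [|[s']] ->.
Qed.

Lemma bprune_V2 s l ss : (1 < size ss)%N ->
  bprune s (Comp l ss) = renorm l (pseams ss (skids s)).
Proof. by case: ss => [|s1 [|s2 ss]]. Qed.

(** The clause on heights carries the induction. When the root of [s] is suppressed, the height
    grows to a maximum with [kap s], and by [slen_prune] the seam edge grows in the same way, so
    that [fits] survives at the parent. *)
Lemma over_bprune s b : over s b -> lenok s ->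
  exists s', [/\ prune s = [:: s'], over s' (bprune s b) &
    ~~ isleaf s' -> hgt (bprune s b) = Num.max (hgt b) (kap s)].
Proof.
move: s b; apply: over_ind => [m|s l s1 hl hs1 ho hc IH|l0 ch l ss hl hss hne hsz IH] hs.
- by exists SLeaf.
- have [x hx] : exists x, x \in s1.
    by case: s1 hs1 {ho hc IH} => // x s1 _; exists x; rewrite mem_head.
  have [s' [es' _ _]] := IH x hx hs; exists s'; split=> //.
    rewrite /bprune -/bprune; apply: (proj1 (over_renorm1 hl _ _ _)) => //.
    + by case: s1 hs1 {ho hc IH hx}.
    + move=> y /mapP[z hz ->].
      by have [s'' [es'' h _]] := IH z hz hs; move: es''; rewrite es' => -[->].
    + case hs' : (isleaf s') => //=; rewrite -map_comp.
      have hns : ~~ isleaf s by case: s es' {hs IH ho hc} => // -[e]; rewrite -e in hs'.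
      apply: (constant_map (v := Num.max (head 0 (map (@hgt R M) s1)) (kap s))) => y hy.
      have [s'' [es'' _ h]] := IH y hy hs; move: es'' h; rewrite es' => -[<-].
      by rewrite hs' /= => ->//; rewrite (hgt_const hns hc hy).
  move=> hs'; case: s1 hs1 ho hc IH hx => [|y [|z s1]] // _ ho hc IH _ /=.
  have [s'' [es'' _ h]] := IH y (mem_head _ _) hs; move: es'' h; rewrite es' => -[<-].
  by move=> ->//; rewrite maxA.
- have hch : forall c, c \in ch -> lenok c by move=> c hc; case/andP: hs => _ /allP; exact.
  rewrite bprune_V2 // (hgt_V2 l hss) /kap.
  have hp p : p \in zip ss ch -> forall x, x \in p.1 -> exists c',
      [/\ prune p.2 = [:: c'], over c' (bprune p.2 x) & fits c' (bprune p.2 x)].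
    move=> hp x hx; have [ho hf h] := IH p hp x hx.
    have hp2 := hch _ (mem_zip2 hp).
    have [c' [e h1 h2]] := h hp2; exists c'; split=> //.
    rewrite /fits; case hl' : (isleaf c') => //=.
    rewrite h2 ?hl' // (slen_prune hp2 e) ?hl' //.
    move: hf; rewrite /fits; case: p.2 e => /= [[e]|? ? _ /eqP-> //].
    by rewrite -e in hl'.
  (* The surviving seam vertices correspond to the surviving children, in order. *)
  have hS : all2 good_seam (pseams ss ch) (flatten (map prune ch)).
    rewrite /pseams; elim: ss ch hsz hp {IH hne hss hs hch} => [|s1 ss IHs] [|c ch] //= [e] hp.
    have IHs' := IHs ch e (fun p h x => hp p (mem_behead (h : p \in behead (_ :: _)) ) x).
    case: (prune_cases c) => [->//|[c' ec]]; rewrite ec /= IHs' andbT.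
    apply/allP => _ /mapP[x hx ->].
    have [c'' []] := hp (s1, c) (mem_head _ _) x hx.
    by rewrite /= ec => -[<-] -> ->.
  have hN : has (fun s1 => 0 < size s1)%N (pseams ss ch).
    rewrite /pseams; elim: ss ch hsz hp hne {IH hss hs hch hS} => [|s1 ss IHs] [|c ch] //= [e] hp.
    have IHs' := IHs ch e (fun p h x => hp p (mem_behead (h : p \in behead (_ :: _)) ) x).
    rewrite has_cat; case/orP => [h|/IHs'->]; last by rewrite orbT.
    case: s1 h hp {IHs'} => // x s1 _ hp.
    by have [c' [/= -> _ _]] := hp (x :: s1, c) (mem_head _ _) x (mem_head _ _).
  case/andP: hs => hl0 _.
  have := hS; rewrite all2E => /andP[/eqP eS _]; move: eS hS hN.
  rewrite [prune _]/=.
  case: (pseams ss ch) (flatten _) => [|x1 [|x2 S]] [|c1 [|c2 d]] // eS hS hN.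
    (* One child survives: the vertex drops to V_comp^1 or is suppressed, and the common height of
       its members is [slen c1], which is the value of [kap] here. *)
    exists (sraise l0 c1) => {eS}.
    move: hS hN; rewrite /= andbT orbF => /allP hS hN.
    have hx1 : x1 != [::] by case: x1 hN {hS}.
    have ho x : x \in x1 -> over (sraise l0 c1) x.
      by move=> /hS /andP[+ _]; exact: over_sraise.
    have hc : isleaf (sraise l0 c1) || constant (map (@hgt R M) x1).
      case: c1 hS {ho} => //= l1 ch1 hS.
      apply: (constant_map (v := l1)) => y hy.
      by have /andP[_ /eqP->] := hS y hy.
    have [h1 h2] := over_renorm1 hl hx1 ho hc.
    split=> // hleaf; rewrite h2 //.
    have -> : head 0 (map (@hgt R M) x1) = slen c1.
      case: x1 hx1 hS {ho hN hc h1 h2} => // y x1 _ hS /=.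
      have /andP[_] := hS y (mem_head _ _).
      by case: c1 hleaf {hS} => //= ? ? _ /eqP.
    by [].
  exists (SNode l0 [:: c1, c2 & d]); split => //.
    rewrite renorm_V2 //; apply/over_V2P => //.
    exists l0, [:: c1, c2 & d]; split=> // p hp' x hx.
    by have /all2_zipP[_ /(_ p hp')/allP/(_ x hx)/andP] := hS.
  by rewrite maxr0 // renorm_V2 // hgt_V2.
Qed.

End Prune.

(** * Labels over the leaves of the seam tree *)

Section Labels.
Variables (R : realType) (M : Type).

(** The group of labels over one leaf, by recursion along its address; [groups] filters a list of
    all marks, which is less suited to induction. *)
Fixpoint lab (b : btree R M) (lam : seq nat) : seq M :=
  match b with
  | Mark m => if lam is [::] then [:: m] else [::]
  | Comp l ss =>
    match ss with
    | [:: s1] => flatten (map (lab^~ lam) s1)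
    | _ => if lam is t :: lam' then
             flatten (nth [::] [seq map (lab^~ lam') s1 | s1 <- ss] t)
           else [::]
    end
  end.

Definition labs (s1 : seq (btree R M)) (lam : seq nat) : seq M :=
  flatten (map (lab^~ lam) s1).

Lemma lab_V1 l s1 : lab (Comp l [:: s1]) = labs s1.
Proof. by apply/funext => lam. Qed.

Lemma lab_V2 l ss t lam : (1 < size ss)%N ->
  lab (Comp l ss) (t :: lam) = labs (nth [::] ss t) lam.
Proof.
move=> h; have -> : lab (Comp l ss) (t :: lam) =
    flatten (nth [::] [seq map (lab^~ lam) s1 | s1 <- ss] t).
  by case: ss h => [|s1 [|s2 ss]].
have [ht|ht] := ltnP t (size ss); first by rewrite (nth_map [::]).
by rewrite !nth_default // size_map.
Qed.

Lemma lab_V2_nil l ss : (1 < size ss)%N -> lab (Comp l ss) [::] = [::].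
Proof. by case: ss => [|s1 [|s2 ss]]. Qed.

(** The offset [i] is arbitrary because the recursion of [mapi_from] advances it. *)
Lemma filter_labels_shift (ss : seq (seq (btree R M))) i t lam :
  [seq p.2 | p <- flatten (mapi_from (fun t s1 =>
      [seq (t :: p.1, p.2) | p <- flatten [seq marks c | c <- s1]]) i ss)
    & p.1 == t :: lam] =
  if (i <= t)%N then [seq p.2 | p <- flatten (map (@marks R M) (nth [::] ss (t - i)))
    & p.1 == lam] else [::].
Proof.
elim: ss i => [|s1 ss IH] i /=; first by rewrite nth_nil; case: ifP.
rewrite filter_cat map_cat IH filter_map -map_comp.
rewrite [X in map _ X ++ _](eq_filter (a2 := fun p => (i == t) && (p.1 == lam))); last first.
  by move=> p; rewrite /= eqseq_cons.
have [->|hit] := eqVneq i t; first by rewrite ltnn leqnn subnn cats0.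
rewrite filter_pred0 /= ltn_neqAle hit /=; case: ifP => // h.
have {}h : (i < t)%N by rewrite ltn_neqAle hit.
by rewrite -[(t - i)%N]prednK ?subn_gt0 //= subnS.
Qed.

Lemma lab_marks b lam : [seq p.2 | p <- marks b & p.1 == lam] = lab b lam.
Proof.
elim/btree_nested_ind: b lam => [m [|t lam]|l ss IH lam] //.
have IHs s1 lam' : s1 \in ss ->
    [seq p.2 | p <- flatten (map (@marks R M) s1) & p.1 == lam'] = labs s1 lam'.
  move=> hs; rewrite filter_flatten map_flatten -!map_comp /labs; congr flatten.
  by apply/eq_in_map => c hc /=; exact: IH hs hc _.
have [h|h] := ltnP 1 (size ss); last first.
  case: ss h IH IHs => [|s1 [|]] //= _ IH IHs; first by case: lam => // t lam; rewrite nth_nil.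
  rewrite /mapi /= cats0 -/(labs s1 lam) -IHs ?mem_head //.
  by rewrite filter_map -map_comp.
have -> : marks (Comp l ss) = flatten (mapi_from (fun t s1 =>
    [seq (t :: p.1, p.2) | p <- flatten [seq marks c | c <- s1]]) 0 ss).
  by rewrite /= h.
case: lam => [|t lam].
  rewrite lab_V2_nil // /=.
  elim: (ss) 0%N => //= s1 ss' IHs' i; rewrite filter_cat map_cat IHs' filter_map.
  by rewrite filter_pred0.
rewrite filter_labels_shift subn0 lab_V2 //=.
have [ht|ht] := ltnP t (size ss); first by rewrite IHs ?mem_nth.
by rewrite nth_default.
Qed.

Lemma groupsE b (s : stree R) : groups b s = map (lab b) (leaves s).
Proof. by apply: eq_map => lam; exact: lab_marks. Qed.

Definition lgroups (s1 : seq (btree R M)) (c : stree R) : seq (seq M) :=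
  map (labs s1) (leaves c).

Definition lgroups2 ss ch := flatten (map2 lgroups ss ch).

Lemma groups_V1 l s1 s : groups (Comp l [:: s1]) s = lgroups s1 s.
Proof. by rewrite groupsE lab_V1. Qed.

Lemma groups_V2 l l0 ss ch : (1 < size ss)%N -> size ss = size ch ->
  groups (Comp l ss) (SNode l0 ch) = lgroups2 ss ch.
Proof.
move=> h e; rewrite groupsE /= map_flatten /lgroups2 /mapi; congr flatten.
suff H pre ss' : pre ++ ss' = ss -> size ss' = size ch ->
    map (map (lab (Comp l ss))) (mapi_from (fun t c =>
      [seq t :: a | a <- leaves c]) (size pre) ch) = map2 lgroups ss' ch.
  exact: (H [::] ss).
elim: ch {e} pre ss' => [|c ch IH] pre [|s1 ss'] //= e [e'].
rewrite -map_comp -(IH (rcons pre s1)) ?cat_rcons // size_rcons; congr (_ :: _).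
apply: eq_map => lam; rewrite -[LHS]/(lab (Comp l ss) (_ :: _)) lab_V2 // -e nth_cat ltnn subnn //.
Qed.

Lemma lab_braise l b : lab (braise l b) = lab b.
Proof. by case: b. Qed.

Lemma lab_renorm l ss : lab (renorm l ss) = lab (Comp l ss).
Proof.
apply/funext; case: ss => [|[|x [|y s1]] [|s2 ss]] // lam.
by rewrite /renorm lab_braise lab_V1 /labs /= cats0.
Qed.

Lemma leaves_sraise l (c : stree R) : leaves (sraise l c) = leaves c.
Proof. by case: c. Qed.

Lemma size_leaves_node l ch : size (leaves (SNode l ch)) =
  sumn (map (fun c : stree R => size (leaves c)) ch).
Proof.
rewrite /= size_flatten /shape /mapi; congr sumn.
by elim: ch 0%N => //= c ch IH i; rewrite size_map IH.
Qed.

(** A flagged leaf is a childless interior vertex and is no longer counted by [leaves], so pruning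
    loses nothing. *)
Lemma size_leaves_prune (s : stree R) :
  sumn (map (fun c : stree R => size (leaves c)) (prune s)) = size (leaves s).
Proof.
elim/stree_nested_ind: s => // l ch IH; rewrite size_leaves_node.
rewrite -(_ : sumn (map (fun c : stree R => size (leaves c))
    (flatten (map (@prune R) ch))) = sumn (map _ ch)) => [/=|].
  case: (flatten _) => [|c [|c' d]] //; first by rewrite /= leaves_sraise.
  transitivity (size (leaves (SNode l [:: c, c' & d])) + 0)%N; first by [].
  by rewrite addn0 size_leaves_node.
elim: ch IH => //= x ch IHch IH; rewrite map_cat sumn_cat IH ?mem_head //.
by rewrite IHch // => y hy; rewrite IH // inE hy orbT.
Qed.

Lemma lgroups_eq f (s1 : seq (btree R M)) (c c' : stree R) :
  size (leaves c) = size (leaves c') ->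
  (forall x, x \in s1 -> map (lab (f x)) (leaves c') = map (lab x) (leaves c)) ->
  lgroups (map f s1) c' = lgroups s1 c.
Proof.
move=> e; elim: s1 => [|x s1 IH] h.
  rewrite /lgroups; apply: (@eq_from_nth _ [::]); rewrite !size_map // => i hi.
  by rewrite !(nth_map [::]) ?e // -e.
apply: (@eq_from_nth _ [::]); rewrite !size_map // => i hi.
have IH' := IH (fun y hy => h y (mem_behead (hy : y \in behead (_ :: _)))).
have := congr1 (nth [::] ^~ i) IH'; have := congr1 (nth [::] ^~ i) (h x (mem_head _ _)).
have hi' : (i < size (leaves c))%N by rewrite e.
rewrite /lgroups /= !(nth_map [::]) // /labs /= => <- <-.
by rewrite -map_comp.
Qed.

(** Pruning changes the addresses of the leaves but neither their planar order nor what lies over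
    them. *)
Lemma groups_bprune s (b : btree R M) s' : over s b -> lenok s -> prune s = [:: s'] ->
  groups (bprune s b) s' = groups b s.
Proof.
rewrite !groupsE; move=> h; move: s b h s'.
apply: over_ind => [m|s l s1 hl hs1 ho hc IH|l0 ch l ss hl hss hne hsz IH] s' hs.
- by case=> <-.
- move=> es; rewrite /bprune -/bprune lab_renorm !lab_V1.
  apply: lgroups_eq => [|x hx]; last exact: IH.
  by have := size_leaves_prune s; rewrite es /= addn0.
rewrite bprune_V2 // lab_renorm -!(groupsE (Comp _ _)) (_ : skids _ = ch) //.
rewrite groups_V2 //.
have hch : forall c, c \in ch -> lenok c by move=> c hc; case/andP: hs => _ /allP; exact.
have -> : lgroups2 ss ch = lgroups2 (pseams ss ch) (flatten (map (@prune R) ch)).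
  rewrite /lgroups2 /pseams.
  elim: ss ch hsz IH hch {hne hss hs} => [|s1 ss IHs] [|c ch] //= [e] IH hch.
  have IHs' := IHs ch e (fun p h x => IH p (mem_behead (h : p \in behead (_ :: _)) ) x)
     (fun x h => hch x (mem_behead (h : x \in behead (_ :: _)) )).
  rewrite IHs'; have := size_leaves_prune c.
  case: (prune_cases c) => [->|[c' ec]] /=.
    by move/esym/size0nil; rewrite /lgroups => ->.
  rewrite ec /= addn0 => ec'; congr (_ ++ _); apply/esym/lgroups_eq => // x hx.
  by have [_ _] := IH (s1, c) (mem_head _ _) x hx; apply; rewrite ?hch ?mem_head.
have : size (pseams ss ch) = size (flatten (map (@prune R) ch)) by exact: size_pseams.
rewrite [prune _]/=.
case: (pseams ss ch) (flatten _) => [|x1 [|x2 S]] [|c1 [|c2 d]] // eS [<-].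
  by rewrite groupsE leaves_sraise lab_V1 /lgroups2 /= cats0.
by rewrite groups_V2.
Qed.

End Labels.

(** * The path conditions and their recursive form *)

Section Addresses.
Variables (R : realType) (M : Type).

Definition bchild (b : btree R M) (p : nat * nat) : option (btree R M) :=
  if b is Comp _ ss then onth (nth [::] ss p.1) p.2 else None.

Definition step_of (b : btree R M) (t : nat) : seq nat :=
  if b is Comp _ ss then if (1 < size ss)%N then [:: t] else [::] else [::].

Lemma bsub_cons b p al : bsub b (p :: al) =
  if bchild b p is Some c then bsub c al else None.
Proof. by case: p b => t j [m|l ss]. Qed.

Lemma coh_cons (b c : btree R M) p al : bchild b p = Some c ->
  coh b (p :: al) = step_of b p.1 ++ coh c al.
Proof. by case: p b => t j [m|l ss] //= ->. Qed.

Lemma bchild_mem l ss p c : bchild (Comp l ss) p = Some c ->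
  (p.1 < size ss)%N /\ c \in nth [::] ss p.1.
Proof.
case: p => t j /= h; have [s1 [s2 [e _]]] := onth_some h; split; last first.
  by rewrite e mem_cat mem_head orbT.
by rewrite ltnNge; apply/negP => h'; move: e; rewrite nth_default //; case: s1 {h}.
Qed.

Lemma mem_onth (A : eqType) (s : seq A) c : c \in s -> exists j, onth s j = Some c.
Proof.
elim: s => //= x s IH; rewrite inE => /orP[/eqP->|/IH[j hj]]; first by exists 0%N.
by exists j.+1.
Qed.

Lemma mem_bchild l ss t c : c \in nth [::] ss t ->
  exists j, bchild (Comp l ss) (t, j) = Some c.
Proof. exact: mem_onth. Qed.

Lemma onth_nth (A : Type) (x0 : A) (s : seq A) t : (t < size s)%N ->
  onth s t = Some (nth x0 s t).
Proof. by elim: s t => [|x s IH] [|t] //= h; exact: IH. Qed.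

Lemma over_bchild s l ss p c : over s (Comp l ss) ->
  bchild (Comp l ss) p = Some c ->
  exists s', [/\ over s' c,
     forall a, ssub s (step_of (Comp l ss) p.1 ++ a) = ssub s' a,
     ~~ (1 < size ss)%N -> s' = s & (1 < size ss)%N -> fits s' c].
Proof.
move=> ho /bchild_mem[ht hc]; have [h|h] := ltnP 1 (size ss); last first.
  case: ss h ht hc ho => [|s1 [|]] // _; case: (p.1) => // _ hc.
  by rewrite over_V1 => /and4P[_ _ /allP/(_ c hc) h _]; exists s.
move/over_V2P: ho => /(_ h) [l0 [ch [-> hl hne e hp]]].
exists (nth SLeaf ch p.1); have ht' : (p.1 < size ch)%N by rewrite -e.
have [] := hp (nth [::] ss p.1, nth SLeaf ch p.1) _ c hc.
  by apply: mem_zip_nth => //; exact: e.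
by move=> h1 h2; split=> // a; rewrite /= h /= (onth_nth SLeaf).
Qed.

Lemma over_bsub s (b : btree R M) al c : over s b -> bsub b al = Some c ->
  exists2 s', ssub s (coh b al) = Some s' & over s' c.
Proof.
elim: al b s => [|p al IH] b s ho.
  by case: b ho => [m|l ss] ho /= -[<-]; exists s => //; case: (s).
rewrite bsub_cons; case e: bchild => [d|] // h.
have [l [ss eb]] : exists l ss, b = Comp l ss by case: b e {ho} => // l ss; exists l, ss.
rewrite eb in ho e *; have [s' [ho' hs' _ _]] := over_bchild ho e.
by rewrite (coh_cons _ e) hs'; exact: IH ho' h.
Qed.

Lemma over_bstable s (b : btree R M) : over s b -> bstable b.
Proof.
move=> ho al l ss h; have [s' _ ho'] := over_bsub ho h.
case: ss {h} ho' => [|s1 [|s2 ss]] ho'; first by have := over_size ho'.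
  by move: ho'; rewrite over_V1 => /and4P[].
by move/over_V2P: ho' => /(_ isT) [l0 [ch []]].
Qed.

Lemma over_coherent s (b : btree R M) : over s b -> coherent b s.
Proof.
move=> ho; split=> [al l ss h h1|al m h]; have [s' e ho'] := over_bsub ho h.
  move/over_V2P: ho' => /(_ h1) [l0 [ch [es _ _ esz _]]].
  by exists l0, ch; rewrite e es esz.
by rewrite e; case: s' ho' {e}.
Qed.

(** [pathmax] with the root included: seen from the parent, this is the maximum over a path that
    stops just before the parent. *)
Definition fullmax (b : btree R M) al : R :=
  \big[Num.max/0]_(0 <= i < (size al).+1) blen b (take i al).

Lemma blen_cons b p c al : bchild b p = Some c -> blen b (p :: al) = blen c al.
Proof. by move=> e; rewrite /blen bsub_cons e. Qed.

Lemma pathmax_cons b p c al be : bchild b p = Some c ->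
  pathmax b (p :: al) (p :: be) = pathmax c al be.
Proof.
move=> e; rewrite /pathmax /= big_add1 /=.
by apply: eq_bigr => i _; rewrite (blen_cons _ e).
Qed.

Lemma pathmax_nil b p c al : bchild b p = Some c ->
  pathmax b (p :: al) [::] = fullmax c al.
Proof.
move=> e; rewrite /pathmax /fullmax /= big_add1 /=.
by apply: eq_bigr => i _; rewrite (blen_cons _ e).
Qed.

Lemma fullmax_cons b p c al : bchild b p = Some c ->
  fullmax b (p :: al) = Num.max (blen b [::]) (fullmax c al).
Proof.
move=> e; rewrite {1}/fullmax big_nat_recl //=; congr Num.max.
by apply: eq_bigr => i _; rewrite (blen_cons _ e).
Qed.

Lemma V2_cons (b : btree R M) p al : V2 b (p :: al) ->
  exists2 c, bchild b p = Some c & V2 c al.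
Proof.
by case=> l [ss []]; rewrite bsub_cons; case: bchild => // c h h1; exists c => //; exists l, ss.
Qed.

Lemma V2_consE (b c : btree R M) p al : bchild b p = Some c ->
  V2 b (p :: al) <-> V2 c al.
Proof. by move=> e; rewrite /V2 bsub_cons e. Qed.

Lemma V1_cons (b : btree R M) p al : V1 b (p :: al) ->
  exists2 c, bchild b p = Some c & V1 c al.
Proof.
by case=> l [s]; rewrite bsub_cons; case: bchild => // c h; exists c => //; exists l, s.
Qed.

Lemma V1_consE (b c : btree R M) p al : bchild b p = Some c ->
  V1 b (p :: al) <-> V1 c al.
Proof. by move=> e; rewrite /V1 bsub_cons e. Qed.

Lemma bchild_Comp (b c : btree R M) p : bchild b p = Some c ->
  exists l ss, b = Comp l ss.
Proof. by case: b => // l ss; exists l, ss. Qed.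

Lemma V2_nil (b : btree R M) : V2 b [::] <-> exists l ss, b = Comp l ss /\ (1 < size ss)%N.
Proof.
split=> -[l [ss [h h1]]]; exists l, ss; split=> //; last by rewrite h.
by case: b h => [m [] //|l' ss' [-> ->]].
Qed.

Lemma V1_nil (b : btree R M) : V1 b [::] <-> exists l s1, b = Comp l [:: s1].
Proof.
split=> -[l [s1 h]]; exists l, s1; last by rewrite h.
by case: b h => [m [] //|l' ss' [-> ->]].
Qed.

(** Through vertices of V_comp^1, [hgt] follows the first member of the seam; constancy of the
    heights lets it follow the member on the given path. *)
Lemma hgt_fullmax s (b : btree R M) al : over s b -> ~~ isleaf s -> V2 b al ->
  coh b al = [::] -> fullmax b al = hgt b.
Proof.
elim: al b => [|p al IH] b ho hs.
  move=> /V2_nil [l [ss [eb h]]] _; rewrite eb in ho *.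
  rewrite /fullmax [size _]/= big_nat_recl // big_geq // /blen [bsub _ _]/= maxr0 ?hgt_V2 //.
  exact: over_unitI ho.
case/V2_cons => c e h; rewrite (coh_cons _ e) (fullmax_cons _ e).
have [l [ss eb]] := bchild_Comp e; rewrite eb in ho e *.
have [h1|h1] := ltnP 1 (size ss); first by rewrite /= h1.
have [s' [ho' _ + _]] := over_bchild ho e; rewrite -leqNgt => /(_ h1) es.
have [_] := bchild_mem e.
case: ss h1 {eb} ho e => [|s1 [|]] // _ ho e; first by rewrite nth_nil.
case: (p.1) => [|?] /=; last by rewrite nth_nil.
move=> hc h2; rewrite (IH c) // -?es // /blen /=; congr Num.max.
by move: ho; rewrite over_V1 => /and4P[_ _ _ h3]; exact: hgt_const hs h3 hc.
Qed.

(** Supplies the paths by which heights are turned into instances of the path conditions. *)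
Lemma over_V2_exists s (b : btree R M) : over s b -> ~~ isleaf s ->
  exists2 al, V2 b al & coh b al = [::].
Proof.
move: s b; apply: over_ind => [//|s l s1 hl h1 ho hc IH|l0 ch l ss hl h _ _ _] hs; last first.
  by exists [::] => //; exists l, ss.
case: s1 h1 {ho hc} IH => // x s1 _ IH.
have [al h2 h3] := IH x (mem_head _ _) hs.
have e : bchild (Comp l [:: x :: s1]) (0, 0)%N = Some x by [].
by exists ((0, 0)%N :: al); [apply/(V2_consE _ e) | rewrite (coh_cons _ e)].
Qed.

(** Each passage through a vertex of V_comp^{>=2} adds one entry to the image under [coh], and none
    is ever removed. *)
Lemma coh_V2_prefix (b c : btree R M) al be : V2 b be -> prefix be al -> be != al ->
  bsub b al = Some c -> coh b al != [::].
Proof.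
elim: be b al => [|p be IH] b [|q al] //.
  move=> /V2_nil[l [ss [-> h]]] _ _; rewrite bsub_cons.
  case e: bchild => [d|] // _; rewrite (coh_cons _ e) /= h //.
case/V2_cons => d e h; rewrite prefix_cons eqseq_cons => /andP[/eqP <- h2].
rewrite eqxx andTb bsub_cons e => h3 h4; rewrite (coh_cons _ e).
by have := IH d al h h2 h3 h4; case: coh => // x y; case: step_of.
Qed.

Lemma coh_nonnil_V2 (b : btree R M) al : V2 b al -> coh b al != [::] ->
  exists ga, [/\ V2 b ga, prefix ga al & ga != al].
Proof.
elim: al b => [|p al IH] b; first by move=> /V2_nil[l [ss [-> h]]].
case/V2_cons => c e h; rewrite (coh_cons _ e).
have [l [ss eb]] := bchild_Comp e; rewrite {}eb in e *.
rewrite /=; case: ifP => [h1 _|h1 h2].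
  by exists [::]; split=> //; exists l, ss.
have [ga [h3 h4 h5]] := IH c h h2; exists (p :: ga).
by split; [apply/(V2_consE _ e) | rewrite /= eqxx | rewrite eqseq_cons eqxx].
Qed.

Definition cond1 (b : btree R M) := forall alpha1 alpha2 beta,
  V2 b alpha1 -> V2 b alpha2 -> V1 b beta ->
  coh b alpha1 = coh b beta -> coh b alpha2 = coh b beta ->
  prefix beta alpha1 -> prefix beta alpha2 ->
  pathmax b alpha1 beta = pathmax b alpha2 beta.

Definition cond2 (s : stree R) (b : btree R M) := forall rho l ch alpha beta,
  rho != [::] -> ssub s rho = Some (SNode l ch) ->
  V2 b alpha -> coh b alpha = rho -> first_V2 b alpha beta ->
  l = pathmax b alpha beta.

Lemma over_coh_interior (s : stree R) (b : btree R M) al : over s b -> V2 b al -> coh b al = [::] -> ~~ isleaf s.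
Proof.
move=> ho [l [ss [h h1]]] e; have [s' + ho'] := over_bsub ho h; rewrite e.
move/over_V2P: ho' => /(_ h1)[l0 [ch [-> _ _ _ _]]].
by case: s {ho}.
Qed.

Lemma over_cond1 s (b : btree R M) : over s b -> cond1 b.
Proof.
move=> ho a1 a2 be; elim: be b s a1 a2 ho => [|p be IH] b s a1 a2 ho.
  move=> h1 h2 /V1_nil[l [s1 eb]]; rewrite {}eb in ho h1 h2 * => /= e1 e2 _ _.
  have hs := over_coh_interior ho h1 e1.
  suff H a : V2 (Comp l [:: s1]) a -> coh (Comp l [:: s1]) a = [::] ->
    pathmax (Comp l [:: s1]) a [::] = head 0 (map (@hgt R M) s1) by rewrite !H.
  case: a => [/V2_nil[? [? [[_ <-]]]] //|p a /V2_cons[c e h]].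
  rewrite (coh_cons _ e) (pathmax_nil _ e) /= => h'.
  have [s' [ho' _ /(_ isT) es _]] := over_bchild ho e.
  rewrite (hgt_fullmax ho') ?es //.
  have [] := bchild_mem e; case: (p.1) => //= _ hc.
  by move: ho; rewrite over_V1 => /and4P[_ _ _ h3]; exact: hgt_const hs h3 hc.
case: a1 a2 => [|q1 a1] [|q2 a2] // h1 h2 /V1_cons[c e h] e1 e2.
rewrite !prefix_cons => /andP[/eqP q1E p1] /andP[/eqP q2E p2].
rewrite -{}q1E -{}q2E in h1 h2 e1 e2 *; move: e1 e2; rewrite !(coh_cons _ e).
move=> /eqP; rewrite eqseq_cat // eqxx => /eqP e1.
move=> /eqP; rewrite eqseq_cat // eqxx => /eqP e2.
rewrite !(pathmax_cons _ _ e).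
have [l [ss eb]] := bchild_Comp e; rewrite {}eb in ho e h1 h2.
have [s' [ho' _ _ _]] := over_bchild ho e.
by apply: (IH c s') => //; [exact/(V2_consE _ e) | exact/(V2_consE _ e)].
Qed.

Lemma over_cond2 s (b : btree R M) : over s b -> cond2 s b.
Proof.
move=> ho rho l ch al be hr hs h er; rewrite -{rho}er in hr hs; move: hs hr h.
elim: al be b s ho => [|p al IH] be b s ho; first by case: b {ho}.
move=> hs hr /V2_cons[c e h] [f1 f2 f3 f4].
move: hs hr; rewrite (coh_cons _ e) => hs hr.
have [l1 [ss eb]] := bchild_Comp e; rewrite {}eb in ho e f1 f4 hs hr *.
have [s' [ho' hs' h1 h2]] := over_bchild ho e.
rewrite hs' in hs.
(* If a vertex of V_comp^{>=2} lies strictly between [c] and [al], the first such vertex after [al]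
   is inside [c]. *)
have below ga : V2 c ga -> prefix ga al -> ga != al ->
    exists2 be', be = p :: be' & first_V2 c al be'.
  move=> g1 g2 g3.
  have : prefix (p :: ga) be.
    apply: f4; first exact/(V2_consE _ e).
    + by rewrite prefix_cons eqxx.
    + by rewrite eqseq_cons eqxx.
  case: be f1 f2 f3 f4 => // q be f1 f2 f3 f4.
  rewrite prefix_cons => /andP[/eqP pq g4]; rewrite -pq in f1 f2 f3 f4 *.
  exists be => //; split; first exact/(V2_consE _ e).
  - by move: f2; rewrite prefix_cons eqxx.
  - by move: f3; rewrite eqseq_cons eqxx.
  move=> g k1 k2 k3; have := f4 (p :: g); rewrite !prefix_cons eqseq_cons !eqxx.
  by apply=> //; exact/(V2_consE _ e).
(* If [al] is not over the seam root of the child, everything happens inside the child. Otherwise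
   [be] is the root, and the maximum is the height of the child, which [fits] equates with [l]. *)
have [e0|e0] := eqVneq (coh c al) [::]; last first.
  have [ga [g1 g2 g3]] := coh_nonnil_V2 h e0.
  have [be' -> hf] := below ga g1 g2 g3.
  by rewrite (pathmax_cons _ _ e); exact: IH hs e0 h hf.
rewrite e0 in hs hr *.
have h3 : (1 < size ss)%N by move: hr; rewrite /=; case: ifP.
have es' : s' = SNode l ch by move: hs; case: (s') => [|? ?] //= -[-> ->].
have -> : be = [::].
  case: be f1 f2 f3 {f4 below} => // q be /V2_cons[d e'].
  move=> k1; rewrite prefix_cons eqseq_cons => /andP[/eqP eq k2]; rewrite eq eqxx /= => k3.
  rewrite eq e in e'; case: e' => e'; rewrite -e' in k1.
  have [l2 [ss2 [k4 _]]] := h.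
  by have := coh_V2_prefix k1 k2 k3 k4; rewrite e0.
rewrite (pathmax_nil _ e) (hgt_fullmax ho') ?es' //.
by have := h2 h3; rewrite es' /fits /= => /eqP.
Qed.

Lemma all_blens (P : pred R) l ss : all P (blens (Comp l ss : btree R M)) =
  P l && all (all (fun c => all P (blens c))) ss.
Proof.
rewrite /=; congr andb; elim: ss => //= s1 ss IH; rewrite all_cat IH; congr andb.
by elim: s1 => //= c s1 IHs; rewrite all_cat IHs.
Qed.

Lemma over_lens s (b : btree R M) : over s b -> all (@unitI R) (blens b).
Proof.
move: s b; apply: over_ind => [//|s l s1 hl _ _ _ IH|l0 ch l ss hl h _ e IH];
  rewrite all_blens hl //=; first by rewrite andbT; apply/allP.
apply/allP => s1 /(nthP [::])[t ht <-]; apply/allP => c hc.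
by have [] := IH (nth [::] ss t, nth SLeaf ch t) (mem_zip_nth _ _ e ht) c hc.
Qed.

(** The conditions pass to a child because prefixing both ends of a path by [p] does not change
    [pathmax]. At the root, constancy of heights is condition 1 with [beta] the root, and [fits] is
    condition 2 with [beta] the root. *)
Lemma conditions_over b s : bstable b -> coherent b s -> cond1 b -> cond2 s b ->
  all (@unitI R) (blens b) -> over s b.
Proof.
elim/btree_nested_ind: b s => [m|l ss IH] s hb [hc hm] h1 h2.
  by move=> _; have := hm [::] m erefl; case: (s) => //= ? ? [].
rewrite all_blens => /andP[hl hall].
have child p c s' : bchild (Comp l ss) p = Some c ->
    (forall a, ssub s (step_of (Comp l ss) p.1 ++ a) = ssub s' a) -> over s' c.
  move=> e es; have [ht hcm] := bchild_mem e.
  apply: (IH (nth [::] ss p.1)) => //; first exact: mem_nth.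
  - by move=> al l' ss' h; apply: (hb (p :: al) l'); rewrite bsub_cons e.
  - split=> al.
      move=> l' ss' h; have := hc (p :: al) l' ss'.
      by rewrite bsub_cons e (coh_cons _ e) es; apply.
    move=> m h; have := hm (p :: al) m.
    by rewrite bsub_cons e (coh_cons _ e) es; apply.
  - move=> a1 a2 be k1 k2 k3 k4 k5 k6 k7.
    rewrite -!(pathmax_cons _ _ e); apply: h1; rewrite ?(coh_cons _ e) ?k4 ?k5 //.
    + exact/(V2_consE _ e).
    + exact/(V2_consE _ e).
    + exact/(V1_consE _ e).
    + by rewrite prefix_cons eqxx.
    + by rewrite prefix_cons eqxx.
  - move=> rho l' ch' a be k1 k2 k3 k4 [f1 f2 f3 f4].
    rewrite -(pathmax_cons _ _ e); apply: (h2 (step_of (Comp l ss) p.1 ++ rho) l' ch').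
    + by case: (rho) k1 => // x y; case: step_of.
    + by rewrite es.
    + exact/(V2_consE _ e).
    + by rewrite (coh_cons _ e) k4.
    + split; first exact/(V2_consE _ e).
      * by rewrite prefix_cons eqxx.
      * by rewrite eqseq_cons eqxx.
      case=> [|q ga]; first by rewrite prefix0s.
      rewrite prefix_cons eqseq_cons => k5 /andP[/eqP eq k6].
      rewrite eq in k5 *; rewrite eqxx !andTb prefix_cons eqxx => k7.
      by apply: f4 => //; exact/(V2_consE _ e).
  - by move/allP: hall => /(_ _ (mem_nth [::] ht)) /allP/(_ c hcm).
have := hb [::] l ss erefl; case: ss IH hb hc hm h1 h2 hall child => [|s1 [|s2 ss]] // IH hb hc hm h1 h2 hall child.
  move=> hs1; rewrite over_V1 hl hs1 /=.
  have hov c : c \in s1 -> over s c.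
    move=> hcs; have [j hj] := @mem_bchild l [:: s1] 0 c hcs.
    by apply: child hj _.
  apply/andP; split; first by apply/allP.
  (* Each height is a maximum over a path from some vertex of V_comp^{>=2} over the root of [s]; two
     such paths are compared at the root of the bubble tree, which is in V_comp^1. *)
  case hs: (isleaf s) => //=; apply: (constant_map (v := head 0 (map (@hgt R M) s1))).
  move=> y hy; case: s1 hs1 hov hy {IH hb hc hm h2 hall child} h1 => // x s1 _ hov hy h1 /=.
  have [a1 k1 k2] := over_V2_exists (hov _ hy) (negbT hs).
  have [a2 k3 k4] := over_V2_exists (hov _ (mem_head _ _)) (negbT hs).
  have [j hj] := @mem_bchild l [:: x :: s1] 0 y hy.
  have [j' hj'] := @mem_bchild l [:: x :: s1] 0 x (mem_head _ _).
  rewrite -(hgt_fullmax (hov _ hy) (negbT hs) k1 k2).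
  rewrite -(hgt_fullmax (hov _ (mem_head _ _)) (negbT hs) k3 k4).
  rewrite -(pathmax_nil _ hj) -(pathmax_nil _ hj'); apply: h1.
  - exact/(V2_consE _ hj).
  - exact/(V2_consE _ hj').
  - by exists l, (x :: s1).
  - by rewrite (coh_cons _ hj) k2.
  - by rewrite (coh_cons _ hj') k4.
  - by [].
  - by [].
move=> hne.
have [l0 [ch [es esz]]] : exists l0 ch, s = SNode l0 ch /\ size ch = size [:: s1, s2 & ss].
  have [l0 [ch [+ h]]] := hc [::] l _ erefl isT.
  by case: (s) => [|l' ch'] //= -[_ ech]; exists l', ch'; rewrite ech.
apply/over_V2P => //; exists l0, ch; split=> //.
move=> p /(nthP ([::], SLeaf)) [t]; rewrite size_zip esz minnn => ht <-.
rewrite nth_zip /= ?esz // => x hx.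
have [j hj] := @mem_bchild l _ t x hx.
have ho : over (nth SLeaf ch t) x.
  apply: child hj _ => a; rewrite es [step_of _ _]/= cat1s /=.
  by rewrite (onth_nth SLeaf) // esz.
split=> //; rewrite /fits; case ec: (nth SLeaf ch t) => [|l' ch'] //=.
have hnl : ~~ isleaf (nth SLeaf ch t) by rewrite ec.
have [a k1 k2] := over_V2_exists ho hnl.
rewrite -(hgt_fullmax ho hnl k1 k2) -(pathmax_nil _ hj); apply/eqP/esym.
apply: (h2 [:: t] l' ch') => //.
- by rewrite es /= (onth_nth SLeaf) ?esz // ec.
- exact/(V2_consE _ hj).
- by rewrite (coh_cons _ hj) k2.
(* The root is the first vertex of V_comp^{>=2} after [a]: an earlier one would give [a] a nonempty
   image in the child. *)
split=> //; first by exists l, [:: s1, s2 & ss].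
move=> [|q ga] // k3; rewrite prefix_cons eqseq_cons => /andP[/eqP eq k4].
rewrite eq eqxx /= => k5; rewrite eq in k3.
have [l2 [ss2 [k6 _]]] := k1.
by move/(V2_consE _ hj): k3 => /coh_V2_prefix/(_ k4 k5 k6); rewrite k2.
Qed.

End Addresses.

(** * Forgetting one leaf *)

Section ForgetOne.
Variables (R : realType) (M : Type).

Definition wf (x : tpair R M) : Prop :=
  [/\ sok x.2, over x.2 x.1, head 0 (blens x.1) = 0 & head 0 (slens x.2) = 0].

Lemma all_slens (P : pred R) l ch :
  all P (slens (SNode l ch)) = P l && all (fun c => all P (slens c)) ch.
Proof. by rewrite /=; congr andb; elim: ch => //= c ch IH; rewrite all_cat IH. Qed.

Lemma sok_sstable (s : stree R) : sok s -> sstable s.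
Proof.
elim/stree_nested_ind: s => [|l ch IH] hs [|t a] // l' ch' /=.
  by case=> _ <-; case/and3P: hs.
case e: onth => [c|] // h; have [s1 [s2 [ech _]]] := onth_some e.
have hc : c \in ch by rewrite ech mem_cat mem_head orbT.
by apply: (IH c hc) h; case/and3P: hs => _ _ /allP/(_ c hc).
Qed.

Lemma sok_lens (s : stree R) : sok s -> all (@unitI R) (slens s).
Proof.
elim/stree_nested_ind: s => // l ch IH /and3P[hl _ /allP h].
by rewrite all_slens hl /=; apply/allP => c hc; apply: IH (h c hc).
Qed.

Lemma sstable_sok (s : stree R) : sstable s -> all (@unitI R) (slens s) -> sok s.
Proof.
elim/stree_nested_ind: s => // l ch IH hs; rewrite all_slens => /andP[hl /allP h].
apply/and3P; split=> //; first exact: (hs [::] l ch).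
apply/allP => c hc; apply: (IH c hc); last exact: h.
move=> a l' ch' e; have [t ht] := mem_onth hc.
by apply: (hs (t :: a) l'); rewrite /= ht.
Qed.

Lemma unitI0 : unitI (0 : R).
Proof. by rewrite /unitI lexx ler01. Qed.

Lemma all_behead (P : pred R) t : P (head 0 t) -> all P t = all P (behead t).
Proof. by case: t => //= x t ->. Qed.

(** The dummies at the roots are 0, hence in [0,1], so bounding [coords] amounts to bounding all
    lengths. From here on [wf] stands for the stability, coherence and metric conditions. *)
Lemma is_type_metricP n (x : tpair R M) :
  is_type n x /\ metric x <-> wf x /\ map size (groups x.1 x.2) = n.
Proof.
split.
  case=> -[h1 h2 h3 h4] [[k1 k1'] k2 k3 k4]; split=> //.
  move: k2; rewrite /coords all_cat => /andP[k2 k2'].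
  have hb : all (@unitI R) (blens x.1) by rewrite all_behead ?k1 ?unitI0.
  have hs : all (@unitI R) (slens x.2) by rewrite all_behead ?k1' ?unitI0.
  split=> //; first exact: sstable_sok.
  exact: conditions_over.
case=> -[h1 h2 h3 h4] h5; split.
  split=> //; [exact: sok_sstable | exact: over_bstable h2 | exact: over_coherent].
split=> //.
- have := over_lens h2; rewrite all_behead ?h3 ?unitI0 // => k1.
  have := sok_lens h1; rewrite all_behead ?h4 ?unitI0 // => k2.
  by rewrite /coords all_cat; apply/andP; split.
- exact: over_cond1 h2.
- exact: over_cond2.
Qed.

(** A flag keeps the addresses of all other vertices, unlike a deletion. Its length 0 is a
    normalization that makes [fill_inj] hold. *)
Fixpoint sflag (lam : seq nat) (s : stree R) : stree R :=
  match lam, s with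
  | [::], SLeaf => SNode 0 [::]
  | t :: lam', SNode l ch =>
      SNode l (mapi (fun i c => if i == t then sflag lam' c else c) ch)
  | _, _ => s
  end.

Lemma sflag_at t lam l ch1 (c : stree R) ch2 : size ch1 = t ->
  sflag (t :: lam) (SNode l (ch1 ++ c :: ch2)) = SNode l (ch1 ++ sflag lam c :: ch2).
Proof. by move=> e; rewrite /= (mapi_at (sflag lam) id) // !map_id. Qed.

Lemma leaves_nilP (s : stree R) : ([::] \in leaves s) = isleaf s.
Proof.
case: s => // l ch; apply/negP => /=; rewrite /mapi.
elim: ch 0%N => //= c ch IH i; rewrite mem_cat => /orP[|/IH//].
by case/mapP.
Qed.

Lemma leaves_consP t lam l (ch : seq (stree R)) : t :: lam \in leaves (SNode l ch) ->
  exists ch1 c ch2, [/\ ch = ch1 ++ c :: ch2, size ch1 = t & lam \in leaves c].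
Proof.
rewrite /= /mapi => h.
suff [ch1 [c [ch2 [e1 e2 e3]]]] : exists ch1 c ch2,
    [/\ ch = ch1 ++ c :: ch2, (0 + size ch1)%N = t & lam \in leaves c].
  by exists ch1, c, ch2; rewrite -e2 add0n.
elim: ch 0%N h => //= c ch IH i; rewrite mem_cat => /orP[|/IH].
  case/mapP => lam' h [-> ->]; exists [::], c, ch; rewrite addn0; split=> //.
by case=> ch1 [c' [ch2 [-> <- h]]]; exists (c :: ch1), c', ch2; rewrite /= addSnnS.
Qed.

Lemma leaves_uniq (s : stree R) : uniq (leaves s).
Proof.
elim/stree_nested_ind: s => // l ch IH /=; rewrite /mapi.
elim: ch 0%N IH => //= c ch IHch i IH; rewrite cat_uniq map_inj_uniq; last by move=> ? ? [].
rewrite IH ?mem_head // IHch ?andbT /=; last by move=> x hx; rewrite IH // inE hx orbT.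
apply/hasPn => lam h; apply/mapP => -[lam' _ e]; move: h; rewrite {}e.
suff H j : (i < j)%N -> i :: lam' \notin flatten (mapi_from (fun t c => [seq t :: a | a <- leaves c]) j ch).
  by apply/negP; exact: H.
elim: (ch) j => //= x ch' IHx j hj; rewrite mem_cat negb_or IHx ?andbT; last by rewrite ltnW.
by apply/mapP => -[? _ [e _]]; rewrite e ltnn in hj.
Qed.

Lemma leaves_sflag lam (s : stree R) :
  leaves (sflag lam s) = [seq x <- leaves s | x != lam].
Proof.
elim/stree_nested_ind: s lam => [|l ch IH] [|t lam] //.
  apply/esym/all_filterP/allP => x hx; apply/eqP => e.
  by move: hx; rewrite e leaves_nilP.
rewrite /= /mapi; elim: ch 0%N IH => //= c ch IHch i IH; rewrite filter_cat.
rewrite -IHch; last by move=> x hx; apply: IH; rewrite inE hx orbT.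
congr (_ ++ _); rewrite filter_map; case: eqP => [->|/eqP hit].
  rewrite IH ?mem_head //; congr map; apply: eq_filter => x /=.
  by rewrite eqseq_cons eqxx.
rewrite (eq_filter (a2 := predT)) ?filter_predT // => x /=.
by rewrite eqseq_cons (negbTE hit).
Qed.

Lemma lenok_sflag lam (s : stree R) : lenok s -> lenok (sflag lam s).
Proof.
elim/stree_nested_ind: s lam => [|l ch IH] [|t lam] //=; first by rewrite unitI0.
case/andP => -> /allP h /=; rewrite /mapi.
elim: ch 0%N IH h => //= c ch IHch i IH h; rewrite IHch ?andbT; last 2 first.
- by move=> x hx; apply: IH; rewrite inE hx orbT.
- by move=> x hx; apply: h; rewrite inE hx orbT.
by case: ifP => _; [apply: IH; rewrite ?mem_head // h ?mem_head | rewrite h ?mem_head].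
Qed.

(** Only vertices of V_comp^1 and marked vertices lie over a leaf, and the former have members, so a
    marked vertex is reached. *)
Lemma over_leaf_lab (b : btree R M) : over SLeaf b -> ~~ nilp (lab b [::]).
Proof.
move E: SLeaf => s h; move: s b h E; apply: over_ind => //.
move=> s l [|x s1] //= hl _ ho _ IH es; have := IH x (mem_head _ _) es.
by case: (lab x [::]).
Qed.

Lemma labs_nil (s1 : seq (btree R M)) lam x : labs s1 lam = [::] -> x \in s1 ->
  lab x lam = [::].
Proof.
rewrite /labs; elim: s1 => //= y s1 IH; case e: (lab y lam) => //= /IH h.
by rewrite inE => /orP[/eqP->|].
Qed.

Lemma isleaf_sflag lam (s : stree R) : isleaf (sflag lam s) = isleaf s && (lam != [::]).
Proof. by case: s lam => [|? ?] [|? ?]. Qed.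

Lemma fits_sflag lam (s : stree R) (b : btree R M) : over s b -> lab b lam = [::] ->
  fits s b -> fits (sflag lam s) b.
Proof.
case: s lam => [|l ch] [|t lam] //= ho h.
by have := over_leaf_lab ho; rewrite h.
Qed.

(** No bubble tree lies over a leaf without labels, so nothing is required over the flag. *)
Lemma over_sflag s (b : btree R M) lam : over s b -> lab b lam = [::] ->
  over (sflag lam s) b.
Proof.
move=> h; move: s b h lam.
apply: over_ind => [m|s l s1 hl hs1 ho hc IH|l0 ch l ss hl hss hne hsz IH] lam.
- by case: lam.
- rewrite lab_V1 => hlab; rewrite over_V1 hl hs1 /=; apply/andP; split.
    by apply/allP => x hx; apply: IH => //; exact: labs_nil hlab hx.
  rewrite isleaf_sflag; move: hc; case hs: (isleaf s); last by move=> /= ->.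
  move=> _ /=; case: lam hlab => //= hlab; case: s1 hs1 ho hlab {IH} => // x s1 _ ho hlab.
  have hx := ho x (mem_head _ _).
  have : over SLeaf x by case: (s) hs hx.
  by move/over_leaf_lab; rewrite (labs_nil hlab) ?mem_head.
case: lam => [|t lam].
  by move=> _; apply/over_V2P => //; exists l0, ch; split=> // p hp x /(IH p hp)[].
rewrite lab_V2 // => hlab; apply/over_V2P => //.
exists l0, (mapi (fun i c => if i == t then sflag lam c else c) ch).
split=> //; first by rewrite size_mapi.
have [ht|ht] := ltnP t (size ch); last first.
  rewrite /mapi (mapi_from_neq (sflag lam) id) ?map_id; last by rewrite add0n ht orbT.
  by move=> p hp x /(IH p hp)[].
have ech := split_nth SLeaf ht; set c := nth _ _ _ in ech.
have ess : ss = _ := split_nth [::] (_ : t < size ss)%N; rewrite hsz in ess.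
have {}ess := ess ht; set s0 := nth _ ss t in ess hlab.
have e1 : size (take t ch) = t by rewrite size_takel // ltnW.
have e2 : size (take t ss) = size (take t ch) by rewrite e1 size_takel // hsz ltnW.
rewrite ech (mapi_at (sflag lam) id) // !map_id [X in zip X]ess zip_cat //.
move=> p; rewrite mem_cat inE => hp x hx.
have hzip q : (q \in zip (take t ss) (take t ch)) || (q \in zip (drop t.+1 ss) (drop t.+1 ch))
    -> q \in zip ss ch.
  by move=> hq; rewrite ess ech zip_cat // mem_cat inE; case/orP: hq => ->; rewrite ?orbT.
case/or3P: hp => hp.
- by have [|ho hf _] := IH p _ x hx; first by apply: hzip; rewrite hp.
- have h0 : (s0, c) \in zip ss ch by rewrite ess ech zip_cat // mem_cat mem_head orbT.
  move/eqP: hp hx => -> /= hx; have [ho hf h] := IH _ h0 x hx.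
  have hl0 := labs_nil hlab hx.
  by split; [exact: h | exact: fits_sflag].
- by have [|ho hf _] := IH p _ x hx; first by apply: hzip; rewrite hp orbT.
Qed.

Lemma srestab_id (s : stree R) : sok s -> srestab s = s.
Proof.
elim/stree_nested_ind: s => //= l ch IH /and3P[_ hs /allP h].
have -> : map (@srestab R) ch = ch.
  by rewrite -[RHS]map_id; apply/eq_in_map => c hc; apply: IH (h c hc).
by case: ch hs {IH h} => [|c [|]].
Qed.

Lemma flatten_prune_id (ch : seq (stree R)) : all (@sok R) ch ->
  flatten (map (@prune R) ch) = ch.
Proof. by elim: ch => //= c ch IH /andP[/prune_id-> /IH->]. Qed.

Lemma srestabE l ch : (0 < size ch)%N ->
  [:: srestab (SNode l ch)] = snorm l (map (@srestab R) ch).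
Proof. by case: ch => [|c [|c' ch]]. Qed.

Lemma map_srestab_id (ch : seq (stree R)) : all (@sok R) ch ->
  map (@srestab R) ch = ch.
Proof. by elim: ch => //= c ch IH /andP[/srestab_id-> /IH->]. Qed.

Lemma sdelete_at t lam l ch1 (c : stree R) ch2 : size ch1 = t -> lam != [::] ->
  sdelete (t :: lam) (SNode l (ch1 ++ c :: ch2)) = SNode l (ch1 ++ sdelete lam c :: ch2).
Proof.
by case: lam => // u lam e _; rewrite /= (mapi_at (sdelete (u :: lam)) id) // !map_id.
Qed.

Lemma remove_at_cat (A : Type) t (s1 : seq A) x s2 : size s1 = t ->
  remove_at t (s1 ++ x :: s2) = s1 ++ s2.
Proof.
move=> <-; rewrite /remove_at take_size_cat // -cat_rcons.
by rewrite drop_size_cat // size_rcons.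
Qed.

(** Off the path to the flag the tree is stable and fixed by both operations; on the path both
    suppress the same vertices. *)
Lemma prune_sflag lam (s : stree R) : sok s -> lam \in leaves s -> lam != [::] ->
  prune (sflag lam s) = [:: srestab (sdelete lam s)].
Proof.
elim: lam s => // t lam IH [|l ch] // hs /leaves_consP[ch1 [c [ch2 [ech et hlam]]]] _.
rewrite {}ech in hs *; rewrite sflag_at //.
move: hs; rewrite /= all_cat /= size_cat /= => /and3P[_ hsz /and3P[h1 hc h2]].
rewrite map_cat flatten_cat flatten_prune_id //= (flatten_prune_id h2).
have [elam|nlam] := eqVneq lam [::].
  rewrite elam in hlam *; move: hlam; rewrite leaves_nilP; case: (c) => //= _.
  rewrite remove_at_cat // -[in RHS](cats0 [:: _]) /=.
  change (match map (@srestab R) (ch1 ++ ch2) with | [:: x] => sraise l x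
    | _ => SNode l (map (@srestab R) (ch1 ++ ch2)) end) with (srestab (SNode l (ch1 ++ ch2))).
  rewrite srestabE ?map_srestab_id ?all_cat ?h1 // size_cat.
  by rewrite addnS ltnS in hsz.
rewrite (IH c hc hlam nlam).
change (snorm l (ch1 ++ [:: srestab (sdelete lam c)] ++ ch2) =
  [:: srestab (sdelete (t :: lam) (SNode l (ch1 ++ c :: ch2)))]).
rewrite sdelete_at // srestabE ?size_cat ?addnS //.
by rewrite map_cat /= !map_srestab_id.
Qed.

Lemma brestabE l ss :
  brestab (Comp l ss) = renorm l (map (map (@brestab R M)) ss).
Proof. by []. Qed.

Lemma brestab_id s (b : btree R M) : over s b -> brestab b = b.
Proof.
move: s b; apply: over_ind => [//|s l s1 _ h _ _ IH|l0 ch l ss _ h _ e IH].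
  rewrite brestabE /= (_ : map (@brestab R M) s1 = s1); first by case: s1 h {IH} => [|x [|y s1]].
  by rewrite -[RHS]map_id; apply/eq_in_map.
rewrite brestabE (_ : map (map (@brestab R M)) ss = ss) ?renorm_V2 //.
apply: (@eq_from_nth _ [::]); rewrite size_map // => i hi; rewrite (nth_map [::]) //.
rewrite -[RHS]map_id; apply/eq_in_map => x hx.
by have [] := IH (nth [::] ss i, nth SLeaf ch i) (mem_zip_nth _ _ e hi) x hx.
Qed.

Lemma pseams_id (ss : seq (seq (btree R M))) (ch : seq (stree R)) : size ss = size ch -> all (@sok R) ch ->
  (forall p, p \in zip ss ch -> forall x, x \in p.1 -> bprune p.2 x = x) ->
  pseams ss ch = ss.
Proof.
rewrite /pseams; elim: ss ch => [|s1 ss IH] [|c ch] //= [e] /andP[hc hch] h.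
rewrite (prune_id hc) /= IH //; last by move=> p hp; apply: h; rewrite inE hp orbT.
rewrite (_ : map (bprune c) s1 = s1) // -[RHS]map_id; apply/eq_in_map => x hx.
exact: (h (s1, c) (mem_head _ _)).
Qed.

Lemma bprune_id s (b : btree R M) : over s b -> sok s -> bprune s b = b.
Proof.
move: s b; apply: over_ind => [//|s l s1 _ h _ _ IH|l0 ch l ss _ h _ e IH] hs.
  rewrite /bprune -/bprune (_ : map (bprune s) s1 = s1).
    by case: s1 h {IH} => [|x [|y s1]].
  by rewrite -[RHS]map_id; apply/eq_in_map => x hx; exact: IH.
case/and3P: hs => _ _ hch; rewrite bprune_V2 // pseams_id ?renorm_V2 //.
move=> p hp x hx; have [_ _] := IH p hp x hx; apply.
by move/allP: hch; apply; exact: mem_zip2 hp.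
Qed.

Lemma bdelete_V2_at t lam l ss1 (s0 : seq (btree R M)) ss2 : size ss1 = t ->
  (1 < size (ss1 ++ s0 :: ss2))%N -> lam != [::] ->
  bdelete (t :: lam) (Comp l (ss1 ++ s0 :: ss2)) =
  Comp l (ss1 ++ map (bdelete lam) s0 :: ss2).
Proof.
case: lam => // u lam e h _; rewrite [bdelete _ _]/= h.
by rewrite (mapi_at (map (bdelete (u :: lam))) id) // !map_id.
Qed.

(** The same comparison on the bubble tree: a seam vertex over the leaf is dropped by both sides,
    one on the way to it is treated recursively, and all others are fixed. *)
Lemma restab_bprune s (b : btree R M) : over s b -> sok s -> forall lam,
  lam \in leaves s -> lam != [::] -> lab b lam = [::] ->
  brestab (bdelete lam b) = bprune (sflag lam s) b.
Proof.
move: s b; apply: over_ind => [//|s l s1 hl h ho _ IH|l0 ch l ss hl h hne e IH] hs lam hlam nlam.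
  rewrite lab_V1 => hlab; rewrite /bprune -/bprune.
  have -> : bdelete lam (Comp l [:: s1]) = Comp l [:: map (bdelete lam) s1] by [].
  rewrite brestabE /= -map_comp; congr (renorm _ [:: _]).
  apply/eq_in_map => x hx; apply: IH => //; exact: labs_nil hlab hx.
case: lam hlam nlam => // t lam hlam _; rewrite lab_V2 // => hlab.
have [ch1 [c [ch2 [ech et hl']]]] := leaves_consP hlam.
have ht : (t < size ss)%N by rewrite e ech size_cat /= addnS -et ltnS leq_addr.
have ess := split_nth [::] ht; set s0 := nth _ _ _ in ess hlab.
set ss1 := take t ss in ess; set ss2 := drop t.+1 ss in ess.
have es1 : size ss1 = t by rewrite size_takel // ltnW.
have e1 : size ss1 = size ch1 by rewrite es1.
have e2 : size ss2 = size ch2.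
  by move: e; rewrite ess ech !size_cat /= e1 => /addnI[].
clearbody s0 ss1 ss2; subst ss ch.
have : all (@sok R) (ch1 ++ c :: ch2) by case/and3P: hs.
rewrite all_cat => /andP[h1 /andP[hc h2]].
rewrite sflag_at // bprune_V2 // [skids _]/= pseams_cat //.
have zip1 p : p \in zip ss1 ch1 -> p \in zip (ss1 ++ s0 :: ss2) (ch1 ++ c :: ch2).
  by move=> hp; rewrite zip_cat // mem_cat hp.
have zip2 p : p \in zip ss2 ch2 -> p \in zip (ss1 ++ s0 :: ss2) (ch1 ++ c :: ch2).
  by move=> hp; rewrite zip_cat // mem_cat inE hp !orbT.
have zip0 : (s0, c) \in zip (ss1 ++ s0 :: ss2) (ch1 ++ c :: ch2).
  by rewrite zip_cat // mem_cat mem_head orbT.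
have id1 : pseams ss1 ch1 = ss1.
  apply: pseams_id => // p hp x hx; have [ho _ _] := IH p (zip1 p hp) x hx.
  by apply: bprune_id ho _; move/allP: h1; apply; exact: mem_zip2 hp.
have id2 : pseams ss2 ch2 = ss2.
  apply: pseams_id => // p hp x hx; have [ho _ _] := IH p (zip2 p hp) x hx.
  by apply: bprune_id ho _; move/allP: h2; apply; exact: mem_zip2 hp.
have rid (ss' : seq (seq (btree R M))) (ch' : seq (stree R)) : size ss' = size ch' ->
    {subset zip ss' ch' <= zip (ss1 ++ s0 :: ss2) (ch1 ++ c :: ch2)} ->
    map (map (@brestab R M)) ss' = ss'.
  move=> es hsub; apply: (@eq_from_nth _ [::]); rewrite size_map // => i hi.
  rewrite (nth_map [::]) // -[RHS]map_id; apply/eq_in_map => x hx.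
  have [ho _ _] := IH _ (hsub _ (mem_zip_nth [::] SLeaf es hi)) x hx.
  exact: brestab_id ho.
have -> : pseams (s0 :: ss2) (sflag lam c :: ch2) =
    (if nilp (prune (sflag lam c)) then [::]
     else [:: map (bprune (sflag lam c)) s0]) ++ ss2 by rewrite -{2}id2.
rewrite id1.
have [elam|nlam] := eqVneq lam [::].
  rewrite elam in hl' *; move: hl'; rewrite leaves_nilP => hl'.
  have -> : c = SLeaf by case: (c) hl'.
  rewrite [nilp _]/= [bdelete _ _]/= h remove_at_cat // brestabE map_cat.
  by rewrite (rid ss1 ch1) ?(rid ss2 ch2).
rewrite (prune_sflag hc) // [nilp _]/= bdelete_V2_at // brestabE map_cat /=.
rewrite (rid ss1 ch1) ?(rid ss2 ch2) // -map_comp; congr (renorm _ (_ ++ _ :: _)).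
apply/eq_in_map => x hx; have [_ _ hh] := IH _ zip0 x hx.
by apply: hh => //; exact: labs_nil hlab hx.
Qed.

End ForgetOne.

(** * Change of labels *)

Section Relabel.
Variables (R : realType) (M M' : Type) (h : M -> M').
Implicit Type b : btree R M.

Lemma lab_bmap (g : R -> R) b lam : lab (bmap g h b) lam = map h (lab b lam).
Proof.
elim/btree_nested_ind: b lam => [m [|? ?]|l ss IH lam] //.
have IHs s1 lam' : s1 \in ss -> labs (map (bmap g h) s1) lam' = map h (labs s1 lam').
  move=> hs; rewrite /labs map_flatten -!map_comp; congr flatten.
  by apply/eq_in_map => x hx; exact: IH hs hx lam'.
have [h1|h1] := ltnP 1 (size ss).
  have eb : bmap g h (Comp l ss) = Comp (g l) (map (map (bmap g h)) ss) by [].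
  case: lam => [|t lam]; first by rewrite eb !lab_V2_nil ?size_map.
  rewrite eb !lab_V2 ?size_map //.
  have [ht|ht] := ltnP t (size ss); last by rewrite !nth_default ?size_map.
  by rewrite (nth_map [::]) // IHs ?mem_nth.
case: ss h1 IH IHs => [|s1 [|]] // _ IH IHs; last by rewrite lab_V1 -IHs ?mem_head.
by case: lam => // t lam; rewrite /= !nth_nil.
Qed.

Lemma groups_bmap (g : R -> R) b (s : stree R) :
  groups (bmap g h b) s = map (map h) (groups b s).
Proof. by rewrite !groupsE -map_comp; apply: eq_map => lam; exact: lab_bmap. Qed.

Lemma hgt_bmap b : hgt (bmap id h b) = hgt b.
Proof.
elim/btree_nested_ind: b => //= l [|[|x s1] [|s2 ss]] //= IH.
by rewrite (IH _ _ (mem_head _ _) (mem_head _ _)).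
Qed.

Lemma fits_bmap (s : stree R) b : fits s (bmap id h b) = fits s b.
Proof. by rewrite /fits hgt_bmap. Qed.

Lemma over_bmap (s : stree R) b : over s (bmap id h b) = over s b.
Proof.
elim/btree_nested_ind: b s => //= l ss IH s; congr andb.
have IHs s1 c : s1 \in ss -> all (over c) (map (bmap id h) s1) = all (over c) s1.
  by move=> hs; rewrite all_map; apply: eq_in_all => x hx /=; exact: IH hs hx c.
have V2E : (if s is SNode _ ch then
    [&& (1 < size (map (map (bmap id h)) ss))%N,
      has (fun s1 => 0 < size s1)%N (map (map (bmap id h)) ss) &
      all2 (fun s1 c => all (fun x => over c x && fits c x) s1)
        (map (map (bmap id h)) ss) ch]
    else false) = (if s is SNode _ ch then
    [&& (1 < size ss)%N, has (fun s1 => 0 < size s1)%N ss &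
      all2 (fun s1 c => all (fun x => over c x && fits c x) s1) ss ch]
    else false).
  case: (s) => // _ ch; rewrite size_map; congr [&& _, _ & _].
    by rewrite has_map; apply: eq_has => s1 /=; rewrite size_map.
  elim: ss ch IH {IHs} => [|s1 ss IHss] [|c ch] //= IH.
  rewrite IHss; last by move=> s2 x h2; apply: IH; rewrite inE h2 orbT.
  congr andb; rewrite all_map; apply: eq_in_all => x hx /=.
  by rewrite (IH _ _ (mem_head _ _) hx) fits_bmap.
case: ss IH IHs V2E => [|s1 [|s2 ss]] // IH IHs _ /=.
rewrite size_map IHs ?mem_head // -map_comp (eq_map (g := @hgt R M)) //.
exact: hgt_bmap.
Qed.

Lemma map_remove_at (A B : Type) (f : A -> B) t s :
  map f (remove_at t s) = remove_at t (map f s).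
Proof. by rewrite /remove_at map_cat map_take map_drop. Qed.

Lemma map_mapi (A B C : Type) (f : B -> C) (F : nat -> A -> B) s :
  map f (mapi F s) = mapi (fun i x => f (F i x)) s.
Proof. by rewrite /mapi; elim: s 0%N => //= x s IH i; rewrite IH. Qed.

Lemma mapi_map (A B C : Type) (f : A -> B) (F : nat -> B -> C) s :
  mapi F (map f s) = mapi (fun i x => F i (f x)) s.
Proof. by rewrite /mapi; elim: s 0%N => //= x s IH i; rewrite IH. Qed.

Lemma eq_in_mapi (A : eqType) (B : Type) (F G : nat -> A -> B) s :
  (forall i x, x \in s -> F i x = G i x) -> mapi F s = mapi G s.
Proof.
rewrite /mapi; elim: s 0%N => //= x s IH i e; rewrite e ?mem_head // IH // => j y hy.
by rewrite e // inE hy orbT.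
Qed.

Lemma bdelete_bmap lam b : bdelete lam (bmap id h b) = bmap id h (bdelete lam b).
Proof.
elim/btree_nested_ind: b lam => // l ss IH lam; rewrite /= size_map.
have IHs s1 lam' : s1 \in ss ->
    map (bdelete lam') (map (bmap id h) s1) = map (bmap id h) (map (bdelete lam') s1).
  by move=> hs; rewrite -!map_comp; apply/eq_in_map => x hx /=; exact: IH hs hx lam'.
case: ifP => _; last first.
  rewrite /= -!map_comp; congr Comp; apply/eq_in_map => s1 hs1 /=; exact: IHs.
case: lam => [//|t [|u lam]] /=; first by rewrite map_remove_at.
rewrite mapi_map map_mapi; congr Comp; apply: eq_in_mapi => i s1 hs1.
by case: ifP => // _; exact: IHs.
Qed.

Lemma braise_bmap l b : braise l (bmap id h b) = bmap id h (braise l b).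
Proof. by case: b. Qed.

Lemma renorm_bmap l (ss : seq (seq (btree R M))) :
  renorm l (map (map (bmap id h)) ss) = bmap id h (renorm l ss).
Proof.
by case: ss => [|[|x [|y s1]] [|s2 ss]] //; rewrite /renorm /= braise_bmap.
Qed.

Lemma brestab_bmap b : brestab (bmap id h b) = bmap id h (brestab b).
Proof.
elim/btree_nested_ind: b => // l ss IH.
rewrite [bmap _ _ (Comp _ _)]/= !brestabE -renorm_bmap -!map_comp; congr renorm.
apply/eq_in_map => s1 hs /=; rewrite -!map_comp; apply/eq_in_map => x hx /=.
exact: IH hs hx.
Qed.

Lemma broot_bmap b : broot (bmap id h b) = bmap id h (broot b).
Proof. by case: b. Qed.

Lemma find_nilp_map (T T' : Type) (f : T -> T') (g : seq (seq T)) :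
  find (@nilp T') (map (map f) g) = find (@nilp T) g.
Proof. by rewrite find_map; apply: eq_find => -[]. Qed.

Lemma count_nilp_map (T T' : Type) (f : T -> T') (g : seq (seq T)) :
  count (@nilp T') (map (map f) g) = count (@nilp T) g.
Proof. by rewrite count_map; apply: eq_count => -[]. Qed.

Lemma forget1_bmap b (s : stree R) :
  forget1 (bmap id h b, s) = (bmap id h (forget1 (b, s)).1, (forget1 (b, s)).2).
Proof.
rewrite /forget1 /= groups_bmap find_nilp_map.
by rewrite bdelete_bmap brestab_bmap broot_bmap.
Qed.

(** Forgetting sees labels only through the emptiness of groups. This relates the labelled pair in
    [is_fsigma] to the plain pair [x]. *)
Lemma forget_bmap b (s : stree R) :
  forget (bmap id h b, s) = (bmap id h (forget (b, s)).1, (forget (b, s)).2).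
Proof.
rewrite /forget /= groups_bmap count_nilp_map.
move: (count _ _) => k; elim: k b s => // k IH b s; rewrite !iterSr forget1_bmap.
by case: (forget1 (b, s)) => b' s'; exact: IH.
Qed.

End Relabel.

(** * Iterated forgetting *)

Section Forget.
Variables (R : realType) (M : Type).
Implicit Type x : tpair R M.

Lemma lab_broot (b : btree R M) : lab (broot b) = lab b.
Proof. by case: b. Qed.

Lemma leaves_sroot (s : stree R) : leaves (sroot s) = leaves s.
Proof. by case: s. Qed.

Lemma groups_root (b : btree R M) s : groups (broot b) (sroot s) = groups b s.
Proof. by rewrite !groupsE lab_broot leaves_sroot. Qed.

Lemma over_sroot s (b : btree R M) : over s b -> over (sroot s) b.
Proof. by case: s => // l ch; exact: over_snode_len. Qed.

Lemma over_broot s (b : btree R M) : over s b -> over s (broot b).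
Proof. by case: b => //= l ss /andP[_ ->]; rewrite unitI0. Qed.

Lemma sok_sroot (s : stree R) : sok s -> sok (sroot s).
Proof. by case: s => //= l ch /andP[_ ->]; rewrite unitI0. Qed.

Lemma wf_root s (b : btree R M) : sok s -> over s b -> wf (broot b, sroot s).
Proof.
move=> hs ho; split=> /=; first exact: sok_sroot.
- by apply: over_sroot; exact: over_broot.
- by case: (b).
- by case: (s).
Qed.

Definition nil_leaf x : seq nat := nth [::] (leaves x.2) (find (@nilp M) (groups x.1 x.2)).

(** The leaf is not the root: a bubble tree over the one-vertex seam tree carries a label. *)
Lemma nil_leafP x : wf x -> has (@nilp M) (groups x.1 x.2) ->
  [/\ nil_leaf x \in leaves x.2, nil_leaf x != [::] & lab x.1 (nil_leaf x) = [::]].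
Proof.
case: x => b s [hs ho _ _] hn.
have hf : (find (@nilp M) (groups b s) < size (leaves s))%N.
  by move: hn; rewrite has_find groupsE size_map.
have hm : nil_leaf (b, s) \in leaves s by exact: mem_nth.
have hl : lab b (nil_leaf (b, s)) = [::].
  have := nth_find [::] hn; rewrite {1}groupsE (nth_map [::]) //.
  by rewrite -/(nil_leaf (b, s)); case: lab.
split=> //; apply/eqP => e; move: hm hl; rewrite e leaves_nilP /=.
case: (s) ho => // /over_leaf_lab; by case: lab.
Qed.

(** Trades deletion and restabilization for the single pass, to which the invariance results
    apply. *)
Lemma forget1E x : wf x -> has (@nilp M) (groups x.1 x.2) ->
  exists s', [/\ prune (sflag (nil_leaf x) x.2) = [:: s'],
    over s' (bprune (sflag (nil_leaf x) x.2) x.1) &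
    forget1 x = (broot (bprune (sflag (nil_leaf x) x.2) x.1), sroot s')].
Proof.
move=> hx hn; have [h1 h2 h3] := nil_leafP hx hn; case: hx => hs ho _ _.
have [s' [e1 e2 _]] := over_bprune (over_sflag ho h3) (lenok_sflag _ (sok_lenok hs)).
exists s'; split=> //; rewrite -(restab_bprune ho) //.
by move: e1; rewrite (prune_sflag hs) // => -[<-].
Qed.

Lemma filter_nth_uniq (T : eqType) (x0 : T) (t : seq T) i : uniq t -> (i < size t)%N ->
  [seq y <- t | y != nth x0 t i] = take i t ++ drop i.+1 t.
Proof.
elim: t i => //= y t IH [|i] /andP[hy hu] /= hi.
  rewrite eqxx drop0; apply/all_filterP/allP => z hz.
  by apply/eqP => e; rewrite -e hz in hy.
rewrite IH //; case: eqP => // e.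
by rewrite e mem_nth in hy.
Qed.

Lemma forget1_spec x : wf x -> has (@nilp M) (groups x.1 x.2) ->
  wf (forget1 x) /\ groups (forget1 x).1 (forget1 x).2 =
    let i := find (@nilp M) (groups x.1 x.2) in
    take i (groups x.1 x.2) ++ drop i.+1 (groups x.1 x.2).
Proof.
move=> hx hn; have [s' [e1 e2 ->]] := forget1E hx hn.
have [h1 h2 h3] := nil_leafP hx hn; have [hs ho _ _] := hx.
have hlen := lenok_sflag (nil_leaf x) (sok_lenok hs).
split.
  by apply: wf_root => //; have := prune_sok hlen; rewrite e1 /= andbT.
rewrite groups_root (groups_bprune (over_sflag ho h3) hlen e1) !groupsE leaves_sflag.
rewrite filter_nth_uniq ?leaves_uniq //; last by move: hn; rewrite has_find groupsE size_map.
by rewrite map_cat groupsE map_take map_drop.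
Qed.

Lemma filter_first_nil (T : Type) (g : seq (seq T)) : has (@nilp T) g ->
  let g' := take (find (@nilp T) g) g ++ drop (find (@nilp T) g).+1 g in
  count (@nilp T) g = (count (@nilp T) g').+1 /\
  [seq u <- g' | ~~ nilp u] = [seq u <- g | ~~ nilp u].
Proof.
elim: g => //= u g IH; case hu: (nilp u) => /=.
  by move=> _; rewrite drop0.
by move=> /IH[h1 h2]; rewrite hu /= h1 h2.
Qed.

Lemma forget_spec x : wf x -> wf (forget x) /\
  groups (forget x).1 (forget x).2 = [seq g <- groups x.1 x.2 | ~~ nilp g].
Proof.
rewrite /forget; move e: (count _ _) => k; elim: k x e => [|k IH] x e hx.
  split=> //; apply/esym/all_filterP; rewrite all_predC has_count e //.
have hn : has (@nilp M) (groups x.1 x.2) by rewrite has_count e.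
have [h1 h2] := forget1_spec hx hn; have [h3 h4] := filter_first_nil hn.
rewrite iterSr; have [|//|h5 h6] := IH (forget1 x); first by rewrite h2; case: h3 e => ->; case.
by split=> //; rewrite h6 h2.
Qed.

End Forget.

Section MtpSet.
Variable R : realType.

Lemma mtp_setP n (x : tpair R unit) :
  mtp_set n x <-> wf x /\ map size (groups x.1 x.2) = n.
Proof. by rewrite /mtp_set -is_type_metricP; split=> [/asboolP|h]; last apply/asboolP. Qed.

Lemma raw_wf n (x : mtp R n) : wf (raw x).
Proof. by have /mtp_setP[] := svalP x. Qed.

End MtpSet.

(** * Forgetting is compatible with the contractions *)

Section ABSteps.
Variable R : realType.
Notation bt := (btree R unit).
Implicit Types (b x : bt) (ss : seq (seq bt)).

(** The contractions (a) and (b) leave the seam tree alone, so they are treated as one relation on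
    bubble trees. *)
Definition step1 b b' := in_ctx (@contractA R) b b' \/ in_ctx (@contractB R) b b'.
Definition steps := clos_refl_trans bt step1.

Definition rlen (f : R -> R) b : bt := if b is Comp l ss then Comp (f l) ss else b.

Lemma step1_ctx l ss1 s1 b b' s2 ss2 : step1 b b' ->
  step1 (Comp l (ss1 ++ (s1 ++ b :: s2) :: ss2)) (Comp l (ss1 ++ (s1 ++ b' :: s2) :: ss2)).
Proof. by case=> h; [left | right]; exact: ctx_in. Qed.

(** No contraction inspects the length at the root of the tree in which it takes place. Hence steps
    survive when this length is raised by a merged edge or reset to 0. *)
Lemma step1_rlen f b b' : step1 b b' -> step1 (rlen f b) (rlen f b').
Proof.
case=> -[].
- by move=> _ _ [l ss1 s1 g s2 ss2]; left; apply: ctx_here; constructor.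
- by move=> l ss1 s1 c c' s2 ss2 h; left; exact: ctx_in.
- by move=> _ _ [l q gss h1 h2 h3]; right; apply: ctx_here; constructor.
- by move=> l ss1 s1 c c' s2 ss2 h; right; exact: ctx_in.
Qed.

Lemma steps_lift (f : bt -> bt) : (forall b b', step1 b b' -> steps (f b) (f b')) ->
  forall b b', steps b b' -> steps (f b) (f b').
Proof.
move=> hf b b'; elim=> [||x y z _ h1 _ h2]; [exact: hf | by move=> *; exact: rt_refl |].
exact: rt_trans h1 h2.
Qed.

Lemma steps_rlen f b b' : steps b b' -> steps (rlen f b) (rlen f b').
Proof. by apply: steps_lift => x y h; apply: rt_step; exact: step1_rlen. Qed.

Lemma braise_rlen l b : braise l b = rlen (Num.max l) b.
Proof. by case: b. Qed.

Lemma broot_rlen b : broot b = rlen (fun=> 0) b.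
Proof. by case: b. Qed.

Lemma size_merge_seams q (gss : seq (seq (seq bt))) : size (merge_seams q gss) = q.
Proof. by rewrite size_map size_iota. Qed.

Lemma nth_merge_seams q gss t : (t < q)%N ->
  nth [::] (merge_seams q gss) t = flatten [seq nth [::] gs t | gs <- (gss : seq (seq (seq bt)))].
Proof. by move=> h; rewrite (nth_map 0%N) ?size_iota // nth_iota. Qed.

Lemma merge_seams1 (g : seq (seq bt)) : merge_seams (size g) [:: g] = g.
Proof.
apply: (@eq_from_nth _ [::]); rewrite size_merge_seams // => t ht.
by rewrite nth_merge_seams //= cats0.
Qed.

Lemma merge_seams_cons q gss : merge_seams q.+1 gss =
  flatten (map (head [::]) gss) :: merge_seams q (map behead gss) :> seq (seq bt).
Proof.
apply: (@eq_from_nth _ [::]); rewrite /= !size_map !size_iota // => -[|t] ht.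
  by rewrite /=; congr flatten; apply: eq_map => -[].
rewrite nth_merge_seams //= nth_merge_seams // -map_comp; congr flatten.
by apply: eq_map => gs /=; rewrite nth_behead.
Qed.

Lemma cat_cons_size1 (A : Type) (s1 s2 : seq A) : (size s1 + size s2 < 1)%N ->
  s1 = [::] /\ s2 = [::].
Proof. by case: s1 s2 => [|? ?] [|? ?]. Qed.

Lemma lab_replace l ss1 (s0 s0' : seq bt) ss2 : labs s0 = labs s0' ->
  lab (Comp l (ss1 ++ s0 :: ss2)) = lab (Comp l (ss1 ++ s0' :: ss2)).
Proof.
move=> e; apply/funext => lam.
have es s : size (ss1 ++ s :: ss2) = (size ss1 + size ss2).+1.
  by rewrite size_cat /= addnS.
have [h|h] := ltnP 1 (size ss1 + size ss2).+1.
  case: lam => [|t lam]; first by rewrite !lab_V2_nil ?es.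
  rewrite !lab_V2 ?es // !nth_cat; case: ifP => // _.
  by case: (t - _)%N => //=; rewrite e.
have [-> ->] := cat_cons_size1 h.
by rewrite !lab_V1 e.
Qed.

(** Not losing members keeps stability. Over an interior seam vertex the old members all have one
    height, so it is enough that every new height occurs among the old ones. *)
Lemma over_replace s l ss1 s0 s0' ss2 : over s (Comp l (ss1 ++ s0 :: ss2)) ->
  (0 < size s0 <= size s0')%N ->
  (forall c, (forall x, x \in s0 -> over c x) ->
     forall x, x \in s0' -> over c x /\
       (~~ isleaf c -> exists2 y, y \in s0 & hgt x = hgt y)) ->
  over s (Comp l (ss1 ++ s0' :: ss2)) /\
  (~~ isleaf s -> hgt (Comp l (ss1 ++ s0' :: ss2)) = hgt (Comp l (ss1 ++ s0 :: ss2))).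
Proof.
move=> ho /andP[hn0 hn] h.
have es t : size (ss1 ++ t :: ss2) = (size ss1 + size ss2).+1.
  by rewrite size_cat /= addnS.
have [h1|h1] := ltnP 1 (size ss1 + size ss2).+1.
  split; last by rewrite !hgt_V2 ?es.
  move/over_V2P: ho; rewrite es => /(_ h1)[l0 [ch [-> hl hne e hp]]].
  have [ch1 [c [ch2 [ech e1 e2]]]] := zip_at (etrans (es s0) e).
  apply/over_V2P; rewrite ?es //; exists l0, ch; split=> //.
    move: hne; rewrite !has_cat /=; case/or3P=> [->//|h2|->]; last by rewrite !orbT.
    by rewrite (leq_trans h2 hn) orbT.
  rewrite ech in hp *; move=> p; rewrite zip_cat // mem_cat inE => hpp x hx.
  have h0 : (s0, c) \in zip (ss1 ++ s0 :: ss2) (ch1 ++ c :: ch2).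
    by rewrite zip_cat // mem_cat inE eqxx orbT.
  have ho0 y : y \in s0 -> over c y by move=> hy; have [] := hp _ h0 y hy.
  case/or3P: hpp => hpp; last 1 first.
  - by apply: hp hx; rewrite zip_cat // mem_cat inE hpp !orbT.
  - by apply: hp hx; rewrite zip_cat // mem_cat hpp.
  move/eqP: hpp hx => -> /= hx; have [h2 h3] := h c ho0 x hx; split=> //.
  rewrite /fits; case hc: (isleaf c) h3 => //= /(_ isT)[y hy ->].
  by have [_] := hp _ h0 y hy; rewrite /fits hc.
have [e1 e2] := cat_cons_size1 h1; rewrite {}e1 {}e2 {es h1 ss1 ss2} /cat in ho *.
move: ho; rewrite !over_V1 => /and4P[hl hs /allP ho hc].
have h0 := h s ho.
have {}hc : ~~ isleaf s -> forall x, x \in s0' -> hgt x = head 0 (map (@hgt R unit) s0).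
  move=> hs0 x hx; have [_ /(_ hs0)[y hy ->]] := h0 x hx.
  exact: hgt_const hs0 hc hy.
split.
  rewrite hl (leq_trans hs hn) /=; apply/andP; split; first by apply/allP => x /h0[].
  case hs0 : (isleaf s) => //=; apply: constant_map => y hy; apply: hc => //.
  by rewrite hs0.
move=> hs0; change (Num.max l (head 0 (map (@hgt R unit) s0')) =
  Num.max l (head 0 (map (@hgt R unit) s0))).
rewrite -(hc hs0 (head (Mark tt) s0')); first by case: s0' hn {h h0 hc} => // hn; move: hs; rewrite ltnNge (leq_trans hn).
by case: s0' hn {h h0 hc} => [hn|? ? _]; [move: hs; rewrite ltnNge (leq_trans hn) | exact: mem_head].
Qed.

Definition nice s b b' := over s b -> over s b' /\ (~~ isleaf s -> hgt b' = hgt b).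

Lemma over_cat_mid s (u v : seq bt) x : (forall y, y \in u ++ x :: v -> over s y) -> over s x.
Proof. by apply; rewrite mem_cat mem_head orbT. Qed.

Lemma in_ctx_nice P : (forall s b b', P b b' -> nice s b b') ->
  forall b b', in_ctx P b b' -> forall s, nice s b b'.
Proof.
move=> hP b b'; elim=> [x y /hP h s|l ss1 s1 x x' s2 ss2 _ IH s ho]; first exact: h.
apply: (over_replace ho); first by rewrite !size_cat /= addnS leqnn.
move=> c hc y; rewrite mem_cat inE orbCA => /orP[/eqP->|hy].
  have [h1 h2] := IH c (over_cat_mid hc); split=> // /h2 ->.
  by exists x => //; rewrite mem_cat mem_head orbT.
have hy' : y \in s1 ++ x :: s2 by rewrite mem_cat inE orbCA hy orbT.
by split; [exact: hc | exists y].
Qed.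

(** The removed vertex has length 0, so its height is the common height of the members that replace
    it. *)
Lemma contractA_nice s b b' : contractA b b' -> nice s b b'.
Proof.
case=> l ss1 s1 g s2 ss2 ho.
have hg c : (forall x, x \in s1 ++ Comp 0 [:: g] :: s2 -> over c x) ->
    [/\ (1 < size g)%N, forall x, x \in g -> over c x &
      isleaf c || constant (map (@hgt R unit) g)].
  by move/over_cat_mid; rewrite over_V1 => /and4P[_ h1 /allP h2 h3].
have hex : exists c, forall x, x \in s1 ++ Comp 0 [:: g] :: s2 -> over c x.
  have [h|h] := ltnP 1 (size (ss1 ++ (s1 ++ Comp 0 [:: g] :: s2) :: ss2)).
    move/over_V2P: ho => /(_ h)[l0 [ch [_ _ _ e hp]]].
    have [ch1 [c [ch2 [ech e1 e2]]]] := zip_at e; exists c => x hx.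
    have [] // := hp (s1 ++ Comp 0 [:: g] :: s2, c) _ x hx.
    by rewrite ech zip_cat // mem_cat mem_head orbT.
  rewrite size_cat /= addnS in h; have [e1 e2] := cat_cons_size1 h.
  by move: ho; rewrite e1 e2 over_V1 => /and4P[_ _ /allP ? _]; exists s.
apply: (over_replace ho).
  have [c /hg[h1 _ _]] := hex.
  rewrite size_cat /= addnS /= -addnS size_cat leq_add2l size_cat.
  by rewrite -add1n leq_add2r ltnW.
move=> c hc y; have [h1 h2 h3] := hg c hc.
rewrite !mem_cat orbCA => /orP[hy|hy]; last first.
  have hy' : y \in s1 ++ Comp 0 [:: g] :: s2.
    by rewrite mem_cat inE orbCA hy orbT.
  by split; [exact: hc | exists y].
split; first exact: h2.
move=> hcl; exists (Comp 0 [:: g]); first by rewrite mem_cat mem_head orbT.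
rewrite /= -(hgt_const hcl h3 hy); apply/esym/max_idPr.
exact: hgt_ge0 (h2 y hy).
Qed.

(** The merged vertices have height 0, so the height of the lower vertex is [l] before and after;
    the new seams collect members that already lay over the right children. *)
Lemma contractB_nice s b b' : contractB b b' -> nice s b b'.
Proof.
case=> l q gss h1 h2 /allP h3; rewrite /nice over_V1.
case/and4P => hl hs /allP ho hc.
have ho' gs : gs \in gss -> over s (Comp 0 gs).
  by move=> h; apply: ho; exact: map_f.
have hq gs : gs \in gss -> size gs = q by move=> /h3/eqP.
have hgs gs : gs \in gss -> exists l0 ch, [/\ s = SNode l0 ch, has (fun s1 => 0 < size s1)%N gs,
    size gs = size ch & forall p, p \in zip gs ch -> forall x, x \in p.1 -> over p.2 x /\ fits p.2 x].
  move=> h; move/over_V2P: (ho' _ h); rewrite hq // => /(_ h2)[l0 [ch [k1 k2 k3 k4 k5]]].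
  by exists l0, ch; split=> //; rewrite hq.
case: gss h1 {h3 ho hc hs} ho' hq hgs => // g0 gss _ ho hq hgs.
have [l0 [ch [es hne e _]]] := hgs g0 (mem_head _ _).
have hq0 : size ch = q by rewrite -e hq ?mem_head.
split.
  2: rewrite hgt_V2 ?size_merge_seams // => _.
  2: change (l = Num.max l (hgt (Comp 0 g0))).
  2: by rewrite hgt_V2 ?hq ?mem_head // maxr0.
apply/over_V2P; rewrite ?size_merge_seams //; exists l0, ch; split=> //.
  have [s1 hs1 hs2] := hasP hne; have ht : (index s1 g0 < q)%N.
    by rewrite -(hq g0) ?mem_head // index_mem.
  apply/hasP; exists (nth [::] (merge_seams q (g0 :: gss)) (index s1 g0)).
    by rewrite mem_nth // size_merge_seams.
  by rewrite nth_merge_seams //= size_cat nth_index // (leq_trans hs2) // leq_addr.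
move=> p /(nthP ([::], SLeaf))[t]; rewrite size_zip size_merge_seams hq0 minnn => ht <-.
rewrite nth_zip ?size_merge_seams //= nth_merge_seams // => x /flatten_mapP[gs hg hx].
have [l1 [ch' [es' _ e' hp]]] := hgs gs hg.
have ech : ch' = ch by move: es'; rewrite es => -[].
rewrite ech in e' hp; apply: (hp (nth [::] gs t, nth SLeaf ch t)) => //.
by apply: mem_zip_nth => //; rewrite hq.
Qed.

Lemma step1_nice s b b' : step1 b b' -> nice s b b'.
Proof.
case=> h; first exact: (in_ctx_nice (fun s b b' => @contractA_nice s b b') h).
exact: (in_ctx_nice (fun s b b' => @contractB_nice s b b') h).
Qed.

Lemma labs_cat (s1 s2 : seq bt) lam : labs (s1 ++ s2) lam = labs s1 lam ++ labs s2 lam.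
Proof. by rewrite /labs map_cat flatten_cat. Qed.

Lemma labs_cons b (s1 : seq bt) lam : labs (b :: s1) lam = lab b lam ++ labs s1 lam.
Proof. by []. Qed.

Lemma step1_lab b b' : step1 b b' -> lab b' = lab b.
Proof.
have ctx P : (forall x y, P x y -> lab y = lab x) ->
    forall x y, in_ctx P x y -> lab y = lab x.
  move=> hP x y; elim=> [? ? /hP //|l ss1 s1 c c' s2 ss2 _ IH].
  by apply: lab_replace; apply/funext => lam; rewrite !labs_cat !labs_cons IH.
case; apply: ctx => _ _ [].
  move=> l ss1 s1 g s2 ss2; apply: lab_replace; apply/funext => lam.
  by rewrite !labs_cat labs_cons lab_V1.
move=> l q gss h1 h2 /allP h3; apply/funext => -[|t lam].
  rewrite lab_V2_nil ?size_merge_seams // lab_V1.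
  elim: gss h3 {h1} => //= gs gss IH h3; rewrite labs_cons -IH; last first.
    by move=> y hy; apply: h3; rewrite inE hy orbT.
  by rewrite lab_V2_nil //; have /eqP-> := h3 gs (mem_head _ _).
rewrite lab_V2 ?size_merge_seams // lab_V1.
have -> : nth [::] (merge_seams q gss) t = flatten [seq nth [::] gs t | gs <- gss].
  have [ht|ht] := ltnP t q; first exact: nth_merge_seams.
  rewrite nth_default ?size_merge_seams //; elim: gss h3 {h1} => //= gs gss IH h3.
  rewrite -IH ?cats0; last by move=> y hy; apply: h3; rewrite inE hy orbT.
  by rewrite nth_default //; have /eqP-> := h3 gs (mem_head _ _).
elim: gss h3 {h1} => //= gs gss IH h3; rewrite labs_cat labs_cons IH; last first.
  by move=> y hy; apply: h3; rewrite inE hy orbT.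
by rewrite lab_V2 //; have /eqP-> := h3 gs (mem_head _ _).
Qed.

Lemma step1_head b b' : step1 b b' -> head 0 (blens b') = head 0 (blens b).
Proof. by case=> -[] // ? ? []. Qed.

Lemma renorm_nocollapse l P1 (s0 : seq bt) P2 : (1 < size P1 + size s0 + size P2)%N ->
  (0 < size s0)%N -> renorm l (P1 ++ s0 :: P2) = Comp l (P1 ++ s0 :: P2).
Proof.
move=> h h0; have [/renorm_V2-> //|] := ltnP 1 (size (P1 ++ s0 :: P2)).
rewrite size_cat /= addnS => /cat_cons_size1[e1 e2]; move: h; rewrite e1 e2 addn0.
by case: s0 {h0} => [|? [|? ?]].
Qed.

Lemma collapse_nil (A B : Type) (P1 P2 : seq A) (u v : seq B) :
  (size P1 + (size u + size v).+1 + size P2 <= 1)%N ->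
  [/\ P1 = [::], P2 = [::], u = [::] & v = [::]].
Proof.
by case: P1 P2 u v => [|? ?] [|? ?] [|? ?] [|? ?];
  rewrite /= ?addnS ?addSn ?ltnS.
Qed.

(** Either [renorm] does nothing and the step takes place in a context, or [x] is the only vertex
    there and replaces the root with a raised length, as covered by [step1_rlen]. *)
Lemma renorm_ctx l P1 u v P2 x x' : step1 x x' ->
  steps (renorm l (P1 ++ (u ++ x :: v) :: P2)) (renorm l (P1 ++ (u ++ x' :: v) :: P2)).
Proof.
move=> h; apply: rt_step.
have [h1|h1] := ltnP 1 (size P1 + (size u + size v).+1 + size P2)%N.
  have e z : renorm l (P1 ++ (u ++ z :: v) :: P2) = Comp l (P1 ++ (u ++ z :: v) :: P2).
    by apply: renorm_nocollapse; rewrite size_cat /= addnS.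
  by rewrite !e; exact: step1_ctx.
have [-> -> -> ->] := collapse_nil h1.
by rewrite /= !braise_rlen; exact: step1_rlen.
Qed.

Lemma renorm_ctx_steps l P1 u v P2 x x' : steps x x' ->
  steps (renorm l (P1 ++ (u ++ x :: v) :: P2)) (renorm l (P1 ++ (u ++ x' :: v) :: P2)).
Proof.
apply: (steps_lift (f := fun x => renorm l (P1 ++ (u ++ x :: v) :: P2))).
by move=> b b'; exact: renorm_ctx.
Qed.

Lemma renorm_map_steps (T : eqType) (f g : T -> bt) l P1 u (s0 : seq T) P2 :
  (forall z, z \in s0 -> steps (f z) (g z)) ->
  steps (renorm l (P1 ++ (u ++ map f s0) :: P2)) (renorm l (P1 ++ (u ++ map g s0) :: P2)).
Proof.
elim: s0 u => [|z s0 IH] u h /=; first exact: rt_refl.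
apply: rt_trans; first by apply: renorm_ctx_steps; exact: (h z (mem_head _ _)).
rewrite -[u ++ g z :: map f s0]cat_rcons -[u ++ g z :: map g s0]cat_rcons.
by apply: IH => w hw; apply: h; rewrite inE hw orbT.
Qed.

(** If the contracted vertex is alone, [renorm] has already absorbed it with length [Num.max l 0],
    and the two sides coincide. *)
Lemma renorm_A l P1 u v P2 (g : seq bt) : unitI l -> (1 < size g)%N ->
  steps (renorm l (P1 ++ (u ++ Comp 0 [:: g] :: v) :: P2))
        (renorm l (P1 ++ (u ++ g ++ v) :: P2)).
Proof.
move=> hl hg; rewrite (@renorm_nocollapse l P1 (u ++ g ++ v)); last 2 first.
- rewrite !size_cat; apply: (leq_trans hg).
  by rewrite -addnA addnCA -!addnA addnCA leq_addr.
- by rewrite !size_cat addnCA ltn_addr // ltnW.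
have [h1|h1] := ltnP 1 (size P1 + (size u + size v).+1 + size P2)%N.
  rewrite renorm_nocollapse; last 2 first.
  - by rewrite size_cat /= addnS.
  - by rewrite size_cat /= addnS.
  by apply: rt_step; left; apply: ctx_here; constructor.
have [-> -> -> ->] := collapse_nil h1.
by rewrite /= maxr0 // cats0; exact: rt_refl.
Qed.

Definition rootok b := if b is Comp l _ then unitI l else true.

Lemma renorm_A1 l P1 u v P2 (g : seq bt) : unitI l -> (0 < size g)%N -> all rootok g ->
  steps (renorm l (P1 ++ (u ++ renorm 0 [:: g] :: v) :: P2))
        (renorm l (P1 ++ (u ++ g ++ v) :: P2)).
Proof.
move=> hl; case: g => [|x [|y g]] // _; last by move=> _; exact: renorm_A.
rewrite /= andbT => hx; have -> : braise 0 x = x; last exact: rt_refl.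
by case: x hx => //= l' ss hl'; rewrite max0r.
Qed.

Lemma renorm_As l P1 u P2 (xs : seq (seq bt)) : unitI l ->
  all (fun g => (0 < size g)%N && all rootok g) xs ->
  steps (renorm l (P1 ++ (u ++ map (fun g => renorm 0 [:: g]) xs) :: P2))
        (renorm l (P1 ++ (u ++ flatten xs) :: P2)).
Proof.
move=> hl; elim: xs u => [|g xs IH] u; first by move=> _; exact: rt_refl.
rewrite [map _ _]/= [flatten _]/= [all _ _]/=.
case/andP => /andP[h1 h2] h; rewrite catA; apply: rt_trans (IH (u ++ g) h).
by rewrite -catA; exact: renorm_A1.
Qed.

(** With a single entry in [Xs] the left side is already collapsed by [renorm]; otherwise this is
    one contraction (b). *)
Lemma renorm_B l q (Xs : seq (seq (seq bt))) : unitI l -> (0 < size Xs)%N -> (1 < q)%N ->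
  all (fun gs => size gs == q) Xs ->
  steps (renorm l [:: map (Comp 0) Xs]) (Comp l (merge_seams q Xs)).
Proof.
move=> hl; case: Xs => [|X [|Y Xs]] // _ hq.
  rewrite /= andbT => /eqP <-; rewrite merge_seams1 maxr0 //; exact: rt_refl.
by move=> h; apply: rt_step; right; apply: ctx_here; constructor.
Qed.

End ABSteps.

(** * Pruning and the contractions (a) and (b) *)

Section PruneSteps.
Variable R : realType.
Notation bt := (btree R unit).

Lemma over_rootok s (b : bt) : over s b -> rootok b.
Proof. by case: b => //= l ss /andP[]. Qed.

Lemma over_prune_nonnil s (b : bt) : over s b -> lenok s -> nilp (prune s) = false.
Proof. by move=> ho hs; have [s' [-> _ _]] := over_bprune ho hs. Qed.

(** A nonempty seam is never dropped, since part of the seam tree below its members survives. The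
    surroundings [P1], [P2] do not depend on what the seam contains, so contractions inside it can
    be carried through. *)
Lemma bprune_ctx a l ss1 (s0 : seq bt) ss2 : over a (Comp l (ss1 ++ s0 :: ss2)) ->
  lenok a -> s0 != [::] ->
  exists c P1 P2, [/\ lenok c, forall x, x \in s0 -> over c x &
    forall l' s0', bprune a (Comp l' (ss1 ++ s0' :: ss2)) =
      renorm l' (P1 ++ map (bprune c) s0' :: P2)].
Proof.
move=> ho ha hne.
have es t : size (ss1 ++ t :: ss2) = (size ss1 + size ss2).+1.
  by rewrite size_cat /= addnS.
have [h1|h1] := ltnP 1 (size ss1 + size ss2).+1; last first.
  have [e1 e2] := cat_cons_size1 h1; rewrite {}e1 {}e2 {es h1 ss1 ss2} /cat in ho *.
  move: ho; rewrite over_V1 => /and4P[_ _ /allP ho _].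
  by exists a, [::], [::]; split.
move/over_V2P: ho; rewrite es => /(_ h1)[l0 [ch [ea hl _ e hp]]].
have [ch1 [c [ch2 [ech e1 e2]]]] := zip_at (etrans (es s0) e).
have ho x : x \in s0 -> over c x.
  move=> hx; have [] // := hp (s0, c) _ x hx.
  by rewrite ech zip_cat // mem_cat inE eqxx orbT.
have hc : lenok c.
  move: ha; rewrite ea => /andP[_ /allP]; apply.
  by rewrite ech mem_cat inE eqxx orbT.
exists c, (pseams ss1 ch1), (pseams ss2 ch2); split=> // l' s0'.
rewrite bprune_V2 ?es // ea [skids _]/= ech pseams_cat //; congr (renorm _ (_ ++ _)).
rewrite /pseams /=; case: s0 hne ho {e hp es h1} => // x s0 _ ho.
by rewrite (over_prune_nonnil (ho x (mem_head _ _)) hc).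
Qed.

(** Whether the [t]-th seam is dropped depends on the [t]-th child alone, so dropping commutes with
    concatenating seams of equal index. *)
Lemma pseams_merge (gss : seq (seq (seq bt))) (ch : seq (stree R)) :
  (forall gs, gs \in gss -> size gs = size ch) ->
  pseams (merge_seams (size ch) gss) ch =
  merge_seams (size (flatten (map (@prune R) ch))) [seq pseams gs ch | gs <- gss].
Proof.
elim: ch gss => [|c ch IH] gss h; first by [].
have h' gs : gs \in map behead gss -> size gs = size ch.
  by case/mapP => g hg ->; rewrite size_behead h.
rewrite [size (c :: ch)]/= merge_seams_cons.
have e gs : gs \in gss -> pseams gs (c :: ch) =
    (if nilp (prune c) then [::] else [:: map (bprune c) (head [::] gs)]) ++
    pseams (behead gs) ch.
  by move=> /h; case: gs.
have -> : pseams (flatten (map (head [::]) gss) :: merge_seams (size ch) (map behead gss))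
    (c :: ch) = (if nilp (prune c) then [::] else
      [:: map (bprune c) (flatten (map (head [::]) gss))]) ++
    pseams (merge_seams (size ch) (map behead gss)) ch by [].
have -> : map (fun gs => pseams gs (c :: ch)) gss = map (fun gs =>
    (if nilp (prune c) then [::] else [:: map (bprune c) (head [::] gs)]) ++
    pseams (behead gs) ch) gss by apply/eq_in_map.
rewrite IH // -map_comp.
rewrite /= size_cat; case: (prune_cases c) => [->|[c' ->]] //=.
rewrite add1n merge_seams_cons; congr (_ :: _); last by rewrite -map_comp.
by rewrite map_flatten -!map_comp.
Qed.

Lemma pseams_rootok (ss : seq (seq bt)) (ch : seq (stree R)) (s1 : seq bt) : size ss = size ch ->
  (forall p, p \in zip ss ch -> forall x, x \in p.1 -> over p.2 x) ->
  all (@lenok R) ch -> s1 \in pseams ss ch -> all (@rootok R) s1.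
Proof.
move=> e h /allP hch; rewrite /pseams map2E => /flatten_mapP[p hp].
case: ifP => // _; rewrite inE => /eqP->; apply/allP => _ /mapP[x hx ->].
have [s' [_ ho _]] := over_bprune (h p hp x hx) (hch _ (mem_zip2 hp)).
exact: over_rootok ho.
Qed.

Lemma renorm_pseams_cases a (gs : seq (seq bt)) ch l0 :
  a = SNode l0 ch -> lenok a -> (1 < size gs)%N -> over a (Comp 0 gs) ->
  size (flatten (map (@prune R) ch)) = 1%N ->
  exists x, [/\ pseams gs ch = [:: x], (0 < size x)%N & all (@rootok R) x].
Proof.
move=> ea ha hgs ho e1.
have [s' [_ + _]] := over_bprune ho ha.
rewrite bprune_V2 // ea [skids _]/=.
move/over_V2P: (ho) => /(_ hgs)[l1 [ch' [ea' _ _ esz hp]]].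
have ech : ch' = ch by move: ea'; rewrite ea => -[].
rewrite {}ech in esz hp.
have : size (pseams gs ch) = 1%N by rewrite size_pseams.
have hroot s1 : s1 \in pseams gs ch -> all (@rootok R) s1.
  apply: pseams_rootok => // [p hpp x hx|]; first by have [] := hp p hpp x hx.
  by move: ha; rewrite ea => /andP[].
case: (pseams gs ch) hroot => [|x [|]] // hroot _ hov; exists x; split=> //.
  by case: x hov {hroot} => //; rewrite over_V1 => /and3P[].
by apply: hroot; rewrite mem_head.
Qed.

(** When one child survives, each vertex being merged turns into a vertex of V_comp^1 of length 0,
    or into its only member. The merge is then a chain of contractions (a). *)
Lemma bprune_merge a l l0 ch (gss : seq (seq (seq bt))) (P1 P2 : seq (seq bt)) :
  a = SNode l0 ch -> lenok a -> unitI l -> (1 < size ch)%N ->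
  (forall gs, gs \in gss -> over a (Comp 0 gs) /\ size gs = size ch) ->
  size (flatten (map (@prune R) ch)) = 1%N ->
  steps (renorm l (P1 ++ map (bprune a) (map (Comp 0) gss) :: P2))
        (renorm l (P1 ++ pseams (merge_seams (size ch) gss) ch ++ P2)).
Proof.
move=> ea ha hl hch hg e1; rewrite pseams_merge; last by move=> gs /hg[].
rewrite e1 merge_seams_cons.
have hx gs : gs \in gss -> exists x, [/\ pseams gs ch = [:: x], (0 < size x)%N & all (@rootok R) x].
  by move=> /hg[h1 h2]; apply: renorm_pseams_cases ea ha _ h1 e1; rewrite h2.
have -> : map (bprune a) (map (Comp 0) gss) =
    map (fun g => renorm 0 [:: g]) (map (head [::]) (map (fun gs => pseams gs ch) gss)).
  rewrite -!map_comp; apply/eq_in_map => gs hgs; transitivity (bprune a (Comp 0 gs)); first by [].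
  rewrite bprune_V2 ?ea; last by rewrite (hg _ hgs).2.
  by rewrite [skids _]/=; have [x [e _ _]] := hx _ hgs; rewrite /= e.
apply: (@renorm_As R l P1 [::] P2) => //.
apply/allP => _ /mapP[_ /mapP[gs hgs ->] ->].
by have [x [-> -> ->]] := hx _ hgs.
Qed.

(** When two or more children survive, the merged vertices stay in V_comp^{>=2} with length 0, and
    the merge is a contraction (b), or nothing if there is only one of them. *)
Lemma bprune_merge_big a l l0 ch (gss : seq (seq (seq bt))) :
  a = SNode l0 ch -> lenok a -> unitI l -> (1 < size ch)%N -> (0 < size gss)%N ->
  (forall gs, gs \in gss -> size gs = size ch) ->
  (1 < size (flatten (map (@prune R) ch)))%N ->
  steps (renorm l [:: map (bprune a) (map (Comp 0) gss)])
        (Comp l (pseams (merge_seams (size ch) gss) ch)).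
Proof.
move=> ea ha hl hch hgss hg e1; rewrite pseams_merge //.
have -> : map (bprune a) (map (Comp 0) gss) = map (Comp 0) (map (fun gs => pseams gs ch) gss).
  rewrite -!map_comp; apply/eq_in_map => gs hgs; transitivity (bprune a (Comp 0 gs)); first by [].
  by rewrite bprune_V2 ?ea ?hg // [skids _]/= renorm_V2 // size_pseams // hg.
apply: renorm_B => //; first by rewrite size_map.
by apply/allP => _ /mapP[gs hgs ->]; rewrite size_pseams // hg.
Qed.

Lemma in_ctx_prune (P : bt -> bt -> Prop) :
  (forall a b b', P b b' -> over a b -> lenok a -> steps (bprune a b) (bprune a b')) ->
  forall b b', in_ctx P b b' -> forall a, over a b -> lenok a ->
    steps (bprune a b) (bprune a b').
Proof.
move=> hP b b'; elim=> [x y h a|l ss1 s1 x x' s2 ss2 _ IH a ho ha]; first exact: hP.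
have [|c [P1 [P2 [hc hov e]]]] := bprune_ctx ho ha; first by case: (s1).
rewrite !e !map_cat /=; apply: renorm_ctx_steps; apply: IH => //.
exact: over_cat_mid hov.
Qed.

(** A vertex of V_comp^1 has at least two members, all of which survive, so pruning does not
    suppress it and [renorm_A] applies. *)
Lemma contractA_prune a (b b' : bt) : contractA b b' -> over a b -> lenok a ->
  steps (bprune a b) (bprune a b').
Proof.
case=> l ss1 s1 g s2 ss2 ho ha.
have [|c [P1 [P2 [hc hov e]]]] := bprune_ctx ho ha; first by case: (s1).
rewrite !e !map_cat map_cons.
have := over_cat_mid hov; rewrite over_V1 => /and4P[_ hg _ _].
have -> : bprune c (Comp 0 [:: g]) = Comp 0 [:: map (bprune c) g].
  by case: g hg {ho hov e} => [|? [|? ?]].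
by apply: renorm_A; rewrite ?size_map //; exact: over_unitI ho.
Qed.

Lemma contractB_prune a (b b' : bt) : contractB b b' -> over a b -> lenok a ->
  steps (bprune a b) (bprune a b').
Proof.
case=> l q gss h1 h2 /allP h3 ho ha.
have hl := over_unitI ho.
move: ho; rewrite over_V1 => /and4P[_ hs /allP ho _].
have hsz gs : gs \in gss -> size gs = q by move=> /h3/eqP.
have [l0 [ch [ea eq]]] : exists l0 ch, a = SNode l0 ch /\ size ch = q.
  case: gss h1 hsz ho {hs h3} => // gs gss _ hsz ho.
  have := ho (Comp 0 gs) (mem_head _ _).
  move/over_V2P; rewrite hsz ?mem_head // => /(_ h2)[l0 [ch [ea _ _ e _]]].
  by exists l0, ch; rewrite -e.
have hg gs : gs \in gss -> over a (Comp 0 gs) /\ size gs = size ch.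
  by move=> h; split; [apply: ho; exact: map_f | rewrite hsz].
have -> : bprune a (Comp l [:: map (Comp 0) gss]) =
    renorm l [:: map (bprune a) (map (Comp 0) gss)] by [].
rewrite bprune_V2 ?size_merge_seams // {2}ea [skids _]/= -eq.
have [|e1] := ltnP 1 (size (flatten (map (@prune R) ch))).
  move=> h; have := @bprune_merge_big a l l0 ch gss ea ha hl.
  move=> hh; have {}hh := hh _ h1 _ h; move: hh; rewrite eq => /(_ h2 hsz) hh; rewrite [renorm l (pseams _ _)]renorm_V2 //.
  by rewrite size_pseams // size_merge_seams.
(* Some child survives, because a bubble tree lies over [a]. *)
have e0 : size (flatten (map (@prune R) ch)) = 1%N.
  apply/eqP; rewrite eqn_leq e1 lt0n; apply/eqP => e0.
  case: gss h1 hg {h3 hs ho hsz} => // gs gss _ hg.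
  have := over_prune_nonnil (hg gs (mem_head _ _)).1 ha.
  by rewrite ea /= (size0nil e0).
have := @bprune_merge a l l0 ch gss [::] [::] ea ha hl.
by rewrite cats0 => hh; apply: hh => //; rewrite eq.
Qed.

Lemma step1_prune a (b b' : bt) : step1 b b' -> over a b -> lenok a ->
  steps (bprune a b) (bprune a b').
Proof.
move=> [] h; apply: in_ctx_prune h _; first exact: contractA_prune.
exact: contractB_prune.
Qed.

End PruneSteps.

(** * Pruning and the contraction (c) *)

Section SeamContraction.
Variable R : realType.
Notation bt := (btree R unit).

(** [scontract] at an edge of length 0 as a relation, with the children split at the address. The
    index [q] is the number of children of the contracted vertex, which [bcontract] takes as a
    parameter. *)
Inductive Cst : nat -> seq nat -> stree R -> stree R -> Prop :=
| Cst_here l ch1 ch ch2 :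
    Cst (size ch) [:: size ch1] (SNode l (ch1 ++ SNode 0 ch :: ch2))
        (SNode l (ch1 ++ ch ++ ch2))
| Cst_in q rho l ch1 c c' ch2 : Cst q rho c c' ->
    Cst q (size ch1 :: rho) (SNode l (ch1 ++ c :: ch2)) (SNode l (ch1 ++ c' :: ch2)).

Lemma flatten_mapi_at (A : Type) (F : A -> seq A) t s x s' : size s = t ->
  flatten (mapi (fun j y => if j == t then F y else [:: y]) (s ++ x :: s')) =
  s ++ F x ++ s'.
Proof.
move=> e; rewrite (mapi_at F (fun y => [:: y])) // flatten_cat /=.
by rewrite !flatten_seq1.
Qed.

Lemma Cst_nonnil q rho s s' : Cst q rho s s' -> rho != [::].
Proof. by case. Qed.

Lemma CstP q rho s s' : Cst q rho s s' ->
  s' = scontract rho s /\ exists2 ch, ssub s rho = Some (SNode 0 ch) & size ch = q.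
Proof.
elim=> {q rho s s'} [l ch1 ch ch2|q rho l ch1 c c' ch2 h [-> [ch e1 e2]]].
  split; first by rewrite /= flatten_mapi_at.
  by exists ch => //=; rewrite onth_cat_size.
split; last by exists ch => //=; rewrite onth_cat_size.
have := Cst_nonnil h; case: (rho) => // u rho' _.
by rewrite /= (mapi_at (scontract (u :: rho')) id) // !map_id.
Qed.

Lemma ssub_Cst rho s ch : rho != [::] -> ssub s rho = Some (SNode 0 ch) ->
  Cst (size ch) rho s (scontract rho s).
Proof.
elim: rho s => // t rho IH [|l cs] // _ /=; case e: onth => [c|] //.
have [s1 [s2 [-> es]]] := onth_some e.
case: rho IH => [_ [->]|u rho IH h] /=.
  by rewrite flatten_mapi_at // -es; constructor.
rewrite (mapi_at (scontract (u :: rho)) id) // !map_id -es; constructor.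
exact: IH.
Qed.

Lemma Cst_map q rho s s' (f : R -> R) : Cst q rho s s' ->
  Cst q rho (if s is SNode l ch then SNode (f l) ch else SLeaf)
    (if s' is SNode l ch then SNode (f l) ch else SLeaf).
Proof. by case=> *; constructor. Qed.

Lemma Cst_sraise l q rho s s' : Cst q rho s s' -> Cst q rho (sraise l s) (sraise l s').
Proof. exact: Cst_map. Qed.

Lemma Cst_sroot q rho s s' : Cst q rho s s' -> Cst q rho (sroot s) (sroot s').
Proof. exact: (@Cst_map _ _ _ _ (fun=> 0)). Qed.

(** [zover rho b]: the vertices of [b] over [rho] all lie in V_comp^{>=2} and
    have length [0]. *)
Fixpoint zover (rho : seq nat) (b : bt) : bool :=
  match b with
  | Mark _ => true
  | Comp l ss =>
    if (1 < size ss)%N then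
      if rho is t :: rho' then nth true [seq all (zover rho') s1 | s1 <- ss] t
      else l == 0
    else (rho != [::]) && all (all (zover rho)) ss
  end.

Lemma zover_V2 t rho l ss : (1 < size ss)%N ->
  zover (t :: rho) (Comp l ss) = all (zover rho) (nth [::] ss t).
Proof.
move=> h; rewrite /= h; have [ht|ht] := ltnP t (size ss).
  by rewrite (nth_map [::]).
by rewrite !nth_default ?size_map.
Qed.

Lemma zover_V1 rho l s1 : zover rho (Comp l [:: s1]) = (rho != [::]) && all (zover rho) s1.
Proof. by rewrite /= andbT. Qed.

Definition zpremise rho (b : bt) := forall al l ss, bsub b al = Some (Comp l ss) ->
  coh b al = rho -> l = 0 /\ (1 < size ss)%N.

Lemma zpremise_zover rho b : zpremise rho b -> zover rho b.
Proof.
elim/btree_nested_ind: b rho => // l ss IH rho h.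
have child p c rho' : bchild (Comp l ss) p = Some c ->
    rho = step_of (Comp l ss) p.1 ++ rho' -> zover rho' c.
  move=> e er; have [ht hc] := bchild_mem e.
  apply: (IH (nth [::] ss p.1)) => //; first exact: mem_nth.
  move=> al l' ss' h1 h2; apply: (h (p :: al)); first by rewrite bsub_cons e.
  by rewrite (coh_cons _ e) h2.
have [h1|h1] := ltnP 1 (size ss).
  case: rho h child => [|t rho] h child.
    by rewrite /= h1; have [-> _] := h [::] l ss erefl erefl.
  rewrite zover_V2 //; apply/allP => c hc.
  by have [j e] := @mem_bchild R unit l ss t c hc; apply: (child (t, j)) => //=; rewrite h1.
rewrite /= ltnNge h1 /=; apply/andP; split.
  by apply/eqP => er; have := h [::] l ss erefl; rewrite er => /(_ erefl)[_]; rewrite ltnNge h1.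
apply/allP => s1 hs1; apply/allP => c hc.
have hc' : c \in nth [::] ss (index s1 ss) by rewrite nth_index.
have [j e] := @mem_bchild R unit l ss _ c hc'.
by apply: (child _ _ _ e) => //=; rewrite ltnNge h1.
Qed.

Lemma zover_zpremise rho b : zover rho b -> zpremise rho b.
Proof.
move=> h al; elim: al b rho h => [|p al IH] b rho hz l ss.
  move=> hb; have eb : b = Comp l ss by case: b hz hb => [? _ []|? ? _ [-> ->]].
  move=> /= er; move: hz; rewrite -{}er eb /=; case: ifP => // h1.
  by move/eqP.
rewrite bsub_cons; case e: bchild => [c|] // h1; rewrite (coh_cons _ e) => er.
have [l' [ss' eb]] := bchild_Comp e; rewrite {}eb in hz e er.
have [ht hc] := bchild_mem e.
apply: (IH c (coh c al)) h1 erefl.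
have [h2|h2] := ltnP 1 (size ss').
  rewrite /= h2 /= in er; move: hz; rewrite -er zover_V2 // => /allP; exact.
have er' : coh c al = rho by move: er; rewrite /= ltnNge h2.
move: hz; rewrite /= ltnNge h2 /= -er' => /andP[_ /allP/(_ _ (mem_nth [::] ht))/allP].
exact.
Qed.

Lemma zover_rlen rho f b : rho != [::] -> zover rho (rlen f b) = zover rho b.
Proof. by case: b rho => // l ss [|t rho]. Qed.

Lemma bcontract_rlen q rho f (b : bt) : bcontract q rho (rlen f b) = rlen f (bcontract q rho b).
Proof. by case: b => //= l ss; case: ifP => // _; case: rho => // t [|? ?]. Qed.

Lemma bcontract_V1 q rho l s1 :
  bcontract q rho (Comp l [:: s1]) = Comp l [:: map (bcontract q rho) s1] :> bt.
Proof. by []. Qed.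

Lemma bcontract_V2_here q l ss1 (s0 : seq bt) ss2 : (1 < size (ss1 ++ s0 :: ss2))%N ->
  bcontract q [:: size ss1] (Comp l (ss1 ++ s0 :: ss2)) =
  Comp l (ss1 ++ merge_seams q (map (@bkids R unit) s0) ++ ss2).
Proof.
move=> h; rewrite [LHS]/= h.
by rewrite (flatten_mapi_at (fun s => merge_seams q (map (@bkids R unit) s))).
Qed.

Lemma bcontract_V2_in q rho l ss1 (s0 : seq bt) ss2 : (1 < size (ss1 ++ s0 :: ss2))%N ->
  rho != [::] -> bcontract q (size ss1 :: rho) (Comp l (ss1 ++ s0 :: ss2)) =
  Comp l (ss1 ++ map (bcontract q rho) s0 :: ss2).
Proof.
case: rho => // u rho h _; rewrite [LHS]/= h.
by rewrite (mapi_at (map (bcontract q (u :: rho))) id) // !map_id.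
Qed.

(** Let [a'] arise from the flagged seam tree [a] by contracting the edge of
    [rho].  Either this edge is suppressed by the pruning, and the contraction
    (c) becomes a chain of contractions (a) and (b), or it survives, and (c)
    becomes a contraction (c) of the pruned pair. *)
Definition eqcase q rho a a' := prune a = prune a' /\
  forall b : bt, over a b -> zover rho b ->
    steps (bprune a b) (bprune a' (bcontract q rho b)).

Definition Ccase q rho a a' := exists q' rho' s1 s1',
  [/\ prune a = [:: s1], prune a' = [:: s1'], Cst q' rho' s1 s1' &
    forall b : bt, over a b -> zover rho b ->
      bprune a' (bcontract q rho b) = bcontract q' rho' (bprune a b) /\
      zover rho' (bprune a b)].

(** A vertex of V_comp^1 and its members lie over the same seam vertex, so chains for the members
    combine through [renorm]. This leaves the vertices of V_comp^{>=2}. *)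
Lemma eqcase_lift q rho l0 ch a' : rho != [::] ->
  prune (SNode l0 ch) = prune a' ->
  (forall l ss, (1 < size ss)%N -> over (SNode l0 ch) (Comp l ss) -> zover rho (Comp l ss) ->
    steps (bprune (SNode l0 ch) (Comp l ss)) (bprune a' (bcontract q rho (Comp l ss)))) ->
  eqcase q rho (SNode l0 ch) a'.
Proof.
move=> hr e h; split=> // b; elim/btree_nested_ind: b => // l ss IH ho hz.
have [h1|h1] := ltnP 1 (size ss); first exact: h.
case: ss h1 IH ho hz => [|s1 [|]] //; first by move=> _ _ /over_size.
move=> _ IH; rewrite over_V1 zover_V1 => /and4P[_ _ /allP ho _].
move=> /andP[_ /allP hz]; rewrite bcontract_V1 /bprune -/bprune -map_comp.
apply: (@renorm_map_steps R (btree R unit) _ _ l [::] [::] s1 [::]) => x hx.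
by apply: (IH s1); rewrite ?mem_head //; [exact: ho | exact: hz].
Qed.

(** As before, the claim passes through V_comp^1. Its vertices have at least two members and are not
    collapsed, so equalities are preserved. *)
Lemma Ccase_lift q rho l0 ch a' q' rho' s1 s1' : rho != [::] ->
  prune (SNode l0 ch) = [:: s1] -> prune a' = [:: s1'] -> Cst q' rho' s1 s1' ->
  (forall l ss, (1 < size ss)%N -> over (SNode l0 ch) (Comp l ss) -> zover rho (Comp l ss) ->
    bprune a' (bcontract q rho (Comp l ss)) = bcontract q' rho' (bprune (SNode l0 ch) (Comp l ss)) /\
    zover rho' (bprune (SNode l0 ch) (Comp l ss))) ->
  Ccase q rho (SNode l0 ch) a'.
Proof.
move=> hr e e' hC h; exists q', rho', s1, s1'; split=> // b.
elim/btree_nested_ind: b => // l ss IH ho hz.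
have [h1|h1] := ltnP 1 (size ss); first exact: h.
case: ss h1 IH ho hz => [|t1 [|]] //; first by move=> _ _ /over_size.
move=> _ IH; rewrite over_V1 zover_V1 => /and4P[_ hs /allP ho _].
move=> /andP[_ /allP hz]; rewrite bcontract_V1 /bprune -/bprune.
have er (t : seq bt) : (1 < size t)%N -> renorm l [:: t] = Comp l [:: t].
  by case: t => [|? [|? ?]].
rewrite !er ?size_map // bcontract_V1 zover_V1 (Cst_nonnil hC) /=; split.
  congr (Comp l [:: _]); rewrite -!map_comp; apply/eq_in_map => x hx.
  by apply: (IH t1 x _ hx _ _).1; rewrite ?mem_head //; [exact: ho | exact: hz].
apply/allP => _ /mapP[x hx ->].
by apply: (IH t1 x _ hx _ _).2; rewrite ?mem_head //; [exact: ho | exact: hz].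
Qed.

Lemma over_split l0 ch1 c ch2 l ss : (1 < size ss)%N ->
  over (SNode l0 (ch1 ++ c :: ch2)) (Comp l ss : bt) ->
  exists ss1 s0 ss2, [/\ ss = ss1 ++ s0 :: ss2, size ss1 = size ch1,
    size ss2 = size ch2 & forall x, x \in s0 -> over c x].
Proof.
move=> h ho; move/over_V2P: ho => /(_ h)[l1 [ch [[_ <-] _ _ e hp]]].
have [ss1 [s0 [ss2 [es e1 e2]]]] := zip_at (esym e).
exists ss1, s0, ss2; split=> // x hx.
have [] // := hp (s0, c) _ x hx; by rewrite es zip_cat // mem_cat mem_head orbT.
Qed.

Lemma zover_nil_map ch (s0 : seq bt) : (forall x, x \in s0 -> over (SNode 0 ch) x) ->
  all (zover [::]) s0 ->
  exists2 gss, s0 = map (Comp 0) gss &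
    forall gs, gs \in gss -> over (SNode 0 ch) (Comp 0 gs) /\ size gs = size ch.
Proof.
elim: s0 => [|x s0 IH] ho; first by exists [::].
case/andP=> hz /IH[|gss -> h]; first by move=> y hy; apply: ho; rewrite inE hy orbT.
have hx := ho x (mem_head _ _).
case: x hx hz {ho IH} => // l ss hx; rewrite /zover -/zover; case: ifP => // h1 /eqP el.
rewrite el in hx *; exists (ss :: gss) => // gs; rewrite inE => /orP[/eqP->|]; last exact: h.
by split=> //; move/over_V2P: hx => /(_ h1)[? [? [[_ <-]]]].
Qed.

Lemma prune_node l ch : prune (SNode l ch) = snorm l (flatten (map (@prune R) ch)).
Proof. by []. Qed.

Lemma snorm_big l (d : seq (stree R)) : (1 < size d)%N -> snorm l d = [:: SNode l d].
Proof. by case: d => [|? [|? ?]]. Qed.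

(** The outcome depends on the survivors: [d] among the children of the contracted vertex, [p1] and
    [p2] among its siblings. *)
Lemma Cst_prune_here l ch1 ch ch2 : (1 < size ch)%N ->
  lenok (SNode l (ch1 ++ SNode 0 ch :: ch2)) ->
  eqcase (size ch) [:: size ch1] (SNode l (ch1 ++ SNode 0 ch :: ch2)) (SNode l (ch1 ++ ch ++ ch2)) \/
  Ccase (size ch) [:: size ch1] (SNode l (ch1 ++ SNode 0 ch :: ch2)) (SNode l (ch1 ++ ch ++ ch2)).
Proof.
move=> hq hlen; set a := SNode l _; set a' := SNode l (ch1 ++ ch ++ ch2).
set p1 := flatten (map (@prune R) ch1); set p2 := flatten (map (@prune R) ch2).
set d := flatten (map (@prune R) ch).
have hl : unitI l by case/andP: hlen.
have hall : all (@lenok R) (ch1 ++ SNode 0 ch :: ch2) by case/andP: hlen.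
have hch : lenok (SNode 0 ch).
  by move/allP: hall; apply; rewrite mem_cat mem_head orbT.
have ea : prune a = snorm l (p1 ++ snorm 0 d ++ p2).
  by rewrite prune_node map_cat flatten_cat.
have ea' : prune a' = snorm l (p1 ++ d ++ p2).
  by rewrite prune_node !map_cat !flatten_cat.
have key l' ss : (1 < size ss)%N -> over a (Comp l' ss) -> zover [:: size ch1] (Comp l' ss) ->
    exists P1 P2 gss, [/\ size P1 = size p1, size P2 = size p2,
      forall gs, gs \in gss -> over (SNode 0 ch) (Comp 0 gs) /\ size gs = size ch,
      bprune a (Comp l' ss) = renorm l' (P1 ++ (if nilp (snorm 0 d) then [::]
        else [:: map (bprune (SNode 0 ch)) (map (Comp 0) gss)]) ++ P2) &
      bprune a' (bcontract (size ch) [:: size ch1] (Comp l' ss)) =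
        renorm l' (P1 ++ pseams (merge_seams (size ch) gss) ch ++ P2)].
  move=> hss ho; have [ss1 [s0 [ss2 [es e1 e2 h0]]]] := over_split hss ho.
  rewrite {}es in hss ho * => hz0.
  have hz : all (zover [::]) s0.
    by move: hz0; rewrite -e1 zover_V2 // nth_cat ltnn subnn.
  have [gss es0 hg] := zover_nil_map h0 hz; rewrite -e1 {hz0}.
  exists (pseams ss1 ch1), (pseams ss2 ch2), gss; split=> //; rewrite ?size_pseams //.
    by rewrite bprune_V2 // [skids _]/= pseams_cat // es0.
  rewrite bcontract_V2_here // bprune_V2; last first.
    by rewrite !size_cat size_merge_seams; lia.
  rewrite [skids _]/= !pseams_cat ?size_merge_seams // es0 -map_comp.
  by rewrite (_ : map _ gss = gss) // -[RHS]map_id.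
have eq_dm gss : (forall gs, gs \in gss -> over (SNode 0 ch) (Comp 0 gs : bt) /\ size gs = size ch) ->
    size (pseams (merge_seams (size ch) gss) ch) = size d.
  by move=> _; rewrite size_pseams // size_merge_seams.
(* With at most one survivor in [d] the contracted vertex is pruned away in any case; both seam
   trees agree, and the merge above is a chain of contractions (a), or concerns seams that are
   dropped. *)
have [d1|d1] := ltnP 1 (size d); last first.
  have esn : snorm 0 d = d.
    have hd : all (@sok R) d.
      apply/allP => x /flatten_mapP[c hc]; move: x; apply/allP/prune_sok.
      by case/andP: hch => _ /allP; exact.
    case: d d1 hd {key ea ea' eq_dm} => [|c [|]] // _.
    by case: c => //= l1 ch0; rewrite andbT => /and3P[h1 _ _]; rewrite max0r.
  left; apply: eqcase_lift => //; first by rewrite ea ea' esn.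
  move=> l' ss hss ho hz; have [P1 [P2 [gss [_ _ hg -> ->]]]] := key l' ss hss ho hz.
  rewrite esn; move: d1; rewrite leq_eqVlt ltnS leqn0 => /orP[/eqP d1|/eqP d0].
    have -> : nilp d = false by rewrite /nilp d1.
    exact: (@bprune_merge R (SNode 0 ch) l' 0 ch gss P1 P2 erefl hch (over_unitI ho) hq hg d1).
  rewrite (size0nil d0) /=.
  have -> : pseams (merge_seams (size ch) gss) ch = [::].
    by apply: size0nil; rewrite eq_dm.
  exact: rt_refl.
have esn : snorm 0 d = [:: SNode 0 d] by exact: snorm_big.
(* A surviving sibling keeps the edge, and (c) remains a (c) at a shifted index. Without one, the
   lower end of the edge is suppressed, the length becomes [Num.max l 0], and the bubble tree
   undergoes (b). *)
have [hp|hp] := posnP (size p1 + size p2); last first.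
  right; apply: (Ccase_lift (q' := size d) (rho' := [:: size p1])
    (s1 := SNode l (p1 ++ SNode 0 d :: p2)) (s1' := SNode l (p1 ++ d ++ p2))) => //.
  - by rewrite ea esn snorm_big // size_cat /= addnS ltnS.
  - by rewrite ea' snorm_big // !size_cat; lia.
  - by constructor.
  move=> l' ss hss ho hz; have [P1 [P2 [gss [h1 h2 hg -> ->]]]] := key l' ss hss ho hz.
  rewrite esn [nilp _]/= -h1 !cat1s.
  have hsz (X : seq bt) : (1 < size (P1 ++ X :: P2))%N.
    by rewrite size_cat /= addnS h1 h2 ltnS.
  have eX : map (bprune (SNode 0 ch)) (map (Comp 0) gss) =
      map (Comp 0) (map (fun gs => pseams gs ch) gss).
    rewrite -!map_comp; apply/eq_in_map => gs /hg[_ e].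
    transitivity (bprune (SNode 0 ch) (Comp 0 gs)); first by [].
    by rewrite bprune_V2 ?e // [skids _]/= renorm_V2 // size_pseams.
  rewrite (renorm_V2 l' (hsz _)) bcontract_V2_here // zover_V2 //.
  rewrite eX nth_cat ltnn subnn -map_comp.
  have -> : map (@bkids R unit \o Comp 0) (map (fun gs => pseams gs ch) gss) =
      map (fun gs => pseams gs ch) gss by rewrite -[RHS]map_id.
  split; last first.
    apply/allP => _ /mapP[_ /mapP[gs /hg[_ e] ->] ->].
    by rewrite /= size_pseams // d1.
  rewrite -pseams_merge; last by move=> gs /hg[].
  by rewrite renorm_V2 // !size_cat size_pseams ?size_merge_seams // -/d; lia.
have [ep1 ep2] : p1 = [::] /\ p2 = [::].
  by split; apply: size0nil; lia.
left; apply: eqcase_lift => //.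
  by rewrite ea ea' esn ep1 ep2 !cats0 !cat0s (snorm_big l d1) /= maxr0.
move=> l' ss hss ho hz; have [P1 [P2 [gss [h1 h2 hg e3 ->]]]] := key l' ss hss ho hz.
rewrite e3; rewrite ep1 in h1; rewrite ep2 in h2.
rewrite (size0nil h1) (size0nil h2) esn [nilp _]/= cats0 !cat0s in e3 *.
(* For empty [gss] the pruned tree would have a single empty seam, against its stability. *)
have hgss : (0 < size gss)%N.
  case: gss e3 {hg} => // e3; have [s' [_ + _]] := over_bprune ho hlen.
  by rewrite e3 /= andbF.
rewrite cats0 [X in steps _ X]renorm_V2 ?eq_dm //.
apply: (@bprune_merge_big R (SNode 0 ch) l' 0 ch gss) => //; first exact: over_unitI ho.
by move=> gs /hg[].
Qed.

Lemma bcontract_renorm q rho l (t : seq bt) :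
  bcontract q rho (renorm l [:: t]) = renorm l [:: map (bcontract q rho) t].
Proof. by case: t => [|x [|y t]] //; rewrite /renorm /= !braise_rlen bcontract_rlen. Qed.

Lemma zover_renorm rho l (t : seq bt) : rho != [::] -> all (zover rho) t ->
  zover rho (renorm l [:: t]).
Proof.
move=> hr; case: t => [|x [|y t]] h.
- by rewrite zover_V1 hr.
- by rewrite /= braise_rlen zover_rlen //; case/andP: h.
- by rewrite zover_V1 hr.
Qed.

Lemma Cst_prune_in q rho l ch1 c c' ch2 : rho != [::] -> Cst q rho c c' ->
  lenok (SNode l (ch1 ++ c :: ch2)) ->
  eqcase q rho c c' \/ Ccase q rho c c' ->
  eqcase q (size ch1 :: rho) (SNode l (ch1 ++ c :: ch2)) (SNode l (ch1 ++ c' :: ch2)) \/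
  Ccase q (size ch1 :: rho) (SNode l (ch1 ++ c :: ch2)) (SNode l (ch1 ++ c' :: ch2)).
Proof.
move=> hr hC hlen H; set a := SNode l (_ ++ c :: _); set a' := SNode l (_ ++ c' :: _).
set p1 := flatten (map (@prune R) ch1); set p2 := flatten (map (@prune R) ch2).
have ea : prune a = snorm l (p1 ++ prune c ++ p2) by rewrite prune_node map_cat flatten_cat.
have ea' : prune a' = snorm l (p1 ++ prune c' ++ p2) by rewrite prune_node map_cat flatten_cat.
have key l' ss : (1 < size ss)%N -> over a (Comp l' ss) -> zover (size ch1 :: rho) (Comp l' ss) ->
    exists P1 P2 s0, [/\ size P1 = size p1, size P2 = size p2,
      forall x, x \in s0 -> over c x /\ zover rho x,
      bprune a (Comp l' ss) = renorm l' (P1 ++ (if nilp (prune c) then [::]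
        else [:: map (bprune c) s0]) ++ P2) &
      bprune a' (bcontract q (size ch1 :: rho) (Comp l' ss)) =
        renorm l' (P1 ++ (if nilp (prune c') then [::]
        else [:: map (bprune c') (map (bcontract q rho) s0)]) ++ P2)].
  move=> hss ho; have [ss1 [s0 [ss2 [es e1 e2 h0]]]] := over_split hss ho.
  rewrite {}es in hss ho *; rewrite -e1 zover_V2 // => hz0.
  have /allP hz : all (zover rho) s0 by move: hz0; rewrite nth_cat ltnn subnn.
  exists (pseams ss1 ch1), (pseams ss2 ch2), s0; split=> //; rewrite ?size_pseams //.
  - by move=> x hx; split; [exact: h0 | exact: hz].
  - by rewrite bprune_V2 // [skids _]/= pseams_cat.
  rewrite bcontract_V2_in // bprune_V2 ?size_cat //; last by move: hss; rewrite size_cat.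
  by rewrite [skids _]/= pseams_cat.
case: H => [[ec hc]|[q' [rho' [s1 [s1' [ec ec' hC' hc]]]]]].
  left; apply: eqcase_lift => //; first by rewrite ea ea' ec.
  move=> l' ss hss ho hz; have [P1 [P2 [s0 [_ _ h0 -> ->]]]] := key l' ss hss ho hz.
  rewrite -ec; case: (nilp _); first exact: rt_refl.
  rewrite -map_comp; apply: (@renorm_map_steps R _ _ _ l' P1 [::] s0 P2) => x hx.
  by have [h1 h2] := h0 x hx; exact: hc.
have e0 (s0 : seq bt) : (forall x, x \in s0 -> over c x /\ zover rho x) ->
    map (bprune c') (map (bcontract q rho) s0) = map (bcontract q' rho') (map (bprune c) s0) /\
    all (zover rho') (map (bprune c) s0).
  move=> h0; split; last by apply/allP => _ /mapP[x /h0[h1 h2] ->]; exact: (hc x h1 h2).2.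
  by rewrite -!map_comp; apply/eq_in_map => x /h0[h1 h2]; exact: (hc x h1 h2).1.
(* Without surviving siblings the root is suppressed, and the address of the contracted vertex loses
   its first entry. *)
have [hp|hp] := posnP (size p1 + size p2).
  have [ep1 ep2] : p1 = [::] /\ p2 = [::] by split; apply: size0nil; lia.
  right; apply: (Ccase_lift (q' := q') (rho' := rho') (s1 := sraise l s1) (s1' := sraise l s1')) => //.
  - by rewrite ea ec ep1 ep2.
  - by rewrite ea' ec' ep1 ep2.
  - exact: Cst_sraise.
  move=> l' ss hss ho hz; have [P1 [P2 [s0 [h1 h2 h0 -> ->]]]] := key l' ss hss ho hz.
  rewrite ep1 in h1; rewrite ep2 in h2.
  rewrite (size0nil h1) (size0nil h2) ec ec' [nilp [:: s1]]/= [nilp [:: s1']]/= !cats0 !cat0s.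
  have [-> hz'] := e0 _ h0; rewrite bcontract_renorm; split=> //.
  by apply: zover_renorm => //; exact: Cst_nonnil hC'.
right; apply: (Ccase_lift (q' := q') (rho' := size p1 :: rho')
  (s1 := SNode l (p1 ++ s1 :: p2)) (s1' := SNode l (p1 ++ s1' :: p2))) => //.
- by rewrite ea ec snorm_big // size_cat /= addnS ltnS.
- by rewrite ea' ec' snorm_big // size_cat /= addnS ltnS.
- by constructor.
move=> l' ss hss ho hz; have [P1 [P2 [s0 [h1 h2 h0 -> ->]]]] := key l' ss hss ho hz.
rewrite ec ec' [nilp [:: s1]]/= [nilp [:: s1']]/= -h1 !cat1s.
have hsz (X : seq bt) : (1 < size (P1 ++ X :: P2))%N.
  by rewrite size_cat /= addnS h1 h2 ltnS.
have [-> hz'] := e0 _ h0.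
rewrite !renorm_V2 // bcontract_V2_in //; last exact: Cst_nonnil hC'.
by rewrite zover_V2 // nth_cat ltnn subnn.
Qed.

Lemma Cst_prune q rho a a' : Cst q rho a a' -> (1 < q)%N -> lenok a ->
  eqcase q rho a a' \/ Ccase q rho a a'.
Proof.
move=> h hq; elim: h hq => {q rho a a'} [l ch1 ch ch2 hq|q rho l ch1 c c' ch2 h IH hq] hlen.
  exact: Cst_prune_here.
apply: Cst_prune_in => //; first exact: Cst_nonnil h.
apply: IH => //; case/andP: hlen => _ /allP; apply.
by rewrite mem_cat mem_head orbT.
Qed.

End SeamContraction.

(** * Contracting a flagged seam tree *)

Section FlaggedContraction.
Variable R : realType.

(** [fill] undoes [sflag], and [lflags] tells which leaves were flagged; a seam
    tree whose flags have length [0] is determined by the two. *)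
Fixpoint fill (s : stree R) : stree R :=
  match s with
  | SLeaf => SLeaf
  | SNode l ch => if ch is [::] then SLeaf else SNode l (map fill ch)
  end.

Fixpoint lflags (s : stree R) : seq bool :=
  match s with
  | SLeaf => [:: false]
  | SNode l ch => if ch is [::] then [:: true] else flatten (map lflags ch)
  end.

Fixpoint flz (s : stree R) : bool :=
  match s with
  | SLeaf => true
  | SNode l ch => if ch is [::] then l == 0 else all flz ch
  end.

Lemma fill_node l ch : ch != [::] -> fill (SNode l ch) = SNode l (map fill ch).
Proof. by case: ch. Qed.

Lemma lflags_node l ch : ch != [::] -> lflags (SNode l ch) = flatten (map lflags ch).
Proof. by case: ch. Qed.

Lemma flz_node l ch : ch != [::] -> flz (SNode l ch) = all flz ch.
Proof. by case: ch. Qed.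

Lemma size_lflags s : size (lflags s) = size (leaves (fill s)).
Proof.
elim/stree_nested_ind: s => // l ch IH; have [->//|hch] := eqVneq ch [::].
rewrite lflags_node // fill_node // size_leaves_node size_flatten /shape -!map_comp.
by congr sumn; apply/eq_in_map => c hc; exact: IH.
Qed.

Lemma fill_inj a a' : flz a -> flz a' -> fill a = fill a' -> lflags a = lflags a' -> a = a'.
Proof.
elim/stree_nested_ind: a a' => [|l ch IH] [|l' ch'] //.
- by case: ch'.
- by case: ch {IH}.
have [->|hch] := eqVneq ch [::].
  by case: ch' => //= /eqP-> /eqP->.
have [->|hch'] := eqVneq ch' [::]; first by case: ch hch {IH}.
rewrite !flz_node // !fill_node // !lflags_node // => h h' [<-] e1 e2; congr SNode.
elim: ch ch' IH h h' e1 e2 {hch hch'} => [|c ch IHch] [|c' ch'] //= IH /andP[hc h] /andP[hc' h'] [ec e1] /eqP.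
rewrite eqseq_cat ?size_lflags ?ec // => /andP[/eqP e2 /eqP e3].
rewrite (IH c (mem_head _ _) c') // (IHch ch') // => x hx.
by apply: IH; rewrite inE hx orbT.
Qed.

Lemma map_cat_inv (A B : Type) (f : A -> B) s t1 x t2 : map f s = t1 ++ x :: t2 ->
  exists s1 y s2, [/\ s = s1 ++ y :: s2, map f s1 = t1, f y = x & map f s2 = t2].
Proof.
elim: t1 s => [|z t1 IH] [|y s] //=; first by case=> <- <-; exists [::], y, s.
by case=> <- /IH[s1 [w [s2 [-> <- <- <-]]]]; exists (y :: s1), w, s2.
Qed.

(** A flag never sits at an interior vertex of [s], so the contraction can be performed with the
    flags in place, and they keep their planar positions. *)
Lemma Cst_fill q rho s s' a : Cst q rho s s' -> (0 < q)%N -> fill a = s -> flz a ->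
  exists a', [/\ Cst q rho a a', fill a' = s', lflags a' = lflags a & flz a'].
Proof.
have node b l ch : fill b = SNode l ch -> exists2 cs, b = SNode l cs & cs != [::] /\ map fill cs = ch.
  by case: b => // l' [|c cs] //= [<- <-]; exists (c :: cs).
move=> h; elim: h a => {q rho s s'} [l ch1 ch ch2|q rho l ch1 c c' ch2 hC IH] a hq.
  case/node => cs -> [hcs em]; have [x1 [x [x2 [ecs e1 ex e2]]]] := map_cat_inv em.
  have [xs exs [hxs e3]] := node _ _ _ ex; rewrite exs in ecs.
  move=> hz; exists (SNode l (x1 ++ xs ++ x2)).
  have hne : x1 ++ xs ++ x2 != [::] by case: (x1) => //; case: (xs) hxs.
  split.
  - by rewrite ecs -e1 -e3 !size_map; constructor.
  - by rewrite fill_node // !map_cat e1 e2 e3.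
  - have e : flatten (map lflags (SNode 0 xs :: x2)) =
        flatten (map lflags xs) ++ flatten (map lflags x2).
      by rewrite -(lflags_node 0 hxs).
    by rewrite !lflags_node // ecs !map_cat !flatten_cat e.
  - have e : all flz (SNode 0 xs :: x2) = all flz xs && all flz x2.
      by rewrite -(flz_node 0 hxs).
    by move: hz; rewrite !flz_node // ecs !all_cat e.
case/node => cs -> [hcs em]; have [x1 [x [x2 [ecs e1 ex e2]]]] := map_cat_inv em => hz.
have hx : flz x.
  by move: hz; rewrite flz_node // ecs all_cat /= => /and3P[].
have [x' [h1 h2 h3 h4]] := IH x hq ex hx.
have hne y : x1 ++ y :: x2 != [::] by case: (x1).
exists (SNode l (x1 ++ x' :: x2)); split.
- by rewrite ecs -e1 size_map; constructor.
- by rewrite fill_node // map_cat /= e1 e2 h2.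
- by rewrite !lflags_node // ecs !map_cat !flatten_cat /= h3.
- by move: hz; rewrite !flz_node // ecs !all_cat /= h4 => /and3P[-> _ ->].
Qed.

Lemma sok_nonnil (l : R) ch : sok (SNode l ch) -> ch != [::].
Proof. by case: ch => //=; rewrite andbF. Qed.

Lemma lflags_sok s : sok s -> lflags s = map (fun=> false) (leaves s).
Proof.
elim/stree_nested_ind: s => // l ch IH hs; have hne := sok_nonnil hs.
have hch c : c \in ch -> sok c by case/and3P: hs => _ _ /allP; exact.
rewrite lflags_node //= /mapi map_flatten; congr flatten.
elim: ch 0%N IH hch {hne hs} => //= c ch IHch i IH hch.
rewrite (IHch i.+1); last 2 first.
- by move=> x hx; apply: IH; rewrite inE hx orbT.
- by move=> x hx; apply: hch; rewrite inE hx orbT.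
by rewrite -map_comp IH ?mem_head // hch ?mem_head.
Qed.

Lemma fill_sok s : sok s -> fill s = s.
Proof.
elim/stree_nested_ind: s => // l ch IH hs; rewrite fill_node ?(sok_nonnil hs) //.
case/and3P: hs => _ _ /allP hch; congr SNode; rewrite -[RHS]map_id.
by apply/eq_in_map => c hc; apply: IH => //; exact: hch.
Qed.

Lemma flz_sok s : sok s -> flz s.
Proof.
elim/stree_nested_ind: s => // l ch IH hs; rewrite flz_node ?(sok_nonnil hs) //.
by case/and3P: hs => _ _ /allP hch; apply/allP => c hc; apply: IH => //; exact: hch.
Qed.

Lemma sflag_spec lam s : sok s ->
  [/\ fill (sflag lam s) = s, flz (sflag lam s) &
      lflags (sflag lam s) = map (fun x => x == lam) (leaves s)].
Proof.
elim/stree_nested_ind: s lam => [|l ch IH] [|t lam] hs //.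
- by split => //=; rewrite eqxx.
- have -> : sflag [::] (SNode l ch) = SNode l ch by [].
  rewrite fill_sok // flz_sok // lflags_sok //; split=> //.
  apply/eq_in_map => x hx; apply/esym/eqP => e.
  by move: hx; rewrite e leaves_nilP.
have hne := sok_nonnil hs; case/and3P: hs => _ _ /allP hch.
have hne' : mapi (fun i c => if i == t then sflag lam c else c) ch != [::].
  by case: (ch) hne.
have -> : sflag (t :: lam) (SNode l ch) =
  SNode l (mapi (fun i c => if i == t then sflag lam c else c) ch) by [].
rewrite fill_node // flz_node // lflags_node //= /mapi.
suff H i : [/\ map fill (mapi_from (fun i c => if i == t then sflag lam c else c) i ch) = ch,
  all flz (mapi_from (fun i c => if i == t then sflag lam c else c) i ch) &
  flatten (map lflags (mapi_from (fun i c => if i == t then sflag lam c else c) i ch)) =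
  map (fun x => x == t :: lam) (flatten (mapi_from (fun t c => [seq t :: a | a <- leaves c]) i ch))].
  by have [-> -> ->] := H 0%N.
elim: ch i IH hch {hne hne'} => //= c ch IHch i IH hch.
have [|x hx|-> -> ->] := IHch i.+1; first by move=> x hx; apply: IH; rewrite inE hx orbT.
  by apply: hch; rewrite inE hx orbT.
have hc := hch c (mem_head _ _); have [k1 k2 k3] := IH c (mem_head _ _) lam hc.
rewrite map_cat -map_comp; case: eqP => [->|/eqP hit].
  rewrite k1 k2 k3; split=> //; congr (_ ++ _); apply: eq_map => x /=.
  by rewrite eqseq_cons eqxx.
rewrite fill_sok // flz_sok // lflags_sok //; split=> //; congr (_ ++ _).
by apply: eq_map => x /=; rewrite eqseq_cons (negbTE hit).
Qed.

Lemma lflags_nth i s : sok s -> (i < size (leaves s))%N ->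
  lflags (sflag (nth [::] (leaves s) i) s) = mkseq (eq_op^~ i) (size (leaves s)).
Proof.
move=> hs hi; have [_ _ ->] := sflag_spec (nth [::] (leaves s) i) hs.
apply: (@eq_from_nth _ false); rewrite size_map ?size_mkseq // => j hj.
by rewrite (nth_map [::]) // nth_mkseq // nth_uniq // leaves_uniq.
Qed.

(** The contraction changes addresses of leaves but not their planar order. So the leaf is specified
    by its index, and by [fill_inj] flagging it before or after contracting gives the same tree. *)
Lemma Cst_sflag q rho (s s' : stree R) i : sok s -> sok s' -> (0 < q)%N -> Cst q rho s s' ->
  (i < size (leaves s))%N -> size (leaves s) = size (leaves s') ->
  Cst q rho (sflag (nth [::] (leaves s) i) s) (sflag (nth [::] (leaves s') i) s').
Proof.
move=> hs hs' hq hC hi e.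
have [k1 k2 _] := sflag_spec (nth [::] (leaves s) i) hs.
have [k1' k2' _] := sflag_spec (nth [::] (leaves s') i) hs'.
have [a' [h1 h2 h3 h4]] := Cst_fill hC hq k1 k2.
rewrite (_ : sflag _ s' = a') //; apply: fill_inj => //; first by rewrite h2.
by rewrite h3 !lflags_nth -?e.
Qed.

End FlaggedContraction.

(** * Forgetting respects the equivalence *)

Section ForgetSteps.
Variable R : realType.
Notation tp := (tpair R unit).

Definition valid n (x : tp) := wf x /\ map size (groups x.1 x.2) = n.

(** Validity is recorded at both ends because [W_equiv] is generated on [mtp n]: every intermediate
    pair of a chain has to be a point of it. *)
Definition vstep n (x y : tp) := [/\ valid n x, valid n y & W_step x y].

Definition vsteps n := clos_refl_trans tp (vstep n).

Lemma step1_valid n b b' s : step1 b b' -> valid n (b, s) -> valid n (b', s).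
Proof.
move=> h [[/= h1 h2 h3 h4] h5]; have [h6 _] := step1_nice h h2; split.
  by split=> //=; rewrite (step1_head h).
by move: h5; rewrite !groupsE /= (step1_lab h).
Qed.

Lemma steps_vsteps n b b' s : steps b b' -> valid n (b, s) ->
  vsteps n (b, s) (b', s) /\ valid n (b', s).
Proof.
move=> h; elim: h => {b b'} [b b' h|b|b1 b2 b3 _ IH1 _ IH2] hv.
- have hv' := step1_valid h hv; split=> //; apply: rt_step; split=> //.
  by case: h => h; [apply: Or31 | apply: Or32].
- by split=> //; exact: rt_refl.
have [h1 h2] := IH1 hv; have [h3 h4] := IH2 h2.
by split=> //; exact: rt_trans h1 h3.
Qed.

Definition nz (n : seq nat) := [seq k <- n | k != 0%N].

Definition rm0 (n : seq nat) := take (find (pred1 0%N) n) n ++ drop (find (pred1 0%N) n).+1 n.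

Lemma find_nilp (T : Type) (g : seq (seq T)) : find (@nilp T) g = find (pred1 0%N) (map size g).
Proof. by rewrite find_map; apply: eq_find. Qed.

Lemma has_nilp (T : Type) (g : seq (seq T)) : has (@nilp T) g = has (pred1 0%N) (map size g).
Proof. by rewrite has_map; apply: eq_has. Qed.

Lemma count_nilp (T : Type) (g : seq (seq T)) : count (@nilp T) g = count (pred1 0%N) (map size g).
Proof. by rewrite count_map; apply: eq_count. Qed.

Lemma forget1_valid n x : has (pred1 0%N) n -> valid n x -> valid (rm0 n) (forget1 x).
Proof.
move=> hn [hx e]; have hn' : has (@nilp unit) (groups x.1 x.2) by rewrite has_nilp e.
have [h1 h2] := forget1_spec hx hn'; split=> //.
by rewrite h2 /= map_cat map_take map_drop find_nilp e.
Qed.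

Lemma forget1_vstep n x y : has (pred1 0%N) n -> vstep n x y ->
  vsteps (rm0 n) (forget1 x) (forget1 y).
Proof.
move=> hn [hx hy hst].
have hvx := forget1_valid hn hx; have hvy := forget1_valid hn hy.
have [wx ex] := hx; have [wy ey] := hy.
have hnx : has (@nilp unit) (groups x.1 x.2) by rewrite has_nilp ex.
have hny : has (@nilp unit) (groups y.1 y.2) by rewrite has_nilp ey.
have [s1 [p1 o1 e1]] := forget1E wx hnx; have [s2 [p2 o2 e2]] := forget1E wy hny.
have [_ _ lx] := nil_leafP wx hnx; have [_ _ ly] := nil_leafP wy hny.
have [sx ox _ _] := wx; have [sy oy _ _] := wy.
have lenx := lenok_sflag (nil_leaf x) (sok_lenok sx).
have AB : step1 x.1 y.1 -> x.2 = y.2 -> vsteps (rm0 n) (forget1 x) (forget1 y).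
  move=> h es.
  have elam : nil_leaf x = nil_leaf y.
    by rewrite /nil_leaf !groupsE (step1_lab h) es.
  have es12 : s2 = s1 by move: p2; rewrite -elam -es p1 => -[].
  rewrite e1 e2 es12 in hvx *; apply: (steps_vsteps _ hvx).1.
  rewrite -elam -es !broot_rlen; apply: steps_rlen.
  by apply: step1_prune h _ lenx; exact: over_sflag.
case: hst => [[h es]|[h es]|hC]; [by apply: AB => //; left | by apply: AB => //; right |].
(* Both group sizes are [n], so the leaf to be forgotten has the same index on both sides, though
   (c) may have changed its address. *)
have ei : find (@nilp unit) (groups x.1 x.2) = find (@nilp unit) (groups y.1 y.2).
  by rewrite !find_nilp ex ey.
have esz : size (leaves x.2) = size (leaves y.2).
  by move: (congr1 size ex) (congr1 size ey); rewrite !groupsE !size_map => -> ->.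
case: hC ei esz sx ox sy oy lx ly p1 p2 e1 e2 lenx hvx hvy hnx {AB ex ey hx hy wx wy hny o1 o2}.
move=> b s rho ch hr hs hz ei esz sx ox sy oy lx ly p1 p2 e1 e2 lenx hvx hvy hnx.
set lam := nil_leaf (b, s) in p1 lx e1 lenx *.
have hq : (1 < size ch)%N by apply: (sok_sstable sx hs).
have hC := ssub_Cst hr hs.
have hi : (find (@nilp unit) (groups b s) < size (leaves s))%N.
  by move: hnx; rewrite has_find groupsE size_map.
have := Cst_sflag sx sy (ltnW hq) hC hi esz.
have -> : nth [::] (leaves s) (find (@nilp unit) (groups b s)) = lam by [].
set y0 := (bcontract _ _ _, _) in ei p2 ly e2 *.
have -> : nth [::] (leaves (scontract rho s)) (find (@nilp unit) (groups b s)) = nil_leaf y0.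
  by rewrite [find _ _]ei.
set lam' := nil_leaf y0 in p2 ly e2 *.
move=> hC'; rewrite [(_, _).1]/= [(_, _).2]/= in p1 p2 lenx e1 e2 ox lx *.
have ho := over_sflag ox lx; have hzo := zpremise_zover hz.
(* Either the edge is lost and only steps (a), (b) are left, or a single step (c) is left, at a
   possibly different address. *)
case: (Cst_prune hC' hq lenx) => [[ep h]|[q' [rho' [t1 [t2 [ep1 ep2 hC2 h]]]]]].
  have es12 : s2 = s1 by move: p2; rewrite -ep p1 => -[].
  rewrite e1 e2 es12 in hvx *; apply: (steps_vsteps _ hvx).1.
  by rewrite !broot_rlen; apply: steps_rlen; exact: h.
have es1 : s1 = t1 by move: ep1; rewrite p1 => -[].
have es2 : s2 = t2 by move: ep2; rewrite p2 => -[].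
have [h1 h2] := h b ho hzo.
apply: rt_step; split=> //; apply: Or33; rewrite e1 e2 es1 es2 h1.
have hr' := Cst_nonnil hC2.
have [es' [ch' hs' <-]] := CstP (Cst_sroot hC2).
rewrite !broot_rlen -bcontract_rlen es'; constructor=> //.
by apply: zover_zpremise; rewrite zover_rlen.
Qed.

Lemma rm0_filter n : has (pred1 0%N) n -> nz (rm0 n) = nz n /\
  count (pred1 0%N) n = (count (pred1 0%N) (rm0 n)).+1.
Proof.
rewrite /rm0 /nz; elim: n => //= k n IH; have [->|hk] := eqVneq k 0%N; rewrite /= ?drop0 //.
by move=> /IH[h1 h2]; rewrite hk (negbTE hk) h1 h2.
Qed.

Lemma iter_forget1_vsteps k n x y : count (pred1 0%N) n = k -> vsteps n x y ->
  vsteps (nz n) (iter k (@forget1 R unit) x) (iter k (@forget1 R unit) y).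
Proof.
elim: k n x y => [|k IH] n x y e h.
  rewrite (_ : nz n = n) //; apply/all_filterP; rewrite all_predC has_count e //.
have hn : has (pred1 0%N) n by rewrite has_count e.
have [h1 h2] := rm0_filter hn; rewrite !iterSr -h1; apply: IH.
  by move: e; rewrite h2 => -[].
elim: h => {x y} [x y|x|x y z _ h3 _ h4]; first exact: forget1_vstep.
  exact: rt_refl.
exact: rt_trans h3 h4.
Qed.

Lemma forget_vstep n x y : vstep n x y ->
  vsteps (nz n) (forget x) (forget y).
Proof.
move=> h; have [[_ ex] [_ ey] _] := h.
rewrite /forget !count_nilp ex ey; apply: iter_forget1_vsteps => //.
exact: rt_step.
Qed.

Lemma forget_valid n x : valid n x -> valid (nz n) (forget x).
Proof.
move=> [hx <-]; have [h1 h2] := forget_spec hx; split=> //.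
rewrite h2 /nz; elim: (groups x.1 x.2) => //= -[|u g] gs IH //=.
by rewrite IH.
Qed.

End ForgetSteps.

(** * Dependence on the shape alone *)

Section Shapes.
Variables (L L' M M' : Type) (g : L -> L') (h : M -> M').

Lemma marks_bmap (b : btree L M) :
  marks (bmap g h b) = [seq (p.1, h p.2) | p <- marks b].
Proof.
elim/btree_nested_ind: b => // l ss IH; rewrite /= size_map map_flatten mapi_map.
rewrite map_mapi; congr flatten; apply: eq_in_mapi => t s1 hs1.
set f := fun p => (_ ++ p.1, p.2); set f' := fun p => (_ ++ p.1, p.2).
have -> : flatten (map (@marks L' M') (map (bmap g h) s1)) =
    map (fun p => (p.1, h p.2)) (flatten (map (@marks L M) s1)).
  rewrite map_flatten -!map_comp; congr flatten; apply/eq_in_map => x hx /=.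
  exact: IH hs1 hx.
by rewrite -!map_comp.
Qed.

Lemma leaves_smapE (s : stree L) : leaves (smap g s) = leaves s.
Proof.
elim/stree_nested_ind: s => // l ch IH; rewrite /= mapi_map; congr flatten.
by apply: eq_in_mapi => i c hc; rewrite IH.
Qed.

Lemma groups_mapE (b : btree L M) (s : stree L) :
  groups (bmap g h b) (smap g s) = map (map h) (groups b s).
Proof.
rewrite /groups leaves_smapE -map_comp; apply: eq_map => lam /=.
by rewrite marks_bmap filter_map -!map_comp.
Qed.

End Shapes.

Lemma all2_catE (A B : Type) (p : A -> B -> bool) s1 s2 t1 t2 : size s1 = size t1 ->
  all2 p (s1 ++ s2) (t1 ++ t2) = all2 p s1 t1 && all2 p s2 t2.
Proof. by elim: s1 t1 => [|x s1 IH] [|y t1] //= [/IH->]; rewrite andbA. Qed.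

Lemma all2_catI (A B : Type) (p : A -> B -> bool) s1 s2 t1 t2 :
  all2 p s1 t1 -> all2 p s2 t2 -> all2 p (s1 ++ s2) (t1 ++ t2).
Proof. by elim: s1 t1 => [|x s1 IH] [|y t1] //= /andP[-> h] h2; exact: IH. Qed.

(** * Relational invariance of forgetting *)

Section Relations.
Variables (R : realType) (M : Type) (rel : R -> R -> bool).
Hypothesis rel0 : rel 0 0.
Hypothesis rel_max : forall x x' y y', rel x x' -> rel y y' ->
  rel (Num.max x y) (Num.max x' y').

(** Equal shape with lengths related by [rel]. Forgetting uses only 0 and [Num.max] on lengths, so
    it preserves every [rel] compatible with these. Two relations are used: the diagonal of a set of
    values, and being at distance at most e, for continuity. *)
Fixpoint srel (s s' : stree R) : bool :=
  match s, s' with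
  | SLeaf, SLeaf => true
  | SNode l ch, SNode l' ch' => rel l l' && all2 srel ch ch'
  | _, _ => false
  end.

Fixpoint brel (b b' : btree R M) : bool :=
  match b, b' with
  | Mark _, Mark _ => true
  | Comp l ss, Comp l' ss' => rel l l' && all2 (all2 brel) ss ss'
  | _, _ => false
  end.

Lemma all2_size (A B : Type) (p : A -> B -> bool) s t : all2 p s t -> size s = size t.
Proof. by elim: s t => [|x s IH] [|y t] //= /andP[_ /IH->]. Qed.

Lemma all2_map_in (A B A' B' : Type) (p : A -> B -> bool) (p' : A' -> B' -> bool)
    (f : A -> A') (f' : B -> B') s t :
  (forall x y, List.In x s -> p x y -> p' (f x) (f' y)) -> all2 p s t ->
  all2 p' (map f s) (map f' t).
Proof.
elim: s t => [|x s IH] [|y t] //= h /andP[h1 h2].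
by rewrite h //; [apply: IH => // z w hz; apply: h; right | left].
Qed.

Lemma mem_In (A : eqType) (x : A) s : List.In x s -> x \in s.
Proof. by elim: s => //= y s IH [->|/IH h]; rewrite inE ?eqxx // h orbT. Qed.

Lemma all2_mapi (A B : eqType) (A' B' : Type) (p : A -> B -> bool) (p' : A' -> B' -> bool)
    (f : nat -> A -> A') (f' : nat -> B -> B') s t :
  (forall i x y, x \in s -> p x y -> p' (f i x) (f' i y)) -> all2 p s t ->
  all2 p' (mapi f s) (mapi f' t).
Proof.
rewrite /mapi; elim: s t 0%N => [|x s IH] [|y t] i //= h /andP[h1 h2].
by rewrite h ?mem_head //=; apply: IH => // j z w hz; apply: h; rewrite inE hz orbT.
Qed.

Lemma all2_mapm (A B : eqType) (A' B' : Type) (p : A -> B -> bool) (p' : A' -> B' -> bool)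
    (f : A -> A') (f' : B -> B') s t :
  (forall x y, x \in s -> p x y -> p' (f x) (f' y)) -> all2 p s t ->
  all2 p' (map f s) (map f' t).
Proof. by move=> h; apply: all2_map_in => x y /mem_In; exact: h. Qed.

Lemma all2_remove_at (A B : Type) (p : A -> B -> bool) i s t : all2 p s t ->
  all2 p (remove_at i s) (remove_at i t).
Proof.
rewrite /remove_at; elim: s t i => [|x s IH] [|y t] [|i] //=.
  by rewrite !drop0 => /andP[].
by move=> /andP[h1 h2]; rewrite h1; exact: IH.
Qed.

Lemma srel_delete lam s s' : srel s s' -> srel (sdelete lam s) (sdelete lam s').
Proof.
elim/stree_nested_ind: s s' lam => [|l ch IH] [|l' ch'] // lam; first by case: lam => [|? []].
move=> /andP[hl h]; case: lam => [|t [|u lam]]; first by apply/andP.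
  by apply/andP; split=> //; exact: all2_remove_at.
pose F (i : nat) (c : stree R) := if i == t then sdelete (u :: lam) c else c.
change (rel l l' && all2 srel (mapi F ch) (mapi F ch')); rewrite hl /=.
by apply: (@all2_mapi _ _ _ _ srel srel F F _ _ _ h) => i x y hx hxy; rewrite /F;
  case: ifP => // _; exact: IH.
Qed.

Lemma brel_delete lam b b' : brel b b' -> brel (bdelete lam b) (bdelete lam b').
Proof.
elim/btree_nested_ind: b b' lam => [m|l ss IH] [m'|l' ss'] // lam /= /andP[hl h].
rewrite -(all2_size h).
have hs f : (forall x y s1, s1 \in ss -> x \in s1 -> brel x y -> brel (f x) (f y)) ->
    all2 (all2 brel) (map (map f) ss) (map (map f) ss').
  move=> hf; apply: (all2_mapm _ h) => s1 s1' hs1 h1.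
  by apply: (all2_mapm _ h1) => x y hx; exact: hf hs1 hx.
case: ifP => _; last by rewrite /= hl; apply: hs => x y s1 hs1 hx; exact: IH hs1 hx _ _.
case: lam => [|t [|u lam]] /=; rewrite hl //=; first exact: all2_remove_at.
apply: (all2_mapi _ h) => i s1 s1' hs1 h1; case: ifP => // _.
by apply: (all2_mapm _ h1) => x y hx; exact: IH hs1 hx _ _.
Qed.

Lemma srel_raise l l' s s' : rel l l' -> srel s s' -> srel (sraise l s) (sraise l' s').
Proof. by case: s s' => [|k ch] [|k' ch'] //= hl /andP[hk ->]; rewrite rel_max. Qed.

Lemma brel_raise l l' b b' : rel l l' -> brel b b' -> brel (braise l b) (braise l' b').
Proof. by case: b b' => [m|k ch] [m'|k' ch'] //= hl /andP[hk ->]; rewrite rel_max. Qed.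

Lemma srel_restab s s' : srel s s' -> srel (srestab s) (srestab s').
Proof.
elim/stree_nested_ind: s s' => [|l ch IH] [|l' ch'] // /andP[hl h].
have : all2 srel (map (@srestab R) ch) (map (@srestab R) ch').
  by apply: (all2_mapm _ h) => x y hx; exact: IH.
rewrite /=; case: (map _ ch) (map _ ch') => [|c [|c1 d]] [|c' [|c1' d']] //=; rewrite ?hl //=.
- by rewrite andbT; exact: srel_raise.
- by rewrite andbF.
- by rewrite andbF.
Qed.

Lemma brel_restab b b' : brel b b' -> brel (brestab b) (brestab b').
Proof.
elim/btree_nested_ind: b b' => [m|l ss IH] [m'|l' ss'] // /andP[hl h].
have : all2 (all2 brel) (map (map (@brestab R M)) ss) (map (map (@brestab R M)) ss').
  apply: (all2_mapm _ h) => s1 s1' hs1 h1.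
  by apply: (all2_mapm _ h1) => x y hx; exact: IH hs1 hx _.
rewrite !brestabE; move: (map _ ss) (map _ ss') => X X' hX.
have : brel (Comp l X) (Comp l' X') by rewrite /= hl.
case: X X' hX => [|[|x [|y X0]] [|X1 X]] [|[|x' [|y' X0']] [|X1' X']] //=; rewrite ?andbF //.
by rewrite !andbT => hx _; exact: brel_raise.
Qed.

Lemma srel_root s s' : srel s s' -> srel (sroot s) (sroot s').
Proof. by case: s s' => [|k ch] [|k' ch'] //= /andP[_ ->]; rewrite rel0. Qed.

Lemma brel_root b b' : brel b b' -> brel (broot b) (broot b').
Proof. by case: b b' => [m|k ch] [m'|k' ch'] //= /andP[_ ->]; rewrite rel0. Qed.

Lemma srel_shape s s' : srel s s' -> smap (fun=> tt) s = smap (fun=> tt) s'.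
Proof.
elim/stree_nested_ind: s s' => [|l ch IH] [|l' ch'] //= /andP[_ h]; congr SNode.
elim: ch ch' IH h => [|c ch IHch] [|c' ch'] //= IH /andP[hc h].
by rewrite (IH c (mem_head _ _) c') // (IHch ch') // => x hx; apply: IH; rewrite inE hx orbT.
Qed.

Lemma brel_shape b b' : brel b b' ->
  bmap (fun=> tt) (fun=> tt) b = bmap (fun=> tt) (fun=> tt) b'.
Proof.
elim/btree_nested_ind: b b' => [m|l ss IH] [m'|l' ss'] //= /andP[_ h]; congr Comp.
elim: ss ss' IH h => [|s1 ss IHss] [|s1' ss'] //= IH /andP[h1 h]; congr cons; last first.
  by apply: IHss => // t c ht; apply: IH; rewrite inE ht orbT.
elim: s1 s1' {IHss h} IH h1 => [|x s1 IHs] [|x' s1'] //= IH /andP[hx h].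
rewrite (IH _ x (mem_head _ _) (mem_head _ _) x') // (IHs s1') // => t c.
rewrite inE => /orP[/eqP->|ht] hc.
  by apply: (IH (x :: s1)); rewrite inE ?eqxx // hc orbT.
by apply: (IH t) => //; rewrite inE ht orbT.
Qed.

Lemma rel_groups b b' s s' : brel b b' -> srel s s' ->
  map size (groups b s) = map size (groups b' s').
Proof.
move=> /brel_shape hb /srel_shape hs.
have sz (T T' : Type) (f : T -> T') G : map size (map (map f) G) = map size G.
  by rewrite -map_comp; apply: eq_map => u; exact: size_map.
rewrite -(sz _ _ (fun=> tt) (groups b s)) -(groups_mapE (fun=> tt) (fun=> tt)) hb hs.
by rewrite groups_mapE sz.
Qed.

Definition prel (x x' : tpair R M) := brel x.1 x'.1 && srel x.2 x'.2.

(** The leaf to be forgotten is determined by the shape, so the same one is deleted on both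
    sides. *)
Lemma forget1_rel x x' : prel x x' -> prel (forget1 x) (forget1 x').
Proof.
move=> /andP[hb hs]; rewrite /forget1.
have hlam : nth [::] (leaves x.2) (find (@nilp M) (groups x.1 x.2)) =
    nth [::] (leaves x'.2) (find (@nilp M) (groups x'.1 x'.2)).
  rewrite !find_nilp (rel_groups hb hs).
  by rewrite -(leaves_smapE (fun=> tt) x.2) (srel_shape hs) leaves_smapE.
rewrite hlam; apply/andP; split.
  by apply: brel_root; apply: brel_restab; exact: brel_delete.
by apply: srel_root; apply: srel_restab; exact: srel_delete.
Qed.

Lemma forget_rel x x' : prel x x' -> prel (forget x) (forget x').
Proof.
move=> h; have /andP[hb hs] := h; rewrite /forget !count_nilp (rel_groups hb hs).
elim: (count _ _) => //= k IH; exact: forget1_rel.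
Qed.

Lemma srel_slens s s' : srel s s' -> all2 rel (slens s) (slens s').
Proof.
elim/stree_nested_ind: s s' => [|l ch IH] [|l' ch'] //= /andP[-> h] /=.
elim: ch ch' IH h => [|c ch IHch] [|c' ch'] //= IH /andP[hc h]; apply: all2_catI.
  by apply: IH; rewrite ?mem_head.
by apply: IHch => // x hx; apply: IH; rewrite inE hx orbT.
Qed.

Lemma brel_blens b b' : brel b b' -> all2 rel (blens b) (blens b').
Proof.
elim/btree_nested_ind: b b' => [m|l ss IH] [m'|l' ss'] //= /andP[-> h] /=.
elim: ss ss' IH h => [|s1 ss IHss] [|s1' ss'] //= IH /andP[h1 h]; apply: all2_catI; last first.
  by apply: IHss => // t c ht; apply: IH; rewrite inE ht orbT.
elim: s1 s1' {IHss h} IH h1 => [|x s1 IHs] [|x' s1'] //= IH /andP[hx h]; apply: all2_catI.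
  by apply: (IH (x :: s1)); rewrite ?mem_head.
apply: IHs => // t c; rewrite inE => /orP[/eqP->|ht] hc.
  by apply: (IH (x :: s1)); rewrite inE ?eqxx // hc orbT.
by apply: (IH t) => //; rewrite inE ht orbT.
Qed.

Lemma shape_srel s s' : smap (fun=> tt) s = smap (fun=> tt) s' ->
  all2 rel (slens s) (slens s') -> srel s s'.
Proof.
have sz (u u' : stree R) : smap (fun=> tt) u = smap (fun=> tt) u' -> size (slens u) = size (slens u').
  elim/stree_nested_ind: u u' => [|l ch IH] [|l' ch'] //= [e]; congr S.
  elim: ch ch' IH e => [|c ch IHch] [|c' ch'] //= IH [ec e]; rewrite !size_cat.
  rewrite (IH c (mem_head _ _) c') // (IHch ch') // => x hx.
  by apply: IH; rewrite inE hx orbT.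
elim/stree_nested_ind: s s' => [|l ch IH] [|l' ch'] //= [e] /andP[-> /=].
elim: ch ch' IH e => [|c ch IHch] [|c' ch'] //= IH [ec e].
rewrite all2_catE ?(sz c c') // => /andP[h1 h2]; rewrite IH ?mem_head //=.
by apply: IHch => // x hx; apply: IH; rewrite inE hx orbT.
Qed.

Lemma shape_brel b b' : bmap (fun=> tt) (fun=> tt) b = bmap (fun=> tt) (fun=> tt) b' ->
  all2 rel (blens b) (blens b') -> brel b b'.
Proof.
pose tts := bmap (fun _ : R => tt) (fun _ : M => tt).
pose sl (s1 : seq (btree R M)) := flatten (map (@blens R M) s1).
have szs (s1 s1' : seq (btree R M)) : (forall x y, x \in s1 -> tts x = tts y -> size (blens x) = size (blens y)) ->
    map tts s1 = map tts s1' -> size (sl s1) = size (sl s1').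
  rewrite /sl; elim: s1 s1' => [|x s1 IHs] [|x' s1'] //= h [hx e]; rewrite !size_cat.
  rewrite (h x x') ?mem_head // (IHs s1') // => y z hy; apply: h; by rewrite inE hy orbT.
have sz (u u' : btree R M) : tts u = tts u' -> size (blens u) = size (blens u').
  elim/btree_nested_ind: u u' => [m|l ss IH] [m'|l' ss'] //= [e]; congr S.
  elim: ss ss' IH e => [|s1 ss IHss] [|s1' ss'] //= IH [e1 e]; rewrite !size_cat.
  rewrite (IHss ss') //; last by move=> t c ht; apply: IH; rewrite inE ht orbT.
  congr addn; apply: szs e1 => x y hx; exact: IH (mem_head _ _) hx y.
elim/btree_nested_ind: b b' => [m|l ss IH] [m'|l' ss'] //= [e] /andP[-> /=].
elim: ss ss' IH e => [|s1 ss IHss] [|s1' ss'] //= IH [e1 e].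
rewrite all2_catE; last by apply: szs e1 => x y _; exact: sz.
case/andP=> h1 h2; apply/andP; split; last first.
  by apply: IHss => // t c ht; apply: IH; rewrite inE ht orbT.
elim: s1 s1' {IHss h2 e} IH e1 h1 => [|x s1 IHs] [|x' s1'] //= IH [ex e1].
rewrite all2_catE ?(sz x x') // => /andP[hx h].
rewrite (IH (x :: s1)) ?mem_head //=.
apply: IHs => // t c; rewrite inE => /orP[/eqP->|ht] hc.
  by apply: (IH (x :: s1)); rewrite inE ?eqxx // hc orbT.
by apply: (IH t) => //; rewrite inE ht orbT.
Qed.

End Relations.

Section LengthPredicates.
Variables (R : realType) (M : Type) (S : pred R).
Hypothesis S0 : S 0.

Definition lens_in (x : tpair R M) := all S (blens x.1) && all S (slens x.2).

(** A maximum is one of its arguments, so the diagonal of [S] is compatible with [Num.max]; the pair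
    is compared with itself. *)
Lemma lens_in_forget x : lens_in x -> lens_in (forget x).
Proof.
pose rel (a b : R) := (a == b) && S a.
have diag t : all2 rel t t = all S t by elim: t => //= a t ->; rewrite /rel eqxx.
have rel0 : rel 0 0 by rewrite /rel eqxx S0.
have relm a a' b b' : rel a a' -> rel b b' -> rel (Num.max a b) (Num.max a' b').
  by move=> /andP[/eqP<- h] /andP[/eqP<- h']; rewrite /rel eqxx; case: (leP a b).
move=> /andP[h1 h2].
have hp : prel rel x x.
  by apply/andP; split; [apply: shape_brel | apply: shape_srel]; rewrite ?diag.
have /andP[/brel_blens + /srel_slens] := forget_rel rel0 relm hp.
by rewrite /lens_in !diag => -> ->.
Qed.

End LengthPredicates.

(** * Decorated data and the cutting map *)

Section AllLabels.
Variables (R : realType) (M : eqType).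
Implicit Type b : btree R M.

Fixpoint blabels b : seq M :=
  match b with
  | Mark m => [:: m]
  | Comp _ ss => flatten [seq flatten [seq blabels c | c <- s1] | s1 <- ss]
  end.

Lemma perm_flatten_map_cat (T : Type) (F G : T -> seq M) (t : seq T) :
  perm_eq (flatten [seq F x ++ G x | x <- t]) (flatten (map F t) ++ flatten (map G t)).
Proof.
elim: t => //= x t IH; rewrite -!catA perm_cat2l.
by rewrite (perm_trans (perm_cat (perm_refl _) IH)) // perm_catCA.
Qed.

Lemma perm_lgroups (s1 : seq (btree R M)) (c : stree R) :
  perm_eq (flatten (lgroups s1 c)) (flatten [seq flatten (groups x c) | x <- s1]).
Proof.
rewrite /lgroups; elim: s1 => [|x s1 IH] /=.
  by elim: (leaves c).
rewrite (perm_trans (perm_flatten_map_cat (lab x) (labs s1) (leaves c))) //.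
by rewrite groupsE perm_cat2l.
Qed.

Lemma perm_flatten_map (T : eqType) (F G : T -> seq M) (t : seq T) :
  (forall x, x \in t -> perm_eq (F x) (G x)) ->
  perm_eq (flatten (map F t)) (flatten (map G t)).
Proof.
elim: t => //= x t IH h; apply: perm_cat; first by apply: h; rewrite mem_head.
by apply: IH => y hy; apply: h; rewrite inE hy orbT.
Qed.

(** [groups] lists labels leaf by leaf, [blabels] in planar order. They differ since several members
    of one seam share the leaves above it; coherence ensures that no label is missed. *)
Lemma perm_groups_labels s b : over s b -> perm_eq (flatten (groups b s)) (blabels b).
Proof.
move: s b; apply: over_ind => [m|s l s1 _ _ _ _ IH|l0 ch l ss _ h _ e IH]; first by [].
  rewrite groups_V1 (perm_trans (perm_lgroups _ _)) //= cats0.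
  by apply: perm_flatten_map.
rewrite groups_V2 // /lgroups2 map2E.
have -> : flatten (flatten [seq lgroups p.1 p.2 | p <- zip ss ch]) =
    flatten [seq flatten (lgroups p.1 p.2) | p <- zip ss ch].
  by elim: (zip ss ch) => //= p z IHz; rewrite flatten_cat IHz.
have -> : blabels (Comp l ss) = flatten [seq flatten (map blabels p.1) | p <- zip ss ch].
  rewrite /=; elim: ss ch e {IH h} => [|s1 ss IHs] [|c ch] //= [e].
  by rewrite (IHs ch).
apply: perm_flatten_map => p hp; rewrite (perm_trans (perm_lgroups _ _)) //.
by apply: perm_flatten_map => x hx; have [] := IH p hp x hx.
Qed.

Lemma over_has_label s b : over s b -> (0 < size (blabels b))%N.
Proof.
move: s b; apply: over_ind => [//|s l [|x s1] //= _ _ _ _ IH|l0 ch l ss _ h hne e IH].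
  by rewrite cats0 size_cat ltn_addr // IH // mem_head.
have [s1 hs1] := hasP hne; case: s1 hs1 => // x s1 hs1 _.
have ht : (index (x :: s1) ss < size ss)%N by rewrite index_mem.
have [|_ _] := IH _ (mem_zip_nth [::] SLeaf e ht) x; first by rewrite /= nth_index ?mem_head.
case ex : (blabels x) => [|m t] // _.
have : m \in blabels (Comp l ss).
  apply/flatten_mapP; exists (x :: s1) => //.
  apply/flatten_mapP; exists x; rewrite ?mem_head //.
  by change (m \in blabels x); rewrite ex mem_head.
by case: (blabels (Comp l ss)).
Qed.

Lemma size_flatten_ge (T : Type) (t : seq (seq T)) : all (fun g => ~~ nilp g) t ->
  (size t <= size (flatten t))%N.
Proof.
elim: t => //= g t IH /andP[hg /IH h]; rewrite size_cat -add1n leq_add //.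
by case: g hg.
Qed.

Lemma sok_leaves (s : stree R) : sok s -> (0 < size (leaves s))%N /\
  (~~ isleaf s -> 1 < size (leaves s))%N.
Proof.
elim/stree_nested_ind: s => // l ch IH hs.
suff H : (size ch <= size (leaves (SNode l ch)))%N.
  by have := H; case/and3P: hs => _ h _ h'; rewrite (leq_trans h h') (leq_trans (ltnW h) h').
have {}hs c : c \in ch -> sok c by case/and3P: hs => _ _ /allP; exact.
rewrite size_leaves_node; elim: ch IH hs => //= c ch IHch IH hs; rewrite -add1n leq_add //.
  by apply: (IH c _ _).1; rewrite ?mem_head // hs ?mem_head.
apply: IHch => [x hx|x hx]; first by apply: IH; rewrite inE hx orbT.
by apply: hs; rewrite inE hx orbT.
Qed.

(** An interior seam tree has two leaves with nonempty groups; over a leaf the vertex is in V_comp^1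
    and has two members, each with a label. This gives the stability of data. *)
Lemma two_labels s l ss : sok s -> over s (Comp l ss : btree R M) ->
  all (fun g => ~~ nilp g) (groups (Comp l ss) s) ->
  (1 < size (flatten (groups (Comp l ss) s)))%N.
Proof.
move=> hs ho hg; case hl: (isleaf s); last first.
  apply: leq_trans (size_flatten_ge hg); rewrite groupsE size_map.
  by apply: (sok_leaves hs).2; rewrite hl.
rewrite (perm_size (perm_groups_labels ho)).
move=> {hs hg}; case: s hl ho => // _.
case: ss => [|s1 [|]] //=; rewrite ?andbF //= cats0 => /and4P[_ h1 /allP h2 _].
case: s1 h1 h2 => [|x [|y s1]] //= _ h2; rewrite !size_cat.
have hx := over_has_label (h2 x (mem_head _ _)).
have hy : (0 < size (blabels y))%N by apply: (over_has_label (s := SLeaf)); apply: h2; rewrite !inE eqxx orbT.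
by lia.
Qed.

End AllLabels.

HB.instance Definition _ (R : realType) := gen_eqMixin (gjm R).

(** * Decorated data with valid tree-pairs *)

Section ValidDecorations.
Variables (R : realType) (S : pred R).

(** [S] holds for all lengths, so that the values of the lengths can be traced
    through [forget] and [q_map]. *)
Inductive vgjm : gjm R -> Prop :=
| VLeaf i : vgjm (MLeaf R i)
| VNode l ss s : wf (Comp l ss, s) -> lens_in S (Comp l ss, s) ->
    all (fun g => ~~ nilp g) (groups (Comp l ss) s) ->
    (forall g m, g \in groups (Comp l ss) s -> m \in g -> vgjm m) ->
    vgjm (MNode (Comp l ss) s).

Lemma gjm_datumE (b : btree R (gjm R)) s :
  gjm_datum (MNode b s) = Node (map (map (@gjm_datum R)) (groups b s)).
Proof. by rewrite /= groups_bmap. Qed.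

Lemma gjm_pairsE (b : btree R (gjm R)) s : gjm_pairs (MNode b s) =
  (strip b, s) :: flatten [seq flatten (map (@gjm_pairs R) g) | g <- groups b s].
Proof. by rewrite /= groups_bmap -map_comp. Qed.

Lemma wf_strip (M : Type) (b : btree R M) s : wf (b, s) -> wf (strip b, s).
Proof.
case=> /= h1 h2 h3 h4; split=> //=; first by rewrite over_bmap.
by case: (b) h3.
Qed.

Lemma blens_bmap (M M' : Type) (h : M -> M') (b : btree R M) : blens (bmap id h b) = blens b.
Proof.
elim/btree_nested_ind: b => //= l ss IH; congr cons; rewrite -map_comp.
congr flatten; apply/eq_in_map => s1 hs /=; rewrite -map_comp; congr flatten.
by apply/eq_in_map => x hx /=; exact: IH hs hx.
Qed.

Lemma vgjm_pairs P : vgjm P -> forall x, x \in gjm_pairs P -> wf x /\ lens_in S x.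
Proof.
elim=> // l ss s hwf hS hg _ IH x; rewrite gjm_pairsE inE => /orP[/eqP->|].
  split; first exact: wf_strip.
  by move: hS; rewrite /lens_in [(_, _).1]/= -[blens (Comp l ss)](blens_bmap (fun=> tt)).
by case/flatten_mapP => g hgg /flatten_mapP[m hm]; exact: IH hgg hm x.
Qed.

Lemma vgjm_types P : vgjm P ->
  [seq map size (groups x.1 x.2) | x <- gjm_pairs P] = gj_types (gjm_datum P).
Proof.
elim=> // l ss s hwf hS hg _ IH; rewrite gjm_pairsE gjm_datumE.
rewrite map_cons [gj_types _]/=; congr (_ :: _).
  transitivity (map size (groups (bmap id (fun=> tt) (Comp l ss)) s)); first by [].
  rewrite groups_bmap -!map_comp; apply: eq_map => g /=; by rewrite !size_map.
move: (groups _ _) IH => G IH; rewrite map_flatten -!map_comp; congr flatten.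
apply/eq_in_map => g hgg /=; rewrite map_flatten -!map_comp; congr flatten; apply/eq_in_map => m hm /=.
exact: IH hgg hm.
Qed.

Lemma vgjm_stable P : vgjm P -> gj_stable (gjm_datum P).
Proof.
elim=> // l ss s hwf hS hg _ IH; rewrite gjm_datumE [gj_stable _]/=; apply/and3P; split.
- by rewrite all_map; apply: sub_all hg => g /=; rewrite size_map; case: g.
- rewrite -map_flatten size_map; case: hwf => /= h1 h2 _ _; exact: two_labels.
- rewrite all_map; apply/allP => g hgg /=; rewrite all_map; apply/allP => m hm /=.
  exact: IH hgg hm.
Qed.

Definition gjl (m : gjm R) := gj_leaves (gjm_datum m).

Lemma gjl_node b s : gjl (MNode b s) = flatten (map gjl (flatten (groups b s))).
Proof.
rewrite /gjl gjm_datumE [gj_leaves _]/= -map_comp map_flatten.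
elim: (groups b s) => //= g G ->; rewrite flatten_cat; congr (_ ++ _).
by rewrite -map_comp.
Qed.

Lemma gjl_mnode x : wf x -> gjl (mnode x) = flatten (map gjl (flatten (groups x.1 x.2))).
Proof.
case: x => [[m|l ss] s] [h1 h2 _ _]; last exact: gjl_node.
by case: s h2 {h1} => // _; rewrite /mnode /= cats0.
Qed.

Lemma flatten_filter_nil (T : Type) (t : seq (seq T)) :
  flatten [seq g <- t | ~~ nilp g] = flatten t.
Proof. by elim: t => //= -[|x g] t /= ->. Qed.

Hypothesis S0 : S 0.

(** If a single marked vertex is left, [mnode] returns its label, which is valid by hypothesis. The
    forgotten groups are empty, so no label is lost. *)
Lemma mnode_forget x : wf x -> lens_in S x ->
  (forall m, m \in flatten (groups x.1 x.2) -> vgjm m) ->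
  vgjm (mnode (forget x)) /\
  gjl (mnode (forget x)) = flatten (map gjl (flatten (groups x.1 x.2))).
Proof.
move=> hx hS hm; have [h1 h2] := forget_spec hx; split; last first.
  by rewrite gjl_mnode // h2 flatten_filter_nil.
have hm' g m : g \in groups (forget x).1 (forget x).2 -> m \in g -> vgjm m.
  move=> hg hmg; apply: hm; rewrite -flatten_filter_nil -h2.
  by apply/flattenP; exists g.
have h3 : all (fun g => ~~ nilp g) (groups (forget x).1 (forget x).2).
  by rewrite h2; exact: filter_all.
have h4 := lens_in_forget S0 hS.
case: (forget x) h1 h3 h4 hm' {h2} => [[m|l ss] s] h1 h3 h4 hm'.
  rewrite /mnode /=; case: h1 => /= _ h _ _.
  by case: s h h3 h4 hm' => // _ _ _ hm'; apply: (hm' [:: m]); rewrite mem_head.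
exact: VNode.
Qed.

Lemma vgjm_represents k P : vgjm P -> perm_eq (gj_leaves (gjm_datum P)) (iota 1 k) ->
  exists X : GJcoprod R k, represents P X.
Proof.
move=> hP hl.
have hT : gj_stable (gjm_datum P) && perm_eq (gj_leaves (gjm_datum P)) (iota 1 k).
  by rewrite vgjm_stable.
pose T : gj_data k := exist _ (gjm_datum P) hT.
have hsz : size (gjm_pairs P) = size (gj_types (val T)).
  by rewrite -[val T]/(gjm_datum P) -(vgjm_types hP) size_map.
have hv (v : gj_vert T) : exists y : mtp R (gj_type v), onth (gjm_pairs P) v = Some (raw y).
  have hvs : (v < size (gjm_pairs P))%N.
    by rewrite hsz; exact: ltn_ord.
  set x := nth (Mark tt, SLeaf) (gjm_pairs P) v.
  have [hx _] := vgjm_pairs hP (mem_nth (Mark tt, SLeaf) hvs).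
  have key (i : nat) : (i < size (gjm_pairs P))%N ->
      map size (groups (nth (Mark tt, SLeaf) (gjm_pairs P) i).1
        (nth (Mark tt, SLeaf) (gjm_pairs P) i).2) = nth [::] (gj_types (gjm_datum P)) i.
    by move=> hi; rewrite -(vgjm_types hP) (nth_map (Mark tt, SLeaf)).
  have hy : mtp_set (gj_type v) x by apply/mtp_setP; split=> //; exact: key.
  by exists (exist _ x hy); rewrite (onth_nth (Mark tt, SLeaf)).
pose y v := projT1 (cid (hv v)).
exists (existT _ T (fun v => Wpi (y v))); split=> // v; exists (y v); split=> //.
exact: projT2 (cid (hv v)).
Qed.

End ValidDecorations.

(** * Cutting at the lengths 1 *)

Section Cutting.
Variable R : realType.
Notation bt := (btree R (gjm R)).

Definition cutc (s : stree R) (c : bt) : bt :=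
  match c with
  | Comp l _ => if l == 1 then Mark (piece s (bcut s c)) else bcut s c
  | Mark m => Mark m
  end.

Definition scutc (c : stree R) : stree R :=
  if c is SNode l _ then if l == 1 then SLeaf else scut c else SLeaf.

Lemma mapi_nth (A B C : Type) (f : A -> B -> C) x0 s t : size s = size t ->
  mapi (fun i x => f x (nth x0 t i)) s = map2 f s t.
Proof.
suff H pre : size s = size t ->
    mapi_from (fun i x => f x (nth x0 (pre ++ t) i)) (size pre) s = map2 f s t.
  exact: (H [::]).
elim: s t pre => [|x s IH] [|y t] pre //= [e]; rewrite nth_cat ltnn subnn /=.
by rewrite -(IH _ (rcons pre y)) // size_rcons -cat_rcons.
Qed.

Lemma bcut_V1 s l s1 : bcut s (Comp l [:: s1]) = Comp l [:: map (cutc s) s1].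
Proof. by []. Qed.

Lemma bcut_V2 l0 ch l (ss : seq (seq bt)) : (1 < size ss)%N -> size ss = size ch ->
  bcut (SNode l0 ch) (Comp l ss) = Comp l (map2 (fun sm c => map (cutc c) sm) ss ch).
Proof.
by move=> h e; rewrite [LHS]/= h -(mapi_nth (fun sm c => map (cutc c) sm) SLeaf e).
Qed.

Lemma scut_node l ch : scut (SNode l ch) = SNode l (map scutc ch).
Proof. by rewrite [LHS]/=; congr SNode; apply: eq_map => -[]. Qed.

Lemma hgt_le1 s (b : bt) : over s b -> hgt b <= 1.
Proof.
move: s b; apply: over_ind => [m|s l s1 hl h _ _ IH|l0 ch l ss hl h _ _ _].
- exact: ler01.
- case/andP: hl => _ hl; case: s1 h IH => // x s1 _ IH.
  by rewrite /= ge_max hl IH ?mem_head.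
- by rewrite hgt_V2 //; case/andP: hl.
Qed.

Lemma hgt_top s l (ss : seq (seq bt)) : over s (Comp l ss) ->
  hgt (Comp l ss) = Num.max l (hgt (Comp 0 ss)).
Proof.
move=> ho; have hl := over_unitI ho.
case: ss ho => [|[|x s1] [|s2 ss]] ho /=; rewrite ?maxxx ?maxr0 //.
have hx : over s x by move: ho; rewrite over_V1 => /and4P[_ _ /allP h _]; rewrite h ?mem_head.
by rewrite (@max_r _ _ 0) //; exact: hgt_ge0 hx.
Qed.

(** If the height of [b] (its own length disregarded) is [1], then every path to
    V_comp^{>=2} is cut and the bottom component is constant over the seam tree;
    otherwise no edge on such a path is cut and the bottom component lies over
    the cut seam tree. *)
Definition cut_shape s (b b' : bt) (top : R) : bool :=
  if isleaf s || (top == 1) then over SLeaf b' && ~~ has_V2 b'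
  else [&& over (scut s) b', has_V2 b' & hgt b' == hgt b].

(** Passes from the height without the edge below [c] to the height with it. If this edge is cut, a
    mark over a leaf remains; otherwise the maximum is 1 exactly when it was before. *)
Lemma cutc_shape s c : over s c -> cut_shape s c (bcut s c) (hgt (broot c)) ->
  cut_shape s c (cutc s c) (hgt c).
Proof.
case: c => [m|l ss] ho; first by rewrite /cut_shape; case: s ho.
have ht : hgt (Comp 0 ss) <= 1 by apply: hgt_le1 (over_broot ho).
have hl1 : l <= 1 by case/andP: (over_unitI ho).
rewrite /cut_shape (hgt_top ho) [hgt (broot _)]/(hgt (Comp 0 ss)) /cutc.
have [el|hl] := eqVneq l 1; first by rewrite el max_l // eqxx orbT.
suff -> : (Num.max l (hgt (Comp 0 ss)) == 1) = (hgt (Comp 0 ss) == 1) by [].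
case: ltP => // h; rewrite (negbTE hl); apply/esym/negbTE.
by rewrite neq_lt (le_lt_trans h) // lt_neqAle hl.
Qed.

Lemma has_V2_map (F : bt -> bt) (s1 : seq bt) b0 :
  (forall x, x \in s1 -> has_V2 (F x) = b0) -> (0 < size s1)%N ->
  has (@has_V2 R (gjm R)) (map F s1) = b0.
Proof.
move=> h; case: s1 h => // x s1 h _ /=; rewrite h ?mem_head //.
case: b0 h => //= h; apply/hasPn => _ /mapP[y hy ->].
by rewrite h // inE hy orbT.
Qed.

Lemma cut_shapeP s b : over s b -> cut_shape s b (bcut s b) (hgt (broot b)).
Proof.
move: s b; apply: over_ind => [//|s l s1 hl h ho hc IH|l0 ch l ss hl h hne e IH].
  have IH' x : x \in s1 -> cut_shape s x (cutc s x) (hgt x).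
    by move=> hx; apply: cutc_shape; [exact: ho | exact: IH].
  rewrite bcut_V1 /cut_shape; case: (boolP (isleaf s)) => [hs|hs].
    have h' x : x \in s1 -> over SLeaf (cutc s x) && ~~ has_V2 (cutc s x).
      by move=> hx; have := IH' x hx; rewrite /cut_shape hs.
    rewrite orTb over_V1 hl size_map h /= orbF !andbT; apply/andP; split.
      by apply/allP => _ /mapP[x hx ->]; case/andP: (h' x hx).
    apply/negbT/has_V2_map; last exact: ltnW.
    by move=> x hx; apply: negbTE; case/andP: (h' x hx).
  have htop x : x \in s1 -> hgt (broot (Comp l [:: s1])) = hgt x.
    move=> hx; rewrite (hgt_const hs hc hx) /= max_r //.
    by rewrite -(hgt_const hs hc hx); exact: hgt_ge0 (ho x hx).
  rewrite orFb; case: ifP => ht.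
    have h' x : x \in s1 -> over SLeaf (cutc s x) && ~~ has_V2 (cutc s x).
      by move=> hx; have := IH' x hx; rewrite /cut_shape -(htop x hx) ht orbT.
    rewrite over_V1 hl size_map h /= orbF !andbT; apply/andP; split.
      by apply/allP => _ /mapP[x hx ->]; case/andP: (h' x hx).
    apply/negbT/has_V2_map; last exact: ltnW.
    by move=> x hx; apply: negbTE; case/andP: (h' x hx).
  have h' x : x \in s1 -> [&& over (scut s) (cutc s x), has_V2 (cutc s x) & hgt (cutc s x) == hgt x].
    by move=> hx; have := IH' x hx; rewrite /cut_shape -(htop x hx) ht (negbTE hs).
  have eh : map (@hgt R (gjm R)) (map (cutc s) s1) = map (@hgt R (gjm R)) s1.
    by rewrite -map_comp; apply/eq_in_map => x /h'/and3P[_ _ /eqP].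
  apply/and3P; split.
  - rewrite over_V1 hl size_map h eh /=; apply/andP; split.
      by apply/allP => _ /mapP[x hx ->]; case/and3P: (h' x hx).
    by move: hc; rewrite (negbTE hs) /= => ->; rewrite orbT.
  - rewrite /= orbF; apply: has_V2_map; last exact: ltnW.
    by move=> x hx; case/and3P: (h' x hx).
  - by apply/eqP; rewrite /= -!/(map (@hgt R (gjm R)) _) eh.
(* A vertex of V_comp^{>=2} has no edge between itself and V_comp^{>=2}; its height 0 differs from
   1, which selects the second alternative. *)
have htop : hgt (broot (Comp l ss)) = 0 by rewrite /broot hgt_V2.
rewrite /cut_shape htop eq_sym oner_eq0 orbF [isleaf _]/= bcut_V2 // scut_node.
have hsz : size (map2 (fun sm c => map (cutc c) sm) ss ch) = size ss.
  by rewrite map2E size_map size_zip -e minnn.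
apply/and3P; split; last 2 first.
- by rewrite /has_V2 -/has_V2 hsz h.
- by rewrite !hgt_V2 ?hsz.
apply/over_V2P; rewrite hsz //; exists l0, (map scutc ch); split=> //.
- rewrite map2E has_map; have [s1 hs1 hs2] := hasP hne.
  have ht : (index s1 ss < size ss)%N by rewrite index_mem.
  apply/hasP; exists (nth [::] ss (index s1 ss), nth SLeaf ch (index s1 ss)).
    exact: mem_zip_nth.
  by rewrite /= size_map nth_index.
- by rewrite size_map.
move=> p; rewrite map2E.
have -> : zip [seq map (cutc p.2) p.1 | p <- zip ss ch] (map scutc ch) =
    [seq (map (cutc p.2) p.1, scutc p.2) | p <- zip ss ch].
  by elim: ss ch e {IH h hne hsz htop} => [|s1 ss IHs] [|c ch] //= [e]; rewrite IHs.
case/mapP => q hq -> y /mapP[x hx ->] /=.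
have [ho hf hs] := IH q hq x hx; have := cutc_shape ho hs; rewrite /cut_shape.
move: hf; rewrite /fits; case: (q.2) ho => [|l1 ch1] ho.
  by rewrite orTb => _ /andP[].
(* By [fits] the seam edge is as long as the bubble tree is high, so they are cut simultaneously. *)
rewrite !orFb [slen _]/= => /eqP eh; rewrite eh [scutc _]/=.
case: eqP => [_ /andP[]|hl1 /and3P[h1 _ /eqP h2]] //.
Qed.

Lemma sok_scut (s : stree R) : sok s -> sok (scut s).
Proof.
elim/stree_nested_ind: s => // l ch IH hs; rewrite scut_node.
case/and3P: hs => hl h /allP hs; apply/and3P; split=> //; first by rewrite size_map.
apply/allP => _ /mapP[c hc ->]; have := IH c hc (hs c hc).
by case: (c) => //= l' ch'; case: ifP.
Qed.

Variable S : pred R.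
Hypothesis S0 : S 0.
Let S1 l := S l && (l != 1).

Definition gjls (t : seq (gjm R)) := flatten (map (@gjl R) t).

Lemma gjls_flatten (t : seq (seq (gjm R))) : gjls (flatten t) = flatten (map gjls t).
Proof. by elim: t => //= a t IH; rewrite /gjls map_cat flatten_cat -/(gjls (flatten t)) IH. Qed.

Lemma perm_gjls t t' : perm_eq t t' -> perm_eq (gjls t) (gjls t').
Proof. by move=> h; apply: perm_flatten; exact: perm_map. Qed.

(** The length at the root is excluded by [behead], since [cutc] decides one level closer to the
    root whether that edge is cut. All other remaining lengths are values of [S] distinct from 1. *)
Definition cut_ok (b b' : bt) : Prop :=
  [/\ forall m, m \in blabels b' -> vgjm S1 m,
      perm_eq (gjls (blabels b')) (gjls (blabels b)) &
      all S1 (behead (blens b'))].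

Lemma scut_lens (s : stree R) : all S (slens s) -> all S1 (behead (slens (scut s))).
Proof.
elim/stree_nested_ind: s => // l ch IH; rewrite scut_node /= => /andP[_ /allP h].
apply/allP => v /flatten_mapP[_ /mapP[c hc ->]].
have {}h : all S (slens c).
  by apply/allP => u hu; apply: h; apply/flatten_mapP; exists c.
have := IH c hc h; case: c {IH hc} h => // l1 ch1 /= /andP[h1 _].
have [//|hl] := eqVneq l1 1; move=> /allP h2.
rewrite inE => /orP[/eqP->|]; last exact: h2.
by rewrite /S1 h1.
Qed.

Lemma piece_ok s b : sok s -> all S (slens s) -> over s b -> cut_ok b (bcut s b) ->
  vgjm S1 (piece s (bcut s b)) /\ perm_eq (gjl (piece s (bcut s b))) (gjls (blabels b)).
Proof.
move=> hs hS ho [h1 h2 h3]; rewrite /piece.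
have S10 : S1 0 by rewrite /S1 S0 eq_sym oner_eq0.
set t := if _ then _ else _.
have [hw ht] : wf (broot (bcut s b), t) /\ all S1 (slens t).
  have := cut_shapeP ho; rewrite /cut_shape /t; case: ifP => _.
    case/andP=> h4 /negbTE ->; split=> //; exact: (@wf_root _ _ SLeaf).
  case/and3P=> h4 -> _; split; first by apply: wf_root => //; exact: sok_scut.
  by have := scut_lens hS; case: (scut s) => //= l ch ->; rewrite S10.
have hlab : blabels (broot (bcut s b)) = blabels (bcut s b) by case: (bcut s b).
have hp := perm_groups_labels (let: And4 _ h _ _ := hw in h); rewrite /= hlab in hp.
have hl : lens_in S1 (broot (bcut s b), t).
  rewrite /lens_in ht andbT; move: h3; case: (bcut s b) => //= l ss ->; by rewrite S10.
have [|h5 ->] := mnode_forget S10 hw hl.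
  by move=> m hm; apply: h1; rewrite -(perm_mem hp).
split=> //; apply: perm_trans h2; exact: perm_gjls.
Qed.

Lemma cutc_ok s c : sok s -> all S (slens s) -> all S (blens c) -> over s c ->
  cut_ok c (bcut s c) -> cut_ok c (cutc s c) /\ all S1 (blens (cutc s c)).
Proof.
move=> hs hS hb ho hc; case: c hb ho hc => [m|l ss] // hb ho hc.
rewrite /cutc; case: eqP => hl.
  have [h1 h2] := piece_ok hs hS ho hc; split=> //; split=> //.
    by move=> m; rewrite inE => /eqP->.
  by rewrite /gjls [flatten (map _ (blabels (Mark _)))]/= cats0.
split=> //; case: hc => _ _ /=; case/andP: hb => hb _ h.
by rewrite /S1 hb; apply/andP; split=> //; apply/eqP.
Qed.

Lemma bcut_ok s b : over s b -> sok s -> all S (slens s) -> all S (blens b) ->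
  (forall m, m \in blabels b -> vgjm S1 m) -> cut_ok b (bcut s b).
Proof.
move: s b; apply: over_ind => [m _ _ _ h|s l s1 hl h1 ho _ IH hs hS hb hm|
  l0 ch l ss hl h1 _ e IH hs hS hb hm]; first by split.
  have key x : x \in s1 -> cut_ok x (cutc s x) /\ all S1 (blens (cutc s x)).
    move=> hx; have hbx : all S (blens x).
      apply/allP => v hv; case/andP: hb => _ /allP; apply; rewrite /= cats0.
      by apply/flatten_mapP; exists x.
    apply: cutc_ok => //; [exact: ho | apply: IH => // m hmx; apply: hm].
    by rewrite /= cats0; apply/flatten_mapP; exists x.
  rewrite bcut_V1; split.
  - move=> m; rewrite /= cats0 => /flatten_mapP[_ /mapP[x hx ->]].
    by have [[h _ _] _] := key x hx; exact: h.
  - rewrite /= !cats0 !gjls_flatten -!map_comp; apply: perm_flatten_map => x hx.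
    by have [[_ h _] _] := key x hx.
  - rewrite /= cats0; apply/allP => v /flatten_mapP[_ /mapP[x hx ->]].
    by have [_ /allP] := key x hx; apply.
have key p : p \in zip ss ch -> forall x, x \in p.1 ->
    cut_ok x (cutc p.2 x) /\ all S1 (blens (cutc p.2 x)).
  move=> hp x hx; have hp1 := mem_zip1 hp; have hp2 := mem_zip2 hp.
  have hbx : all S (blens x).
    apply/allP => v hv; case/andP: hb => _ /allP; apply.
    by apply/flatten_mapP; exists p.1 => //; apply/flatten_mapP; exists x.
  have hsp : sok p.2 by case/and3P: hs => _ _ /allP; apply.
  have hSp : all S (slens p.2).
    apply/allP => v hv; case/andP: hS => _ /allP; apply.
    by apply/flatten_mapP; exists p.2.
  have [hox _ hc] := IH p hp x hx; apply: cutc_ok => //; apply: hc => // m hmx; apply: hm.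
  by apply/flatten_mapP; exists p.1 => //; apply/flatten_mapP; exists x.
have eb (T : eqType) (F : bt -> seq T) :
    flatten [seq flatten (map F s1) | s1 <- map2 (fun sm c => map (cutc c) sm) ss ch] =
    flatten [seq flatten [seq F (cutc p.2 x) | x <- p.1] | p <- zip ss ch].
  by rewrite map2E -map_comp; congr flatten; apply: eq_map => p /=; rewrite -map_comp.
have es (T : eqType) (F : bt -> seq T) :
    flatten [seq flatten (map F s1) | s1 <- ss] =
    flatten [seq flatten [seq F x | x <- p.1] | p <- zip ss ch].
  elim: ss ch e {IH h1 hb hm hs hS key eb} => [|s1 ss IHs] [|c ch] //= [e].
  by rewrite (IHs ch).
rewrite bcut_V2 //; split.
- move=> m; rewrite [blabels _]/= eb => /flatten_mapP[p hp] /flatten_mapP[x hx].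
  by have [[h _ _] _] := key p hp x hx; exact: h.
- rewrite [blabels (Comp l (map2 _ _ _))]/= [blabels (Comp l ss)]/= eb es.
  rewrite !gjls_flatten -!map_comp; apply: perm_flatten_map => p hp /=.
  rewrite !gjls_flatten -!map_comp; apply: perm_flatten_map => x hx /=.
  by have [[_ h _] _] := key p hp x hx.
- rewrite [behead _]/= eb; apply/allP => v /flatten_mapP[p hp] /flatten_mapP[x hx].
  by have [_ /allP] := key p hp x hx; apply.
Qed.

(** Stated for a decorated corolla, where the recursion of [q_map] into the labels is trivial and
    there is one cut. *)
Lemma q_map_ok P : vgjm S P -> (forall b s m, P = MNode b s -> m \in blabels b -> exists i, m = MLeaf R i) ->
  vgjm S1 (q_map P) /\ perm_eq (gjl (q_map P)) (gjl P).
Proof.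
case=> [i|l ss s hw hl hg hm] hi; first by split=> //; exact: VLeaf.
case: (hw) => hs ho _ _; rewrite [(_, _).1]/= [(_, _).2]/= in hs ho.
case/andP: hl => [hb hS].
have hL m : m \in blabels (Comp l ss) -> exists i, m = MLeaf R i by exact: hi.
have -> : q_map (MNode (Comp l ss) s) = piece s (bcut s (Comp l ss)).
  rewrite /q_map -/q_map; congr (piece s (bcut s _)).
  elim/btree_nested_ind: (Comp l ss) hL => [m h|l' ss' IH h].
    by have [|i ->] := h m; rewrite ?mem_head.
  rewrite /=; congr Comp; rewrite -[RHS]map_id; apply/eq_in_map => s1 h1.
  rewrite -[RHS]map_id; apply/eq_in_map => x hx; apply: (IH s1) => // m hmx; apply: h.
  by apply/flatten_mapP; exists s1 => //; apply/flatten_mapP; exists x.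
have hc : cut_ok (Comp l ss) (bcut s (Comp l ss)).
  by apply: bcut_ok => // m /hL[i ->]; exact: VLeaf.
have [h1 h2] := piece_ok hs hS ho hc; split=> //.
rewrite (perm_trans h2) // gjl_node; apply: perm_gjls.
by rewrite perm_sym; exact: perm_groups_labels.
Qed.

End Cutting.

(** * Invariance of the nonzero lengths *)

Section NonzeroLengths.
Variables (R : realType) (v : R).
Hypothesis v0 : v != 0.
Notation bt := (btree R unit).

Let inb (b : bt) := v \in blens b.

Lemma mem_blens l (ss : seq (seq bt)) :
  inb (Comp l ss) = (v == l) || has (has inb) ss.
Proof.
rewrite /inb inE; congr orb; apply/flatten_mapP/hasP => -[s1 h1].
  by case/flatten_mapP => x hx hv; exists s1 => //; apply/hasP; exists x.
by case/hasP => x hx hv; exists s1 => //; apply/flatten_mapP; exists x.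
Qed.

Lemma mem_merge_seams q (gss : seq (seq (seq bt))) : all (fun gs => size gs == q) gss ->
  has (has inb) (merge_seams q gss) = has (has (has inb)) gss.
Proof.
move=> h; apply/hasP/hasP => -[s1 h1 /hasP[x hx hi]].
  have [t ht et] := nthP [::] h1; rewrite size_merge_seams in ht.
  rewrite -et nth_merge_seams // in hx; case/flatten_mapP: hx => gs hgs hx.
  exists gs => //; apply/hasP; exists (nth [::] gs t); last by apply/hasP; exists x.
  by apply: mem_nth; move/allP: h => /(_ gs hgs)/eqP->.
have [t ht et] := nthP [::] hx; move/allP: h => /(_ s1 h1)/eqP eq.
rewrite eq in ht; exists (nth [::] (merge_seams q gss) t).
  by rewrite mem_nth // size_merge_seams.
rewrite nth_merge_seams //; case/hasP: hi => y hy hi; apply/hasP; exists y => //.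
by apply/flatten_mapP; exists s1 => //; rewrite et.
Qed.

Lemma mem_Comp0 (ss : seq (seq bt)) : inb (Comp 0 ss) = has (has inb) ss.
Proof. by rewrite mem_blens (negbTE v0). Qed.

Lemma step1_lens (b b' : bt) : step1 b b' -> inb b = inb b'.
Proof.
case=> h; elim: h => {b b'} [b b'|l ss1 s1 b b' s2 ss2 _ IH].
- case=> l ss1 s1 g s2 ss2; rewrite !mem_blens !has_cat /= !has_cat /=.
  by rewrite mem_Comp0 /= orbF.
- by rewrite !mem_blens !has_cat /= !has_cat /= IH.
- case=> l q gss h1 h2 h3; rewrite !mem_blens mem_merge_seams //= orbF has_map.
  by congr orb; apply: eq_has => gs /=; exact: mem_Comp0.
- by rewrite !mem_blens !has_cat /= !has_cat /= IH.
Qed.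

Lemma has_cat3 (T : Type) (p : pred T) s1 x s2 : has p (s1 ++ x :: s2) = [|| has p s1, p x | has p s2].
Proof. by rewrite has_cat. Qed.

(** By [zover] the removed vertices have length 0; all others are kept or moved with their
    lengths. *)
Lemma bcontract_lens rho s ch (b : bt) : over s b -> ssub s rho = Some (SNode 0 ch) ->
  zover rho b -> inb (bcontract (size ch) rho b) = inb b.
Proof.
elim/btree_nested_ind: b rho s => // l ss IH rho s ho hs hz.
have [h1|h1] := ltnP 1 (size ss); last first.
  case: ss h1 IH ho hz => [|s1 [|]] // _ IH.
  rewrite over_V1 zover_V1 => /and4P[_ _ /allP ho _] /andP[_ /allP hz].
  rewrite bcontract_V1 !mem_blens /= has_map !orbF; congr orb.
  apply: eq_in_has => x hx /=; apply: (IH s1 _ _ _ rho s) => //; rewrite ?mem_head //.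
    exact: ho.
  exact: hz.
case: s ho hs => [|l0 cs] ho; first by case: rho hz => [|t rho] //= _; rewrite h1.
case: rho hz => [|t rho] hz; first by rewrite /= h1.
rewrite [ssub _ _]/=; case e: onth => [c|] // hs.
have [ch1 [ch2 [ec et]]] := onth_some e; rewrite ec in ho.
have [ss1 [s0 [ss2 [es e1 e2 h0]]]] := over_split h1 ho.
rewrite zover_V2 // in hz; subst ss.
have ets : t = size ss1 by rewrite e1.
rewrite {}ets in hz *; rewrite nth_cat ltnn subnn [nth _ _ 0]/= in hz.
case: rho hs hz => [[ecc] hz|u rho hs].
  rewrite ecc in h0; have [gss es hg] := zover_nil_map h0 hz.
  rewrite bcontract_V2_here // !mem_blens has_cat3 !has_cat; congr [|| _, _, _ | _].
  rewrite es -map_comp [map _ gss]map_id mem_merge_seams; last first.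
    by apply/allP => gs /hg[_ ->].
  by rewrite has_map; apply: eq_has => gs /=; rewrite mem_Comp0.
move=> /allP hz; rewrite bcontract_V2_in // !mem_blens !has_cat3; congr [|| _, _, _ | _].
rewrite has_map; apply: eq_in_has => x hx /=; apply: (IH s0 _ _ _ (u :: rho) c) => //.
- by rewrite mem_cat mem_head orbT.
- exact: h0.
- exact: hz.
Qed.

Lemma mem_slens l (ch : seq (stree R)) :
  (v \in slens (SNode l ch)) = (v == l) || has (fun c => v \in slens c) ch.
Proof.
rewrite inE; congr orb; apply/flatten_mapP/hasP => -[c h1 h2]; by exists c.
Qed.

Lemma Cst_lens q rho (s s' : stree R) : Cst q rho s s' -> (v \in slens s') = (v \in slens s).
Proof.
elim=> {q rho s s'} [l ch1 ch ch2|q rho l ch1 c c' ch2 _ IH]; rewrite !mem_slens has_cat3.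
  by rewrite !has_cat mem_slens (negbTE v0).
by rewrite has_cat3 IH.
Qed.

Lemma mem_coords (x : tpair R unit) : wf x ->
  (v \in coords x) = (v \in blens x.1) || (v \in slens x.2).
Proof.
case=> _ _ h1 h2; rewrite mem_cat.
have key (t : seq R) : head 0 t = 0 -> (v \in behead t) = (v \in t).
  by case: t => //= l t ->; rewrite inE (negbTE v0).
by rewrite !key.
Qed.

(** A contraction only removes coordinates equal to [0]; so containing a
    coordinate [1] does not depend on the representative. *)
Lemma W_step_coords (x y : tpair R unit) : wf x -> wf y -> W_step x y ->
  (v \in coords x) = (v \in coords y).
Proof.
move=> hx hy h; rewrite !mem_coords //; case: h => [[h ->]|[h ->]|h].
- by congr orb; apply: step1_lens; left.
- by congr orb; apply: step1_lens; right.
case: h hx hy => b s rho ch hr hs hz [/= _ ho _ _] _.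
congr orb; first by rewrite -!/(inb _) (@bcontract_lens rho s) //; exact: zpremise_zover.
by rewrite (Cst_lens (ssub_Cst hr hs)).
Qed.

End NonzeroLengths.

(** * Representatives of boundary points *)

Section Boundary.
Variables (R : realType) (n : seq nat).

Lemma W_equiv_coords (v : R) (x y : mtp R n) : v != 0 -> W_equiv R n x y ->
  (v \in coords (raw x)) = (v \in coords (raw y)).
Proof.
move=> v0 /asboolP; elim=> // {x y} [x y h|x y z _ -> _ ->] //.
by apply: W_step_coords => //; exact: raw_wf.
Qed.

Lemma Wpi_eqP (x y : mtp R n) : Wpi x = Wpi y <-> W_equiv R n x y.
Proof.
split=> [h|h]; first by apply/eqmodP; rewrite /Wpi in h; rewrite h.
by rewrite /Wpi; apply/eqmodP.
Qed.

(** The definition of the boundary provides a coordinate 1 for some representative [y] only;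
    invariance carries it to [x]. *)
Lemma boundary_coords (x : mtp R n) : W_boundary (Wpi x) -> 1 \in coords (raw x).
Proof.
case=> S [tau [c [i [_ [y [hS hy] e] h1]]]].
have hyx : W_equiv R n y x by apply/Wpi_eqP.
rewrite -(W_equiv_coords (oner_neq0 R) hyx) -(h1 _ hy) mem_nth //.
by case: hy => ->.
Qed.

End Boundary.

(** * Open cells *)

Section OpenSimplices.
Variables (R : realType) (m : nat).
Implicit Types (tau : 'S_m) (c : m.+1.-tuple bool) (v : seq R).

Definition sorting tau v : seq R := [seq nth 0 v (tau j) | j <- enum 'I_m].

Lemma size_sorting tau v : size (sorting tau v) = m.
Proof. by rewrite size_map size_enum_ord. Qed.

Lemma open_simplexP tau c v : open_simplex tau c v <->
  [/\ size v = m, path <=%R 0 (rcons (sorting tau v) 1) &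
      val c = pairmap <%R 0 (rcons (sorting tau v) 1)].
Proof.
have hsz : size (rcons (sorting tau v) 1) = m.+1 by rewrite size_rcons size_sorting.
rewrite /open_simplex /= -/(sorting tau v); split=> [[e h]|[e h1 h2]]; last first.
  split=> // i; rewrite (tnth_nth false) h2 (nth_pairmap 0) ?hsz //.
  by case: ltP => // h; rewrite eq_le h andbT; apply: (pathP 0 h1); rewrite hsz.
have h' i : (i < m.+1)%N -> if nth false c i
    then (0 :: rcons (sorting tau v) 1)`_i < (rcons (sorting tau v) 1)`_i
    else (0 :: rcons (sorting tau v) 1)`_i == (rcons (sorting tau v) 1)`_i.
  by move=> hi; have := h (Ordinal hi); rewrite (tnth_nth false).
split=> //.
  apply/(pathP 0) => i; rewrite hsz => /h'; case: ifP => _; first exact: ltW.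
  by move/eqP->.
apply: (@eq_from_nth _ false); rewrite size_tuple ?size_pairmap ?hsz // => i hi.
rewrite (nth_pairmap 0) ?hsz //; have := h' i hi; case: ifP => _ => [->//|/eqP->].
by rewrite ltxx.
Qed.

Lemma perm_sorting tau v : size v = m -> perm_eq (sorting tau v) v.
Proof.
move=> e; have ht : size v == m by apply/eqP.
rewrite -[X in perm_eq _ X]/(val (Tuple ht)); apply/tuple_permP; exists tau.
by rewrite /= /sorting; apply: eq_map => i; rewrite (tnth_nth 0).
Qed.

(** In a nondecreasing sequence each strict step brings exactly one new value. *)
Lemma size_undup_path (x : R) t : path <=%R x t ->
  size (undup (x :: t)) = (count id (pairmap <%R x t)).+1.
Proof.
elim: t x => // y t IH x /= /andP[hxy hp]; have := IH y hp; rewrite [undup (y :: t)]/= => e.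
have hy z : z \in t -> y <= z by move: hp; rewrite (path_sortedE le_trans) => /andP[/allP h _]; exact: h.
have [exy|hne] := eqVneq x y.
  by rewrite exy ltxx mem_head e.
have hlt : x < y by rewrite lt_neqAle hne.
have hx : x \in y :: t = false.
  apply/negbTE; rewrite inE negb_or hne; apply/negP => /hy.
  by rewrite leNgt hlt.
by rewrite hx hlt [LHS]/= e add1n.
Qed.

(** The dimension of the open simplex of [v] is the number of these values. *)
Definition interior (v : seq R) := undup [seq x <- v | 0 < x < 1].

Lemma open_simplex_unit tau c v x : open_simplex tau c v -> x \in v -> 0 <= x <= 1.
Proof.
case/open_simplexP => e h1 _; rewrite -(perm_mem (perm_sorting tau e)) => hx.
move: h1; rewrite (path_sortedE le_trans) all_rcons => /andP[/andP[_ /allP h]].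
by rewrite (sorted_pairwise le_trans) pairwise_rcons => /andP[/allP h' _]; rewrite h // h'.
Qed.

Lemma simplex_dimE tau c v : open_simplex tau c v -> simplex_dim c = size (interior v).
Proof.
move=> h; have h3 x := open_simplex_unit (x := x) h.
case/open_simplexP: h => e h1 h2; rewrite /simplex_dim h2.
have hp := perm_sorting tau e; move: (sorting tau v) h1 hp {h2} => w h1 hp.
have := size_undup_path h1; set n := count _ _ => hn.
(* The values 0 and 1 account for the two units between the number of distinct values and the
   dimension. *)
have : perm_eq (undup (0 :: rcons w 1)) (0 :: 1 :: interior v).
  apply: uniq_perm; first exact: undup_uniq.
    rewrite /= undup_uniq inE eq_sym oner_eq0 !mem_undup !mem_filter !ltxx andbF.
    by rewrite andFb.
  move=> x; rewrite mem_undup !inE mem_rcons inE mem_undup mem_filter.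
  case: (eqVneq x 0) => //= x0; case: (eqVneq x 1) => //= x1.
  case hx: (x \in w); last by rewrite (perm_mem hp) in hx; rewrite hx andbF.
  rewrite (perm_mem hp) in hx; rewrite hx andbT; have /andP[h4 h5] := h3 x hx.
  by rewrite !lt_neqAle eq_sym x0 x1 h4 h5.
by move/perm_size; rewrite hn /= => -[->].
Qed.

(** The permutation sorts [v], and [c] records the strict steps. *)
Lemma in_open_simplex v : size v = m -> all (@unitI R) v ->
  exists tau c, open_simplex tau c v.
Proof.
move=> e hv; have ht : size v == m by apply/eqP.
have : perm_eq (sort <=%R v) (Tuple ht) by rewrite perm_sort.
case/tuple_permP => tau es; exists tau.
have es' : sorting tau v = sort <=%R v.
  by rewrite es /= /sorting; apply: eq_map => i; rewrite (tnth_nth 0).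
have hsz : size (pairmap <%R 0 (rcons (sorting tau v) 1)) == m.+1.
  by rewrite size_pairmap size_rcons size_sorting.
exists (Tuple hsz); apply/open_simplexP; split=> //; rewrite es'.
rewrite rcons_path; apply/andP; split.
  rewrite (path_sortedE le_trans) sort_le_sorted andbT.
  by apply/allP => x; rewrite mem_sort => /(allP hv)/andP[].
apply: (@le_trans _ _ 1) => //; have := mem_last 0 (sort <=%R v).
by rewrite inE mem_sort => /orP[/eqP-> //|/(allP hv)/andP[]].
Qed.

(** The two points lie on the same side of every wall, so the ordered values of
    the first are carried to those of the second by a monotone step function. *)
Lemma same_simplex tau c v v' : open_simplex tau c v -> open_simplex tau c v' ->
  exists phi : R -> R, [/\ {homo phi : x y / x <= y}, phi 0 = 0, phi 1 = 1 &
    v' = map phi v].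
Proof.
case/open_simplexP => e1 p1 c1 /open_simplexP[e2 p2 c2].
pose z := 0 :: rcons (sorting tau v) 1; pose z' := 0 :: rcons (sorting tau v') 1.
have hz : size z = m.+2 by rewrite /= size_rcons size_sorting.
have hz' : size z' = m.+2 by rewrite /= size_rcons size_sorting.
have mono i j : (i <= j)%N -> (j < m.+2)%N -> z`_i <= z`_j.
  by move=> hij hj; apply: (@sorted_leq_nth R <=%R le_trans lexx 0 z p1) => //; rewrite inE hz //; exact: leq_ltn_trans hj.
have mono' i j : (i <= j)%N -> (j < m.+2)%N -> z'`_i <= z'`_j.
  by move=> hij hj; apply: (@sorted_leq_nth R <=%R le_trans lexx 0 z' p2) => //; rewrite inE hz' //; exact: leq_ltn_trans hj.
have step i : (i < m.+1)%N -> z`_i = z`_i.+1 -> z'`_i = z'`_i.+1.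
  move=> hi ez; have hs w : size (rcons (sorting tau w) 1) = m.+1 by rewrite size_rcons size_sorting.
  have h1 : nth false c i = (z`_i < z`_i.+1) by rewrite c1 (nth_pairmap 0) ?hs.
  have h2 : nth false c i = (z'`_i < z'`_i.+1) by rewrite c2 (nth_pairmap 0) ?hs.
  apply/eqP; rewrite eq_le mono' //= leNgt -h2 h1 ez ltxx //.
have steps i j : (i <= j)%N -> (j < m.+2)%N -> z`_i = z`_j -> z'`_i = z'`_j.
  elim: j => [|j IH]; first by rewrite leqn0 => /eqP->.
  rewrite leq_eqVlt => /orP[/eqP->//|hij] hj ez.
  have ej : z`_i = z`_j.
    by apply/eqP; rewrite eq_le mono ?(ltnW hj) //= ez mono.
  by rewrite (IH hij (ltnW hj) ej); apply: step => //; rewrite -ej.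
(* This step function is monotone by construction and takes [z_i] to [z'_i]; ties in [z] cause no
   conflict by [steps]. *)
pose phi x := \big[Num.max/0]_(i < m.+2 | z`_i <= x) z'`_i.
have z'0 i : (i < m.+2)%N -> 0 <= z'`_i by move=> hi; apply: (mono' 0%N).
have hphi i : (i < m.+2)%N -> phi z`_i = z'`_i.
  move=> hi; apply/eqP; rewrite eq_le; apply/andP; split.
    apply/bigmax_leP; split=> [|j hj]; first exact: z'0.
    have [hij|hij] := leqP j i; first exact: mono'.
    rewrite (@steps i j) ?(ltnW hij) //; apply/eqP; rewrite eq_le hj andbT; apply: mono => //; exact: ltnW.
  exact: (@le_bigmax_cond _ _ _ 0 (Ordinal hi) (fun j : 'I_m.+2 => z`_j <= z`_i) (fun j : 'I_m.+2 => z'`_j)).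
exists phi; split.
- move=> x y hxy; apply/bigmax_leP; split=> [|i hi].
    exact: bigmax_ge_id.
  apply: (@le_bigmax_cond _ _ _ 0 i (fun j : 'I_m.+2 => z`_j <= y) (fun j : 'I_m.+2 => z'`_j)).
  exact: le_trans hi hxy.
- exact: (hphi 0%N).
- have := hphi m.+1 (ltnSn _); rewrite /z /z' /= !nth_rcons !size_sorting ltnn eqxx; exact.
apply: (@eq_from_nth _ 0); rewrite ?size_map ?e1 ?e2 // => i hi.
rewrite (nth_map 0) ?e1 //; pose j := (tau^-1)%g (Ordinal hi).
have hj w : w = v \/ w = v' -> (0 :: rcons (sorting tau w) 1)`_j.+1 = w`_i.
  move=> _; rewrite /= nth_rcons size_sorting ltn_ord (nth_map j) ?size_enum_ord //.
  by rewrite nth_ord_enum permKV.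
rewrite -(hj v); last by left. 
rewrite -(hj v'); last by right.
by rewrite hphi // !ltnS; exact: ltnW (ltn_ord j).
Qed.

End OpenSimplices.

(** * Monotone deformation of the lengths *)

Section MonotoneDeformation.
Variables (R : realType) (M : Type) (phi : R -> R).
Hypotheses (phi_homo : {homo phi : x y / x <= y}) (phi0 : phi 0 = 0) (phi1 : phi 1 = 1).
Implicit Types (b : btree R M) (s : stree R).

(** The metric conditions are equalities of maxima, so this makes them invariant under [phi]; [phi0]
    and [phi1] keep the range [0,1]. *)
Lemma homo_maxr x y : phi (Num.max x y) = Num.max (phi x) (phi y).
Proof.
by case: (leP x y) => h; [rewrite max_r // | rewrite max_l //]; apply: phi_homo => //; exact: ltW.
Qed.

Lemma homo_unitI x : unitI x -> unitI (phi x).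
Proof. case/andP=> h h'; rewrite /unitI; by rewrite -{1}phi0 phi_homo // -phi1 phi_homo. Qed.

Lemma hgt_homo s b : over s b -> hgt (bmap phi id b) = phi (hgt b).
Proof.
move: s b; apply: over_ind => [m|s l s1 hl h _ _ IH|l0 ch l ss hl h _ _ _].
- by rewrite /= phi0.
- case: s1 h IH => // x s1 _ IH /=; rewrite homo_maxr; congr Num.max.
  by apply: IH; rewrite mem_head.
- by rewrite [bmap _ _ _]/= !hgt_V2 ?size_map.
Qed.

Lemma over_homo s b : over s b -> over (smap phi s) (bmap phi id b).
Proof.
move: s b; apply: over_ind => [//|s l s1 hl h ho hc IH|l0 ch l ss hl h1 h2 e IH].
  rewrite [bmap _ _ _]/= over_V1 homo_unitI // size_map h /=; apply/andP; split.
    by apply/allP => _ /mapP[x hx ->]; exact: IH.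
  case: (s) ho hc => // l1 ch ho; rewrite !orFb -map_comp => hc.
  have -> : map (@hgt R M \o bmap phi id) s1 = map phi (map (@hgt R M) s1).
    by rewrite -map_comp; apply/eq_in_map => x /ho/hgt_homo.
  by case: (map _ s1) hc => //= a t /allP h'; apply/allP => _ /mapP[y /h'/eqP -> ->] /=.
rewrite [bmap _ _ _]/=; apply/over_V2P; rewrite ?size_map //.
exists (phi l0), (map (smap phi) ch); split.
- by [].
- exact: homo_unitI.
- by rewrite has_map; apply: sub_has h2 => s1 /=; rewrite size_map.
- by rewrite size_map.
have -> : zip [seq [seq bmap phi id c | c <- u] | u <- ss] [seq smap phi c | c <- ch] =
    [seq ([seq bmap phi id c | c <- p.1], smap phi p.2) | p <- zip ss ch].
  by elim: ss ch e {IH h1 h2} => [|s1 ss IHs] [|c ch] //= [e]; rewrite IHs.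
move=> _ /mapP[p hp ->] _ /mapP[x hx ->] /=; have [ho hf h] := IH p hp x hx; split=> //.
move: hf; rewrite /fits (hgt_homo ho); case: (p.2) => //= l1 ch1 /eqP->.
by [].
Qed.

Lemma sok_homo s : sok s -> sok (smap phi s).
Proof.
elim/stree_nested_ind: s => // l ch IH /and3P[hl h /allP hs]; apply/and3P; split.
- exact: homo_unitI.
- by rewrite size_map.
- by apply/allP => _ /mapP[c hc ->]; exact: IH hc (hs c hc).
Qed.

Lemma blens_map (L L' M' : Type) (g : L -> L') (h : M -> M') (b : btree L M) : blens (bmap g h b) = map g (blens b).
Proof.
elim/btree_nested_ind: b => //= l ss IH; congr cons; rewrite map_flatten -!map_comp.
congr flatten; apply/eq_in_map => s1 hs /=; rewrite map_flatten -!map_comp; congr flatten.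
by apply/eq_in_map => x hx /=; exact: IH hs hx.
Qed.

Lemma slens_map (L L' : Type) (g : L -> L') (s : stree L) : slens (smap g s) = map g (slens s).
Proof.
elim/stree_nested_ind: s => //= l ch IH; congr cons; rewrite map_flatten -!map_comp.
by congr flatten; apply/eq_in_map => c hc /=; exact: IH.
Qed.

End MonotoneDeformation.

Section Deformation.
Variables (R : realType) (phi : R -> R).
Hypotheses (phi_homo : {homo phi : x y / x <= y}) (phi0 : phi 0 = 0) (phi1 : phi 1 = 1).

Definition deform (x : tpair R unit) : tpair R unit := (bmap phi id x.1, smap phi x.2).

Lemma deform_wf x : wf x -> wf (deform x).
Proof.
case=> h1 h2 h3 h4; split; first exact: sok_homo.
- exact: over_homo.
- by rewrite blens_map; case: (blens x.1) h3 => //= l t ->.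
- by rewrite slens_map; case: (slens x.2) h4 => //= l t ->.
Qed.

Lemma deform_mtp n x : mtp_set n x -> mtp_set n (deform x).
Proof.
case/mtp_setP => h e; apply/mtp_setP; split; first exact: deform_wf.
by rewrite groups_mapE map_id_in // => g _; rewrite map_id.
Qed.

Lemma deform_coords x : coords (deform x) = map phi (coords x).
Proof.
by rewrite /coords blens_map slens_map map_cat; case: (blens x.1); case: (slens x.2).
Qed.

Lemma deform_type x : tree_type (deform x) = tree_type x.
Proof.
congr pair => /=.
  elim/btree_nested_ind: (x.1) => //= l ss IH; congr Comp; rewrite -map_comp.
  apply/eq_in_map => s1 hs /=; rewrite -map_comp; apply/eq_in_map => b hb; exact: IH hs hb.
elim/stree_nested_ind: (x.2) => //= l ch IH; congr SNode; rewrite -map_comp.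
by apply/eq_in_map => c hc; exact: IH.
Qed.

End Deformation.

Lemma size_coords_type (L : Type) (x : tpair L unit) : size (coords (tree_type x)) = size (coords x).
Proof. by rewrite /coords /= blens_map slens_map !size_cat !size_behead !size_map. Qed.

(** * The open cell of a point *)

Section Cells.
Variables (R : realType) (k : nat).

Definition no_one (x : tpair R unit) := 1 \notin coords x.

Lemma size_GJ_coords (T : gj_data k) S (y : forall v : gj_vert T, mtp R (gj_type v)) :
  GJ_C2T S y -> size (GJ_coords y) = GJ_dim S.
Proof.
move=> h; rewrite size_flatten /shape -map_comp /GJ_dim sumnE big_map big_enum /=.
by apply: eq_bigr => v _; rewrite -(h v) size_coords_type.
Qed.

Lemma GJ_coordsP (T : gj_data k) (y : forall v : gj_vert T, mtp R (gj_type v)) u :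
  u \in GJ_coords y <-> exists v, u \in coords (raw (y v)).
Proof.
split=> [/flatten_mapP[v _ h]|[v h]]; first by exists v.
by apply/flatten_mapP; exists v => //; rewrite mem_enum.
Qed.

Lemma GJ_coords_unit (T : gj_data k) (y : forall v : gj_vert T, mtp R (gj_type v)) :
  all (@unitI R) (GJ_coords y).
Proof.
apply/allP => u /GJ_coordsP[v]; have := svalP (y v); rewrite -/(raw (y v)).
by move=> /asboolP[_ [_ /allP h _ _]] /h.
Qed.

(** The cell is the open simplex of the coordinates of [y]; two facts about its other points are
    needed, and both come from [same_simplex]. *)
Lemma FM_cell_point (T : gj_data k) (y : forall v : gj_vert T, mtp R (gj_type v)) :
  (forall v, no_one (raw (y v))) ->
  exists e, @FM_cell R k (size (interior (GJ_coords y))) e /\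
    e (FMpi (existT _ T (fun v => Wpi (y v)))).
Proof.
move=> h1; pose S v := tree_type (raw (y v)).
have hS : GJ_C2T S y by [].
have [tau [c hc]] := in_open_simplex (size_GJ_coords hS) (GJ_coords_unit y).
exists [set @FMpi R k (existT (fun T' => GJt R T') T X) | X in @GJ_open_cell R k T S tau c]%classic; split; last first.
  by exists (fun v => Wpi (y v)) => //; exists y.
exists T, S, tau, c; split=> //; last exact: simplex_dimE hc.
(* Any other point of the simplex consists of the coordinates of a deformation of [y], hence comes
   from the product of the C_2T. *)
- split=> [|v' hv']; first by exists (GJ_coords y).
  have [phi [hm p0 p1 e]] := same_simplex hc hv'.
  exists (fun v => exist _ (deform phi (raw (y v))) (deform_mtp hm p0 p1 (svalP (y v)))).
    by move=> v; exact: deform_type.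
  rewrite e /GJ_coords map_flatten -map_comp; congr flatten; apply: eq_map => v /=.
  by rewrite -deform_coords.
(* A boundary point of the cell would have a coordinate 1, and then so would [y], because 1 is fixed
   by the deformation. *)
- move=> _ [z [hz hcz] <-] v hb.
  have h1v : 1 \in GJ_coords z by apply/GJ_coordsP; exists v; exact: boundary_coords hb.
  have [phi [_ _ p1 e]] := same_simplex hcz hc.
  have : 1 \in GJ_coords y by rewrite e -p1 map_f.
  by case/GJ_coordsP => u hu; have := h1 u; rewrite /no_one hu.
Qed.

(** Bounds the dimension by a count of values in [S], which will be the lengths of the original
    point. *)
Lemma FM_cell_represents (S : seq R) P (X : GJcoprod R k) : represents P X ->
  (forall x, x \in gjm_pairs P -> no_one x) ->
  (forall x, x \in gjm_pairs P -> {subset coords x <= S}) ->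
  exists d e, [/\ (d <= size (interior S))%N, @FM_cell R k d e & e (FMpi X)].
Proof.
case: X => T X [_ h] h1 hS; have {}h (v : gj_vert T) := cid (h v).
pose y v := projT1 (h v); have hy (v : gj_vert T) : onth (gjm_pairs P) v = Some (raw (y v)) := (projT2 (h v)).1.
have hX : X = fun v => Wpi (y v).
  by apply: functional_extensionality_dep => v; exact: (projT2 (h v)).2.
have hin (v : gj_vert T) : raw (y v) \in gjm_pairs P.
  by have [s1 [s2 [-> _]]] := onth_some (hy v); rewrite mem_cat mem_head orbT.
have [e [he1 he2]] := FM_cell_point (fun v => h1 _ (hin v)).
exists (size (interior (GJ_coords y))), e; split=> //; last by rewrite hX.
apply: uniq_leq_size; first exact: undup_uniq.
move=> u; rewrite !mem_undup !mem_filter => /andP[-> /GJ_coordsP[v hv]].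
by rewrite (hS _ (hin v)).
Qed.

End Cells.

(** * The map of a 2-permutation *)

Section Labelling.
Variables (R : realType) (M : eqType).

Lemma lift_labels (A B : Type) (F : A -> seq unit) (F' : B -> seq M) (g : B -> A) (s : seq A) :
  (forall x t, List.In x s -> size t = size (F x) -> exists x', g x' = x /\ F' x' = t) ->
  forall t, size t = size (flatten (map F s)) ->
  exists s', map g s' = s /\ flatten (map F' s') = t.
Proof.
elim: s => [|x s IH] h t /=; first by move/size0nil->; exists [::].
rewrite size_cat => e.
have [|x' [ex et]] := h x (take (size (F x)) t) (or_introl erefl).
  by rewrite size_takel // e leq_addr.
have [||s' [es et']] := IH _ (drop (size (F x)) t).
- by move=> y u hy; apply: h; right.
- by rewrite size_drop e addKn.
by exists (x' :: s'); rewrite /= ex es et et' cat_take_drop.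
Qed.

Lemma exists_labels (b : btree R unit) (t : seq M) : size t = size (blabels b) ->
  exists b' : btree R M, strip b' = b /\ blabels b' = t.
Proof.
elim/btree_nested_ind: b t => [[]|l ss IH] t.
  by case: t => [|m []] // _; exists (Mark m).
rewrite [blabels _]/= => e.
have [|ss' [e1 e2]] := lift_labels (F := fun s1 => flatten (map (@blabels R unit) s1))
  (F' := fun s1 => flatten (map (@blabels R M) s1)) (g := map (@strip R M)) _ e.
  move=> s1 u /mem_In hs e1; apply: lift_labels e1 => x u' /mem_In hx e2; exact: IH hs hx _ e2.
exists (Comp l ss'); split=> //; rewrite /strip /= -/(strip _).
by congr Comp.
Qed.

End Labelling.

(** The marked vertices are numbered in planar order, the numbers are read off in the order of
    [groups], and each is replaced by the entry of [G] in that place. So the permutation between the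
    two orders need not be computed. *)
Lemma exists_groups (R : realType) (M : eqType) (x : tpair R unit) (G : seq (seq M)) : wf x ->
  map size (groups x.1 x.2) = map size G ->
  exists b : btree R M, strip b = x.1 /\ groups b x.2 = G.
Proof.
case: x => b s [/= hs ho _ _] e.
have [b' [eb el]] := exists_labels (t := iota 0 (size (blabels b))) (size_iota _ _).
have ho' : over s b' by rewrite -(over_bmap (fun=> tt)) -/(strip b') eb.
pose t := flatten (groups b' s).
have hp : perm_eq t (blabels b') := perm_groups_labels ho'.
have ht : uniq t by rewrite (perm_uniq hp) el iota_uniq.
have esz : map size (groups b' s) = map size G.
  rewrite -e -eb /strip groups_bmap -map_comp; apply: eq_map => g.
  by rewrite /= size_map.
have est : size t = size (flatten G) by rewrite !size_flatten /shape esz.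
(* Some label exists, which supplies the default value for [nth]. *)
case eG : (flatten G) => [|m0 G'].
  by have := over_has_label ho'; rewrite -(perm_size hp) est eG.
pose h j := nth m0 (flatten G) (index j t).
exists (bmap id h b'); split.
  rewrite -eb /strip; elim/btree_nested_ind: (b') => //= l ss IH; congr Comp.
  rewrite -map_comp; apply/eq_in_map => s1 h1 /=; rewrite -map_comp.
  by apply/eq_in_map => y hy; exact: IH h1 hy.
rewrite groups_bmap; apply: eq_from_flatten_shape; last first.
  by rewrite /shape -esz -map_comp; apply: eq_map => g /=; rewrite size_map.
rewrite -map_flatten -/t; apply: (@eq_from_nth _ m0); first by rewrite size_map.
move=> i; rewrite size_map => hi; rewrite (nth_map 0%N) // /h index_uniq //.
Qed.

Lemma raw_inj (R : realType) n : injective (@raw R n).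
Proof.
case=> x hx [y hy] e; have {}e : x = y by [].
by case: y / e hy => hy; congr exist; exact: bool_irrelevance.
Qed.

(** * The corolla and its forgetful map *)

Section Corolla.
Variables (R : realType) (n : seq nat) (sigma : seq (seq nat)).
Hypotheses (hn : has (predC1 0%N) n) (hsigma : two_perm n sigma).

Definition corolla : gj :=
  if flatten sigma is [:: i] then Leaf i
  else Node [seq [seq Leaf i | i <- a] | a <- sigma & ~~ nilp a].

Lemma size_flatten_sigma : size (flatten sigma) = sumn n.
Proof. by case: hsigma => <- _; rewrite size_flatten. Qed.

Lemma flatten_sigma_gt0 : (0 < size (flatten sigma))%N.
Proof.
rewrite size_flatten_sigma lt0n; apply/negP => /eqP e; have [k hk] := hasP hn.
move: e; rewrite sumnE => /eqP; rewrite sum_nat_seq_eq0 => /allP/(_ k hk) /=.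
by move=> h; rewrite h.
Qed.

Lemma corolla_leaves : gj_leaves corolla = flatten sigma.
Proof.
have key : gj_leaves (Node [seq [seq Leaf i | i <- a] | a <- sigma & ~~ nilp a]) = flatten sigma.
  rewrite [LHS]/= -map_comp -[RHS]flatten_filter_nil; congr flatten.
  rewrite -[RHS]map_id; apply: eq_map => a /=; rewrite -map_comp.
  by elim: a => //= i a ->.
by rewrite /corolla; case: (flatten sigma) key => [|i [|]].
Qed.

Lemma corolla_stable : gj_stable corolla.
Proof.
rewrite /corolla; case e: (flatten sigma) => [|i [|j t]] //.
  by have := flatten_sigma_gt0; rewrite e.
have e' : flatten [seq [seq Leaf i | i <- a] | a <- sigma & ~~ nilp a] = map Leaf (flatten sigma).
  by rewrite -[in RHS]flatten_filter_nil map_flatten.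
apply/and3P; split.
- by rewrite all_map; apply/allP => a; rewrite mem_filter => /andP[ha _] /=; rewrite size_map; case: a ha.
- by rewrite e' size_map e.
- rewrite all_map; apply/allP => a _ /=; rewrite all_map; exact/allP.
Qed.

Fact corolla_proof : gj_stable corolla && perm_eq (gj_leaves corolla) (iota 1 (sumn n)).
Proof. by rewrite corolla_stable corolla_leaves; case: hsigma. Qed.

Definition corolla_datum : gj_data (sumn n) := exist _ corolla corolla_proof.

Lemma corolla_types : gj_types corolla =
  if size (flatten sigma) == 1%N then [::] else [:: nz n].
Proof.
rewrite /corolla; case e: (flatten sigma) => [|i [|j t]] //=.
  by have := flatten_sigma_gt0; rewrite e.
congr cons; last first.
  by rewrite -map_comp; elim: [seq _ <- _ | _] => //= a s ->; rewrite cats0; elim: a.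
case: hsigma => <- _; rewrite /nz filter_map -!map_comp; under eq_map do rewrite /= size_map.
by [].
Qed.

(** For |n| = 1 the datum is a leaf and there is no [v]; this spares case distinctions later. *)
Lemma corolla_type (v : gj_vert corolla_datum) : gj_type v = nz n.
Proof.
rewrite /gj_type; case: v => v /=; rewrite corolla_types; case: ifP => // _.
by case: v.
Qed.

Lemma forget_mtp (v : gj_vert corolla_datum) (x : mtp R n) : mtp_set (gj_type v) (forget (raw x)).
Proof.
rewrite corolla_type; apply/mtp_setP; apply: forget_valid; apply/mtp_setP; exact: (svalP x).
Qed.

Definition forgetv (v : gj_vert corolla_datum) (x : mtp R n) : mtp R (gj_type v) :=
  exist _ (forget (raw x)) (forget_mtp v x).

(** Validity of an intermediate pair makes it a point of [mtp m]; the point is determined by the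
    pair through [raw_inj]. *)
Lemma vsteps_equiv m (y z : tpair R unit) : vsteps m y z -> valid m y ->
  valid m z /\ forall (a b : mtp R m), raw a = y -> raw b = z -> W_equiv R m a b.
Proof.
elim=> {y z} [y z [h1 h2 h3] _|y hy|y z w _ IH1 _ IH2 hy].
- split=> // a b ea eb; apply/asboolP; apply: rst_step; by rewrite ea eb.
- split; first exact: hy.
  move=> a b ea eb; have -> : a = b by apply: raw_inj; rewrite ea eb.
  by apply/asboolP; exact: rst_refl.
have [hz h1] := IH1 hy; have [hw h2] := IH2 hz; split=> // a b ea eb.
pose c : mtp R m := exist _ z ((mtp_setP m z).2 hz).
have /asboolP h3 := h1 a c ea erefl; have /asboolP h4 := h2 c b erefl eb.
by apply/asboolP; exact: rst_trans h3 h4.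
Qed.

Lemma forgetv_equiv v x y : W_equiv R n x y -> W_equiv R (gj_type v) (forgetv v x) (forgetv v y).
Proof.
have vx (z : mtp R n) : valid n (raw z) by apply/mtp_setP; exact: (svalP z).
move=> /asboolP; elim=> {x y} [x y h|x|x y _ /asboolP h|x y z _ /asboolP h1 _ /asboolP h2].
- have hs : vstep n (raw x) (raw y) by split.
  have [|_] := vsteps_equiv (forget_vstep hs); first exact: forget_valid.
  rewrite -(corolla_type v); exact.
- by apply/asboolP; exact: rst_refl.
- by apply/asboolP; exact: rst_sym.
- by apply/asboolP; exact: rst_trans h1 h2.
Qed.

Definition fsigma_point (x : mtp R n) : GJt R corolla_datum := fun v => Wpi (forgetv v x).

Definition fsigma (w : W R n) : FM R (sumn n) :=
  FMpi (existT (fun T => GJt R T) corolla_datum (fsigma_point (repr w))).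

(** Well-definedness: the chosen representative is equivalent to [x], and forgetting respects the
    equivalence. *)
Lemma fsigma_Wpi x : fsigma (Wpi x) = FMpi (existT (fun T => GJt R T) corolla_datum (fsigma_point x)).
Proof.
rewrite /fsigma; congr (FMpi (existT _ _ _)); apply: functional_extensionality_dep => v.
apply/Wpi_eqP; apply: forgetv_equiv; apply/Wpi_eqP; exact: reprK.
Qed.

End Corolla.

(** * Labelled representatives and their cells *)

Section Representation.
Variables (R : realType) (n : seq nat) (sigma : seq (seq nat)).
Hypotheses (hn : has (predC1 0%N) n) (hsigma : two_perm n sigma).
Variables (x : mtp R n) (b : btree R (gjm R)).
Hypotheses (eb : strip b = (raw x).1)
  (eg : groups b (raw x).2 = [seq [seq MLeaf R i | i <- a] | a <- sigma]).

Let P := mnode (forget (b, (raw x).2)).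
(** The value 0 is added for the dummies at the roots; it does not affect [interior]. *)
Let S := fun u : R => u \in 0 :: coords (raw x).

Lemma labelled_wf : wf (b, (raw x).2).
Proof.
case: (raw_wf x) => h1 h2 h3 h4; split=> //=.
  by rewrite -(over_bmap (fun=> tt)) -/(strip b) eb.
by rewrite -(blens_bmap (fun=> tt)) -/(strip b) eb.
Qed.

Lemma labelled_lens : lens_in S (b, (raw x).2).
Proof.
have key (t u : seq R) : head 0 t = 0 -> {subset behead t <= u} -> all (fun v => v \in 0 :: u) t.
  case: t => // l t /= -> h; rewrite mem_head /=; apply/allP => v /h hv; by rewrite inE hv orbT.
have [_ _ h1 h2] := raw_wf x; apply/andP; split; last first.
  by apply: key => // u hu; rewrite mem_cat hu orbT.
have -> : blens (b, (raw x).2).1 = blens (raw x).1.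
  by rewrite -eb -(blens_bmap (fun=> tt) b).
by apply: key => // u hu; rewrite mem_cat hu.
Qed.

Lemma labelled_labels m : m \in flatten (groups b (raw x).2) -> exists i, m = MLeaf R i.
Proof. by rewrite eg => /flattenP[_ /mapP[a _ ->] /mapP[i _ ->]]; exists i. Qed.

Lemma labelled_vgjm : vgjm S P /\ gjl P = flatten sigma.
Proof.
have [|h1 h2] := mnode_forget (mem_head _ _ : S 0) labelled_wf labelled_lens.
  by move=> m /labelled_labels[i ->]; exact: VLeaf.
split=> //; rewrite h2 eg -map_flatten -map_comp.
by elim: (flatten sigma) => //= i t ->.
Qed.

Lemma forget_groups : groups (forget (b, (raw x).2)).1 (forget (b, (raw x).2)).2 =
  [seq [seq MLeaf R i | i <- a] | a <- sigma & ~~ nilp a].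
Proof.
have [_ ->] := forget_spec labelled_wf; rewrite eg filter_map; congr map.
by apply: eq_filter => -[].
Qed.

Lemma forget_labels m : m \in blabels (forget (b, (raw x).2)).1 -> exists i, m = MLeaf R i.
Proof.
have [[_ ho _ _] _] := forget_spec labelled_wf.
rewrite -(perm_mem (perm_groups_labels ho)) forget_groups.
by case/flattenP=> _ /mapP[a _ ->] /mapP[i _ ->]; exists i.
Qed.

(** A pair reduced to a mark has one label and any other has at least two, so the clauses of [mnode]
    match those of [corolla]. *)
Lemma labelled_datum : gjm_datum P = corolla sigma.
Proof.
have [hw _] := forget_spec labelled_wf.
have hg := forget_groups.
have hf : map (@gjl R) (flatten (groups (forget (b, (raw x).2)).1 (forget (b, (raw x).2)).2)) =
    [seq [:: i] | i <- flatten sigma].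
  by rewrite hg -map_flatten flatten_filter_nil -map_comp.
have hnil : all (fun g => ~~ nilp g) (groups (forget (b, (raw x).2)).1 (forget (b, (raw x).2)).2).
  by rewrite hg all_map; apply/allP => a; rewrite mem_filter => /andP[h _]; case: a h.
rewrite /P; case: (forget _) hw hg hf hnil => [[m|l ss] s] [hs ho _ _] hg hf hnil.
  have {}ho : isleaf s := ho; case: s ho hs hg hf hnil => // _ _; rewrite /groups /= => hg.
  rewrite /corolla; case e: (flatten sigma) => [|i [|]] //= _ _.
  have : m \in flatten [seq [seq MLeaf R i | i <- a] | a <- sigma & ~~ nilp a].
    by rewrite -hg mem_head.
  by rewrite -map_flatten flatten_filter_nil e inE => /eqP->.
have {}ho : over s (Comp l ss) := ho; have {}hs : sok s := hs.
have h2 := two_labels hs ho hnil; rewrite [(_, _).1]/= [(_, _).2]/= in hg hf.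
rewrite /mnode [(_, _).1]/= [(_, _).2]/= gjm_datumE hg -map_comp /corolla.
have {}h2 : (1 < size (flatten sigma))%N.
  by move: h2; rewrite -(size_map (@gjl R)) hf size_map.
case: (flatten sigma) h2 => [|i [|j t]] // _; congr Node.
by apply: eq_map => a /=; rewrite -map_comp.
Qed.

Lemma labelled_represents :
  represents P (existT (fun T => GJt R T) (corolla_datum hn hsigma) (@fsigma_point _ _ _ hn hsigma x)).
Proof.
split; first exact: labelled_datum.
move=> v; exists (forgetv v x); split=> //.
have ed := labelled_datum; have [hv _] := labelled_vgjm.
have hvt : (v < size (gj_types (corolla sigma)))%N by exact: ltn_ord v.
have ex : raw (forgetv v x) = (strip (forget (b, (raw x).2)).1, (forget (b, (raw x).2)).2).
  transitivity (forget (raw x)); first by [].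
  by rewrite -forget_bmap -/(strip b) eb -surjective_pairing.
rewrite {}ex; move: (hvt); rewrite -ed /P; have := forget_labels; case: (forget (b, (raw x).2)) => [[m|l ss] s] hm.
  by have [|i ->] := hm m; first exact: mem_head.
move=> _; rewrite /mnode [(_, _).1]/= [(_, _).2]/= gjm_pairsE.
have H (j : nat) : (j < size (gj_types (corolla sigma)))%N -> j = 0%N.
  by rewrite (corolla_types hn hsigma); case: ifP => _; case: j.
by rewrite (H _ hvt).
Qed.

Lemma labelled_leaves c s m : P = MNode c s -> m \in blabels c -> exists i, m = MLeaf R i.
Proof.
have := forget_labels; rewrite /P; case: (forget _) => [[m'|l ss] s'] hm.
  by have [|i ->] := hm m'; first exact: mem_head.
by case=> <- _; exact: hm.
Qed.

Lemma interior_cons0 (t : seq R) : interior (0 :: t) = interior t.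
Proof. by rewrite /interior /= ltxx. Qed.

Lemma vgjm_coords (S' : pred R) Q : vgjm S' Q -> forall y u, y \in gjm_pairs Q -> u \in coords y -> S' u.
Proof.
move=> hQ y u /(vgjm_pairs hQ)[_ /andP[/allP h1 /allP h2]].
by rewrite mem_cat => /orP[/mem_behead/h1|/mem_behead/h2].
Qed.

Lemma fsigma_cell : exists d e, [/\ (d <= size (interior (coords (raw x))))%N,
  @FM_cell R (sumn n) d e & e (fsigma hn hsigma (Wpi x))].
Proof.
have [hv hl] := labelled_vgjm.
rewrite fsigma_Wpi -interior_cons0.
(* Without a length 1 the point already lies in an open cell of the corolla; otherwise it is first
   replaced by its image under the gluing. *)
case h1 : (has (fun y => 1 \in coords y) (gjm_pairs P)); last first.
  apply: (FM_cell_represents labelled_represents).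
    by move=> y hy; move/negbT/hasPn: h1 => /(_ y hy).
  by move=> y hy u; exact: (vgjm_coords hv hy).
have [hq hp] := q_map_ok (mem_head _ _ : S 0) hv labelled_leaves.
have [Y hY] : exists Y : GJcoprod R (sumn n), represents (q_map P) Y.
  apply: (vgjm_represents hq); rewrite (perm_trans hp) // hl.
  by case: hsigma.
(* A single instance of [FM_glue], with [P] as the decorated tree. *)
have -> : FMpi (existT (fun T => GJt R T) (corolla_datum hn hsigma) (@fsigma_point _ _ _ hn hsigma x)) = FMpi Y.
  apply/eqmodP/asboolP; apply: rst_step; exists P; split=> //; exact: labelled_represents.
apply: (FM_cell_represents hY) => y hy.
  by apply/negP => /(vgjm_coords hq hy)/andP[_]; rewrite eqxx.
by move=> u /(vgjm_coords hq hy)/andP[].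
Qed.

End Representation.

(** * Existence of labellings and images of skeleta *)

Section Skeleta.
Variables (R : realType) (n : seq nat) (sigma : seq (seq nat)).
Hypotheses (hn : has (predC1 0%N) n) (hsigma : two_perm n sigma).

Lemma exists_labelled (x : mtp R n) : exists b : btree R (gjm R), strip b = (raw x).1 /\
  groups b (raw x).2 = [seq [seq MLeaf R i | i <- a] | a <- sigma].
Proof.
apply: exists_groups; first exact: raw_wf.
have /mtp_setP[_ ->] := svalP x; case: hsigma => <- _.
by rewrite -map_comp; apply: eq_map => a /=; rewrite size_map.
Qed.

Lemma fsigma_is_fsigma : is_fsigma sigma (fsigma hn hsigma : W R n -> FM R (sumn n)).
Proof.
move=> x; have [b [eb eg]] := exists_labelled x.
exists b, (existT (fun T => GJt R T) (corolla_datum hn hsigma) (@fsigma_point _ _ _ hn hsigma x)).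
split=> //; first exact: labelled_represents.
exact: fsigma_Wpi.
Qed.

Lemma fsigma_skeleton d w : skeleton (@W_cell R n) d w ->
  skeleton (@FM_cell R (sumn n)) d (fsigma hn hsigma w).
Proof.
case=> d' [e [hd [S [tau [c [_ hc he]]]]]]; rewrite he => -[x [_ hx] <-].
have [b [eb eg]] := exists_labelled x.
have [d'' [e' [h1 h2 h3]]] := fsigma_cell hn hsigma eb eg.
exists d'', e'; split=> //; apply: leq_trans hd; apply: leq_trans h1 _.
by rewrite -hc (simplex_dimE hx).
Qed.

End Skeleta.

(** * Continuity on metric tree-pairs *)

Section Continuity.
Import numFieldNormedType.Exports.
Local Open Scope classical_set_scope.
Variable R : realType.

Lemma continuous_prod_topology (X : topologicalType) (I : Type) (T : I -> topologicalType)
    (f : X -> prod_topology T) : (forall i, continuous (fun x => f x i)) -> continuous f.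
Proof.
move=> h x; apply/cvg_sup => i.
exact: (@continuous_comp_initial _ _ _ (fun g : (forall i, T i) => g i) f (h i) x).
Qed.

(** The first component of [shape_coords] takes values in a discrete space. *)
Lemma near_tree_type n (x : mtp R n) : \forall y \near x, tree_type (raw y) = tree_type (raw x).
Proof.
apply: (@initial_continuous _ _ (@shape_coords R n) x [set p | p.1 = tree_type (raw x)]).
exists ([set tree_type (raw x)], setT) => [|[a b] [/= -> _]] //.
split; [exact: discrete_set1 | exact: filterT].
Qed.

Lemma coord_continuous n i : continuous (fun y : mtp R n => nth 0 (coords (raw y)) i : R).
Proof.
move=> y.
apply: (@continuous_comp _ _ _ (fun z : mtp R n => (shape_coords z).2) (@proj nat (fun=> R) i)).
  apply: (@continuous_comp _ _ _ (fun z : mtp R n => shape_coords z) snd).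
    exact: initial_continuous.
  exact: cvg_snd.
exact: proj_continuous.
Qed.

Lemma continuous_mtp n m (g : mtp R n -> mtp R m) :
  (forall x, \forall y \near x, tree_type (raw (g y)) = tree_type (raw (g x))) ->
  (forall i, continuous (fun y => nth 0 (coords (raw (g y))) i : R)) -> continuous g.
Proof.
move=> h1 h2; apply: (@continuous_comp_initial _ _ _ (@shape_coords R m) g) => x.
have c1 : (tree_type (raw (g y)) : discrete_topology (tpair unit unit)) @[y --> x] -->
    (tree_type (raw (g x)) : discrete_topology (tpair unit unit)).
  move=> A hA; apply: (@filterS _ _ (nbhs_filter x) _ _ _ (h1 x)) => y hy.
  rewrite /= hy; exact: nbhs_singleton hA.
have c2 : continuous (fun y : mtp R n => (fun i => nth 0 (coords (raw (g y))) i) : {ptws nat -> R}).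
  exact: (@continuous_prod_topology _ nat (fun=> R)).
exact: (@cvg_pair _ _ _ _ _ _ (nbhs_filter x) _ _ _ _ c1 (c2 x)).
Qed.

Definition close (e x y : R) := `|x - y| <= e.

Lemma close_max e x x' y y' : close e x x' -> close e y y' ->
  close e (Num.max x y) (Num.max x' y').
Proof.
rewrite /close !ler_norml => /andP[h1 h2] /andP[h3 h4].
by case: (leP x y) => h5; case: (leP x' y') => h6; lra.
Qed.

Lemma all2_nth (T T' : Type) (p : T -> T' -> bool) x0 y0 s t : p x0 y0 -> all2 p s t ->
  forall i, p (nth x0 s i) (nth y0 t i).
Proof.
move=> h0; elim: s t => [|x s IH] [|y t] //= h [|i] //=; case/andP: h => // _ h; exact: IH.
Qed.

Lemma nth_all2 (T T' : Type) (p : T -> T' -> bool) x0 y0 s t : size s = size t ->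
  (forall i, (i < size s)%N -> p (nth x0 s i) (nth y0 t i)) -> all2 p s t.
Proof.
elim: s t => [|x s IH] [|y t] //= [e] h; rewrite (h 0%N) //=.
by apply: IH => // i; exact: (h i.+1).
Qed.

Lemma prel_close (e : R) (x y : tpair R unit) : 0 <= e -> prel (close e) x y ->
  tree_type y = tree_type x /\
  forall i, close e (nth 0 (coords x) i) (nth 0 (coords y) i).
Proof.
move=> e0 /andP[hb hs]; split.
  have eu : (fun _ : unit => tt) = id by apply/funext => -[].
  by rewrite /tree_type (srel_shape hs) -eu (brel_shape hb).
move=> i; apply: all2_nth; first by rewrite /close subrr normr0.
have bh (s t : seq R) : all2 (close e) s t -> all2 (close e) (behead s) (behead t).
  by case: s t => [|u s] [|v t] //= /andP[].
by apply: all2_catI; apply: bh; [exact: brel_blens | exact: srel_slens].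
Qed.

Lemma close_prel (e : R) (x y : tpair R unit) : 0 <= e -> wf x -> wf y ->
  tree_type y = tree_type x ->
  (forall i, close e (nth 0 (coords x) i) (nth 0 (coords y) i)) -> prel (close e) x y.
Proof.
move=> e0 [_ _ hb hs] [_ _ hb' hs'] [eb es] h.
have eu : (fun _ : unit => tt) = id by apply/funext => -[].
have zb : size (blens x.1) = size (blens y.1).
  have := congr1 (fun b => size (blens b)) eb; by rewrite !blens_map !size_map.
have zs : size (slens x.2) = size (slens y.2).
  have := congr1 (fun s => size (slens s)) es; by rewrite !slens_map !size_map.
apply/andP; split.
  apply: shape_brel; first by rewrite eu eb.
  (* Entry 0 is the dummy at the root, equal to 0 on both sides; the others are [coords] shifted by
     one. *)
  apply: (nth_all2 (x0 := 0) (y0 := 0)) => // -[|i] hi.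
    by rewrite !nth0 hb hb' /close subrr normr0.
  have hi1 : (i < size (behead (blens x.1)))%N by rewrite size_behead -ltnS prednK // (leq_trans _ hi).
  by have := h i; rewrite !nth_cat !size_behead -zb -size_behead hi1 !nth_behead.
apply: shape_srel; first by rewrite es.
apply: (nth_all2 (x0 := 0) (y0 := 0)) => // -[|i] hi.
  by rewrite !nth0 hs hs' /close subrr normr0.
have := h (size (behead (blens x.1)) + i)%N; rewrite !nth_cat !size_behead -zb -!size_behead.
by rewrite ltnNge leq_addr /= addKn !nth_behead.
Qed.

(** Near [x] the shape is fixed, and only the finitely many coordinates below
    [size (coords (raw x))] have to be controlled; the rest are defaults. *)
Lemma near_prel n (x : mtp R n) (e : R) : 0 < e ->
  \forall y \near x, prel (close e) (raw x) (raw y).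
Proof.
move=> e0; pose I := 'I_(size (coords (raw x))).
have hc : \forall y \near x, forall i : I,
    close e (nth 0 (coords (raw x)) i) (nth 0 (coords (raw y)) i).
  apply: (@filter_forall _ I _ _ (nbhs_filter x)) => i.
  exact: (@cvgrPdist_le R R _ _ (nbhs_filter x) _ _).1 (@coord_continuous n i x) e e0.
apply: (@filterS2 _ _ (nbhs_filter x) _ _ _ _ (near_tree_type x) hc) => y ht hi.
apply: close_prel => //; [exact: ltW | exact: raw_wf | exact: raw_wf |].
move=> i; have [hs|hs] := ltnP i (size (coords (raw x))); first exact: (hi (Ordinal hs)).
rewrite !nth_default //; first by rewrite /close subrr normr0 ltW.
by rewrite -size_coords_type ht size_coords_type.
Qed.

End Continuity.

Section FsigmaContinuous.
Import numFieldNormedType.Exports.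
Local Open Scope classical_set_scope.
Variables (R : realType) (n : seq nat) (sigma : seq (seq nat)).
Hypotheses (hn : has (predC1 0%N) n) (hsigma : two_perm n sigma).

(** Forgetting preserves closeness with the same [e], since maxima do; this yields both local
    constancy of the shape and continuity of each coordinate. *)
Lemma forgetv_continuous (v : gj_vert (corolla_datum hn hsigma)) :
  continuous (@forgetv R n sigma hn hsigma v).
Proof.
have key (e : R) (x : mtp R n) : 0 < e ->
    \forall y \near x, prel (close e) (raw (forgetv v x)) (raw (forgetv v y)).
  move=> e0; apply: (@filterS _ _ (nbhs_filter x) _ _ _ (near_prel x e0)) => y h.
  apply: forget_rel h; [by rewrite /close subrr normr0 ltW | exact: close_max].
apply: continuous_mtp => [x|i x].
  apply: (@filterS _ _ (nbhs_filter x) _ _ _ (key 1 x ltr01)) => y.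
  by case/(prel_close ler01).
apply: (@cvgrPdist_le R R _ _ (nbhs_filter x) _ _).2 => e e0.
apply: (@filterS _ _ (nbhs_filter x) _ _ _ (key e x e0)) => y.
by case/(prel_close (ltW e0)) => _; exact.
Qed.

Lemma fsigma_continuous : continuous (fsigma hn hsigma : W R n -> FM R (sumn n)).
Proof.
(* It is enough to test before passing to the quotient, where the map is forgetting followed by the
   projections and the inclusion into the coproduct. *)
apply/quotient_continuous => x.
have -> : fsigma hn hsigma \o \pi_(W R n)%qT = @FMpi R (sumn n) \o
    (existT (fun T => GJt R T) (corolla_datum hn hsigma) \o @fsigma_point R n sigma hn hsigma).
  by apply/funext => y; exact: fsigma_Wpi.
apply: continuous_comp; last exact: pi_continuous.
apply: continuous_comp; last exact: existT_continuous.
apply: continuous_prod_topology => v y.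
apply: (@continuous_comp _ _ _ (@forgetv R n sigma hn hsigma v) (@Wpi R (gj_type v))).
  exact: forgetv_continuous.
exact: pi_continuous.
Qed.

End FsigmaContinuous.

Theorem mainTheorem2 (R : realType) (r : nat) (n : r.-tuple nat)
    (sigma : r.-tuple (seq nat))
    (hr : (1 <= r)%N) (hn : exists i : 'I_r, tnth n i <> 0%N)
    (hsigma : two_perm n sigma) :
  exists f : W R n -> FM R (sumn n),
    is_fsigma sigma f /\
    cellular (@W_cell R n) (@FM_cell R (sumn n)) f.
Proof.
have hn' : has (predC1 0%N) n.
  by case: hn => i /eqP hi; apply/hasP; exists (tnth n i); rewrite ?mem_tnth.
exists (fsigma hn' hsigma); split; first exact: fsigma_is_fsigma.
split; first exact: fsigma_continuous.
by move=> d _ [w hw <-]; exact: fsigma_skeleton.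
Qed.
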